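(* Let $\mathcal P_t=e^{t\mathcal L}$ be a (not necessarily primitive) quantum Markov semigroup on $\mathcal B(\mathcal H)$, $\dim\mathcal H<\infty$, satisfying the $\sigma$-GNS detailed balance condition for some full-rank state $\sigma\in\mathcal D_+(\mathcal H)$. Then for every $p\in(1,2]$ the non-primitive Beckner inequality $$\alpha_p\,\mathcal F_{p,E_{\mathcal F}^\dagger(\rho)}(\rho)\le p^{-2}\,\mathcal E_{p,\mathcal L}\big(\Gamma_{E_{\mathcal F}^\dagger(\rho)}^{-1}(\rho)\big)\qquad\text{for all }\rho\in\mathcal D_+(\mathcal H)$$ holds, with optimal constant $\alpha_p(\mathcal L)$ satisfying $$\alpha_p(\mathcal L)\ \ge\ \frac p4\,C(E_{\mathcal F})^{p-2}\,\lambda(\mathcal L).$$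
   Context: $\mathcal D(\mathcal H)$, $\mathcal D_+(\mathcal H)$ are the density operators and the full-rank ones; $\dagger$ is the adjoint for $\langle X,Y\rangle=\mathrm{Tr}(X^*Y)$. A quantum Markov semigroup is a $C_0$-semigroup of completely positive unital maps with generator $\mathcal L$. The $\sigma$-GNS detailed balance condition means that $\mathcal L$ is self-adjoint for $\mathrm{Tr}(\sigma X^*Y)$; then $\sigma$ is invariant ($\mathcal P_t^\dagger(\sigma)=\sigma$), and the condition does not depend on the choice of full-rank invariant state. $\mathcal F=\{X\in\mathcal B(\mathcal H):\mathcal P_t(X)=X\ \forall t\ge0\}$ is the fixed-point algebra and $E_{\mathcal F}$ the associated conditional expectation onto it, $E_{\mathcal F}(X)=\lim_{t\to\infty}\mathcal P_t(X)$. For $\rho\in\mathcal D_+(\mathcal H)$, $E_{\mathcal F}^\dagger(\rho)$ is a full-rank invariant state. The subalgebra index is $C(E_{\mathcal F})=\inf\{c>0:\rho\le c\,E_{\mathcal F}^\dagger(\rho)\ \forall\rho\in\mathcal D(\mathcal H)\}$. For a full-rank state $\tau$: $\Gamma_\tau^s(X)=\tau^{s/2}X\tau^{s/2}$, $\|X\|_{p,\tau}=\mathrm{Tr}(|\Gamma_\tau^{1/p}(X)|^p)^{1/p}$, $\mathcal F_{p,\tau}(\rho)=\frac1{p(p-1)}\big(\|\Gamma_\tau^{-1}(\rho)\|_{p,\tau}^p-1\big)$. With $\hat p=p/(p-1)$, for $X>0$, $$\mathcal E_{p,\mathcal L}(X)=-\frac{\hat p\,p}{4}\mathrm{Tr}\Big(\tau^{1/2}\,\Gamma_\tau^{-1/\hat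 p}\big((\Gamma_\tau^{1/p}(X))^{p-1}\big)\,\tau^{1/2}\,\mathcal L(X)\Big),$$ where in the Beckner inequality the reference state is $\tau=E_{\mathcal F}^\dagger(\rho)$. $\alpha_p(\mathcal L)$ is the largest constant for which the Beckner inequality holds. The spectral gap is $$\lambda(\mathcal L)=\inf_{X\in\mathcal B(\mathcal H),\,X\notin\mathcal F}\frac{-\langle X,\mathcal L(X)\rangle_{\tau,f}}{\|X-E_{\mathcal F}(X)\|_{\tau,f}^2},$$ for a full-rank invariant state $\tau$ and $f:(0,\infty)\to(0,\infty)$, where $\langle X,Y\rangle_{\tau,f}=\langle X,R_\tau f(\Delta_\tau)(Y)\rangle$, $R_\tau(Y)=Y\tau$, $\Delta_\tau(Y)=\tau Y\tau^{-1}$; its value does not depend on the choice of $\tau$ and $f$ (e.g. $f(x)=x^{1/2}$ gives $\langle X,Y\rangle_{\tau,f}=\mathrm{Tr}(\tau^{1/2}X^*\tau^{1/2}Y)$). *)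

(* Defs.v *)
From HB Require Import structures.
From mathcomp Require Import all_boot all_order all_algebra.
From mathcomp Require Import sesquilinear spectral complex.
From mathcomp Require Import all_classical all_reals all_analysis.

Set Implicit Arguments.
Unset Strict Implicit.
Unset Printing Implicit Defensive.

Import Order.TTheory GRing.Theory Num.Theory.
Import numFieldNormedType.Exports.

Local Open Scope classical_set_scope.
Local Open Scope sesquilinear_scope.
Local Open Scope complex_scope.
Local Open Scope ring_scope.

(* B(H) for dim H = n is 'M[R[i]]_n.  R[i] gets the topology of its modulus,
   so that matrices get the (unique) Hausdorff vector space topology. *)
HB.instance Definition _ (R : realType) :=
  PseudoPointedMetric.copy R[i] R[i]^o.
HB.instance Definition _ (R : realType) := NormedModule.copy R[i] R[i]^o.

Section Matrices.
Variables (R : realType) (n : nat).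
Local Notation C := R[i].
Implicit Types (A X Y rho : 'M[C]_n) (Phi : 'M[C]_n -> 'M[C]_n).

(* 0 <= z in R[i] means that z is real and nonnegative; hence psdmx A
   forces A to be Hermitian. *)
Definition psdmx A : Prop := forall u : 'rV[C]_n, 0 <= (u *m A *m u ^t*) 0 0.

Definition lemx A B : Prop := psdmx (B - A).

Definition density rho : Prop := psdmx rho /\ \tr rho = 1.

Definition full_density rho : Prop := density rho /\ rho \in unitmx.

Definition hsdot X Y : C := \tr (X ^t* *m Y).

(* Adjoint for hsdot: the (i, j) entry of Z is hsdot (delta_mx i j) Z. *)
Definition adjsup Phi Y : 'M[C]_n :=
  \matrix_(i, j) hsdot (Phi (delta_mx i j)) Y.

(* f(A) for A Hermitian, through A = U^-1 diag(d) U with U unitary and d real. *)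
Definition mxfun (f : R -> R) A : 'M[C]_n :=
  invmx (spectralmx A) *m
  diag_mx (map_mx (fun z : C => (f (complex.Re z))%:C) (spectral_diag A)) *m
  spectralmx A.

Definition mxpow A (s : R) : 'M[C]_n := mxfun (fun x => x `^ s) A.

Definition absmx X : 'M[C]_n := mxpow (X ^t* *m X) 2^-1.

End Matrices.

Lemma adjsupE (R : realType) (n : nat)
    (Phi : {linear 'M[R[i]]_n -> 'M[R[i]]_n}) (X Y : 'M[R[i]]_n) :
  hsdot X (adjsup Phi Y) = hsdot (Phi X) Y.
Proof.
have hsE (Z W : 'M[R[i]]_n) : hsdot Z W = \sum_i \sum_j (Z i j)^* * W i j.
  rewrite /hsdot /mxtrace exchange_big; apply: eq_bigr => j _.
  by rewrite mxE; apply: eq_bigr => i _; rewrite !mxE.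
have hsl Z W (c : R[i]) (D : 'M[R[i]]_n) :
    hsdot (c *: Z + D) W = c^* * hsdot Z W + hsdot D W.
  by rewrite /hsdot linearD/= linearZ /= map_mxD map_mxZ mulmxDl mxtraceD
    -scalemxAl mxtraceZ.
rewrite [in RHS](matrix_sum_delta X) hsE.
have hs0 W : hsdot 0 W = 0 by rewrite /hsdot trmx0 map_mx0 mul0mx mxtrace0.
have hssum (I : finType) (F : I -> 'M[R[i]]_n) W :
    hsdot (\sum_i F i) W = \sum_i hsdot (F i) W.
  apply: (big_morph (fun Z => hsdot Z W)) => // Z D.
  by rewrite -[Z]scale1r hsl rmorph1 mul1r scale1r.
rewrite linear_sum hssum; apply: eq_bigr => i _.
rewrite linear_sum hssum; apply: eq_bigr => j _.
by rewrite linearZ /= -[_ *: _]addr0 hsl hs0 addr0 mxE.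
Qed.

Section Semigroups.
Variables (R : realType) (n : nat).
Local Notation C := R[i].
Implicit Types (P : R -> {linear 'M[C]_n -> 'M[C]_n}).
Implicit Types (L : {linear 'M[C]_n -> 'M[C]_n}).
Implicit Types (X Y rho sigma tau : 'M[C]_n) (p s : R).

(* M_k(B(H)) is the type of k x k block matrices with n x n blocks, on which
   id (x) Phi acts blockwise. *)
Definition completely_positive (Phi : 'M[C]_n -> 'M[C]_n) : Prop :=
  forall (k : nat) (A : 'M[C]_(\sum_(i < k) n, \sum_(j < k) n)),
    psdmx A ->
    psdmx (\mxblock_(i < k, j < k) Phi (submxblock A i j)).

(* The values P t at t < 0 are irrelevant. *)
Record qms P : Prop := Qms {
  qms0 : forall X, P 0 X = X;
  qmsD : forall s t : R, 0 <= s -> 0 <= t -> forall X, P (s + t) X = P s (P t X);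
  qms_cvg0 : forall X, P t X @[t --> 0^'+] --> X;
  qms_cp : forall t : R, 0 <= t -> completely_positive (P t);
  qms_unital : forall t : R, 0 <= t -> P t 1%:M = 1%:M
}.

Definition generator_of P L : Prop :=
  forall X, (t^-1)%:C *: (P t X - X) @[t --> 0^'+] --> L X.

Definition gns_symmetric sigma L : Prop :=
  forall X Y, \tr (sigma *m X ^t* *m L Y) = \tr (sigma *m (L X) ^t* *m Y).

Definition invariant_state P tau : Prop :=
  forall t : R, 0 <= t -> adjsup (P t) tau = tau.

Definition fixed_points P : set 'M[C]_n :=
  [set X | forall t : R, 0 <= t -> P t X = X].

Definition cond_exp P X : 'M[C]_n := lim (P t X @[t --> +oo]).

Definition cond_exp_adj P : 'M[C]_n -> 'M[C]_n := adjsup (cond_exp P).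

Definition subalg_index P : R :=
  inf [set c : R | 0 < c /\
    forall rho, density rho -> lemx rho (c%:C *: cond_exp_adj P rho)].

Definition weight tau s X : 'M[C]_n :=
  mxpow tau (s / 2) *m X *m mxpow tau (s / 2).

Definition wnorm p tau X : R :=
  (complex.Re (\tr (mxpow (absmx (weight tau p^-1 X)) p))) `^ p^-1.

Definition pdivergence p tau rho : R :=
  (p * (p - 1))^-1 * (wnorm p tau (weight tau (- 1) rho) `^ p - 1).

(* All the traces whose real part is taken below are real for the arguments
   of interest. *)
Definition dirichlet p tau L X : R :=
  let hp := p / (p - 1) in
  - (hp * p / 4) *
  complex.Re (\tr (mxpow tau 2^-1 *m
     weight tau (- hp^-1) (mxpow (weight tau p^-1 X) (p - 1)) *m
     mxpow tau 2^-1 *m L X)).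

Definition beckner P L p (alpha : R) : Prop :=
  forall rho, full_density rho ->
    let tau := cond_exp_adj P rho in
    alpha * pdivergence p tau rho <=
      p ^- 2 * dirichlet p tau L (weight tau (- 1) rho).

(* Extended real: it is +oo when every P t is the identity. *)
Definition beckner_constant P L p : \bar R :=
  ereal_sup [set alpha%:E | alpha in [set alpha | beckner P L p alpha]].

Definition modular_op tau Y : 'M[C]_n := tau *m Y *m invmx tau.

(* f(Delta_tau), Delta_tau being represented by its matrix in the basis of
   matrix units, which is orthonormal for hsdot. *)
Definition modular_fun (f : R -> R) tau Y : 'M[C]_n :=
  vec_mx (mxvec Y *m mxfun f (lin_mx (modular_op tau))).

Definition wdot tau (f : R -> R) X Y : C :=
  hsdot X (modular_fun f tau Y *m tau).

(* The infimum is over the empty set, hence +oo, when every P t is the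
   identity. *)
Definition spectral_gap P L tau (f : R -> R) : \bar R :=
  ereal_inf [set (- complex.Re (wdot tau f X (L X)) /
     complex.Re (wdot tau f (X - cond_exp P X) (X - cond_exp P X)))%:E
   | X in ~` fixed_points P].

End Semigroups.

(* Main.v *)
(** Put X = tau^(-1/2) rho tau^(-1/2) and Y = tau^(1/2p) X tau^(1/2p).  Up to a
    factor, the Dirichlet form is minus Tr(Y^(p-1) tau^(1/2p) L(X) tau^(1/2p)),
    the derivative at t = 0 of the same expression with X - P_t X.

    The semigroup is also GNS-symmetric for tau = E^dagger(rho), because tau is
    sigma times a fixed point and fixed points commute with the Kraus operators
    of P_t.  Hence P_t has Kraus operators K with tau K = r K tau, and the
    contribution of each K is a sum over the eigenvalues u, v of Y (scaled by
    powers of r) of (u - v)(u^(p-1) - v^(p-1)) times the square of a matrix entry.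
    The divided difference of u^(p-1) is a positive combination of products of
    resolvents, so as a quadratic form it decreases when Y is replaced by the
    larger operator c tau^(1/p), c = C(E).  By homogeneity this leaves c^(p-2)
    times the GNS form of tau at X', the image of X under a Schur multiplier.

    As E(X) = 1, E(X') is the scalar (p-1)^(1/2), so the Poincare inequality bounds
    the form below by the gap times <X', X'> - (p - 1), which dominates
    Tr(Y^p) - 1 by convexity. *)
Require Import Defs.
From HB Require Import structures.
From mathcomp Require Import all_boot all_order all_algebra.
From mathcomp Require Import sesquilinear spectral complex.
From mathcomp Require Import all_classical all_reals all_analysis.
From mathcomp Require Import ring lra.

Set Implicit Arguments.
Unset Strict Implicit.
Unset Printing Implicit Defensive.

Import Order.TTheory GRing.Theory Num.Theory.
Import numFieldNormedType.Exports.

Local Open Scope classical_set_scope.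
Local Open Scope sesquilinear_scope.
Local Open Scope ring_scope.

(** The obstacle is that Y does not commute with tau: the quadratic forms built from the divided
    differences of u^(p-1) at Y and at tau^(1/p) are diagonal in unrelated eigenbases and cannot be
    compared eigenvalue by eigenvalue. With resolvents this is possible, since inversion is operator
    antitone in whatever bases the two matrices are diagonal. The convexity bound comes from the
    tangent to the operator convex function 1/x by the same device, so both halves rest on the
    transfer principle [divpow_ge0_comb].

    The multiplier that defines X' depends only on ratios of eigenvalues of tau. It is thus a
    function of the modular operator, and commutes with every GNS-symmetric map, in particular with
    E.

    Kraus operators belong to P_h and not to L, so the comparison is made for X - P_h X, divided by
    h, and passed to the limit.

    The gap enters only through eigenvalues of L, whose Rayleigh quotients do not depend on the
    state or on f. The factor p/4 is a quotient of normalizations: 1/(4(p-1)) is left in front of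
    the Dirichlet trace, against 1/(p(p-1)) in the divergence. *)

Local Notation "x %:C" := (real_complex _ x) (format "x %:C") : ring_scope.
Local Notation Re := complex.Re.
Local Notation Im := complex.Im.

(** * Adjoints, real parts and squared moduli *)

Section ConjTranspose.
Variable R : realType.
Local Notation C := R[i].

Lemma trmxC_mul m n q (A : 'M[C]_(m, n)) (B : 'M[C]_(n, q)) :
  (A *m B)^t* = B^t* *m A^t*.
Proof. by rewrite trmx_mul map_mxM. Qed.

Lemma trmxCD m n (A B : 'M[C]_(m, n)) : (A + B)^t* = A^t* + B^t*.
Proof. by rewrite linearD /= map_mxD. Qed.

Lemma trmxCN m n (A : 'M[C]_(m, n)) : (- A)^t* = - A^t*.
Proof. by rewrite linearN /= map_mxN. Qed.

Lemma trmxCB m n (A B : 'M[C]_(m, n)) : (A - B)^t* = A^t* - B^t*.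
Proof. by rewrite trmxCD trmxCN. Qed.

Lemma trmxCZ m n (c : C) (A : 'M[C]_(m, n)) : (c *: A)^t* = c^* *: A^t*.
Proof. by rewrite linearZ /= map_mxZ. Qed.

Lemma trmxC1 n : (1%:M : 'M[C]_n)^t* = 1%:M.
Proof. by rewrite trmx1 map_mx1. Qed.

Lemma trmxC_sum m n (I : finType) (P : pred I) (F : I -> 'M[C]_(m, n)) :
  (\sum_(i | P i) F i)^t* = \sum_(i | P i) (F i)^t*.
Proof. by rewrite linear_sum /= (raddf_sum (map_mx _)). Qed.

Lemma trmxCE m n (A : 'M[C]_(m, n)) i j : A^t* i j = (A j i)^*.
Proof. by rewrite !mxE. Qed.

Lemma conjc_realC (x : R) : (x%:C)^* = x%:C.
Proof. exact: conjc_real. Qed.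

Lemma trmxCZr m n (c : R) (A : 'M[C]_(m, n)) : (c%:C *: A)^t* = c%:C *: A^t*.
Proof. by rewrite trmxCZ conjc_realC. Qed.

Lemma mxtraceC n (A : 'M[C]_n) : \tr (A^t*) = (\tr A)^*.
Proof.
by rewrite /mxtrace rmorph_sum; apply: eq_bigr => i _; rewrite trmxCE.
Qed.

Definition absq (z : C) : R := Re z ^+ 2 + Im z ^+ 2.

Lemma absqE z : (absq z)%:C = z^* * z.
Proof. by rewrite /absq add_Re2_Im2 normCK mulrC. Qed.

Lemma absq_ge0 z : 0 <= absq z.
Proof. by rewrite addr_ge0 // sqr_ge0. Qed.

Lemma absqM z w : absq (z * w) = absq z * absq w.
Proof.
by apply: complexI; rewrite rmorphM /= !absqE rmorphM mulrACA.
Qed.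

Lemma absqr (x : R) : absq x%:C = x ^+ 2.
Proof. by rewrite /absq /= expr0n addr0. Qed.

Lemma cReD (z w : C) : Re (z + w) = Re z + Re w. Proof. by case: z w => [??] []. Qed.
Lemma cReN (z : C) : Re (- z) = - Re z. Proof. by case: z. Qed.
Lemma cReB (z w : C) : Re (z - w) = Re z - Re w. Proof. by rewrite cReD cReN. Qed.
Lemma cReMl (x : R) (z : C) : Re (x%:C * z) = x * Re z.
Proof. by case: z => a b /=; rewrite mul0r subr0. Qed.
Lemma cRe_conj (z : C) : Re (z^*) = Re z. Proof. by case: z. Qed.
Lemma Re_sum (I : finType) (P : pred I) (F : I -> C) :
  Re (\sum_(i | P i) F i) = \sum_(i | P i) Re (F i).
Proof. by rewrite (big_morph (@Re R) cReD (erefl _)). Qed.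
Lemma Re_ge0 (z : C) : 0 <= z -> 0 <= Re z.
Proof. by rewrite lecE => /andP[]. Qed.
Lemma Re_real (z : C) : 0 <= z -> (Re z)%:C = z.
Proof. by move/ger0_real/RRe_real. Qed.

End ConjTranspose.

(** * Positive semidefinite matrices *)

Section Positive.
Variable R : realType.
Local Notation C := R[i].

Lemma mx11_trace (A : 'M[C]_1) : A 0 0 = \tr A.
Proof. by rewrite /mxtrace big_ord1. Qed.

Lemma gram_ge0 m n (A : 'M[C]_(m, n)) : 0 <= \tr (A^t* *m A).
Proof.
apply: sumr_ge0 => i _; rewrite mxE; apply: sumr_ge0 => j _.
by rewrite trmxCE mulrC mul_conjC_ge0.
Qed.

Lemma gram_eq0 m n (A : 'M[C]_(m, n)) : \tr (A^t* *m A) = 0 -> A = 0.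
Proof.
move=> /eqP; rewrite psumr_eq0; last first.
  move=> i _; rewrite mxE; apply: sumr_ge0 => j _.
  by rewrite trmxCE mulrC mul_conjC_ge0.
move=> /allP h; apply/matrixP => i j; rewrite [RHS]mxE.
have := h j (mem_index_enum _); rewrite mxE psumr_eq0; last first.
  by move=> k _; rewrite trmxCE mulrC mul_conjC_ge0.
move=> /allP /(_ i (mem_index_enum _)); rewrite trmxCE.
by rewrite mulrC mul_conjC_eq0 => /eqP.
Qed.

Lemma psd_gram m n (S : 'M[C]_(m, n)) : psdmx (S^t* *m S).
Proof.
move=> u; rewrite mx11_trace !mulmxA -mulmxA -{1}[u]trmxCK -trmxC_mul.
exact: gram_ge0.
Qed.

Lemma psd_congr m n (A : 'M[C]_n) (G : 'M[C]_(n, m)) :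
  psdmx A -> psdmx (G^t* *m A *m G).
Proof.
move=> pA u; have := pA (u *m G^t*).
by rewrite trmxC_mul trmxCK !mulmxA.
Qed.

Lemma psdD n (A B : 'M[C]_n) : psdmx A -> psdmx B -> psdmx (A + B).
Proof.
by move=> pA pB u; rewrite mulmxDr mulmxDl mxE addr_ge0 ?pA ?pB.
Qed.

Lemma psd0 n : psdmx (0 : 'M[C]_n).
Proof. by move=> u; rewrite mulmx0 mul0mx mxE. Qed.

Lemma psd_sum n (I : finType) (P : pred I) (F : I -> 'M[C]_n) :
  (forall i, P i -> psdmx (F i)) -> psdmx (\sum_(i | P i) F i).
Proof.
by move=> h; apply: (big_ind (@psdmx R n)); [exact: psd0 | exact: psdD | exact: h].
Qed.

Lemma psdZ n (c : R) (A : 'M[C]_n) : 0 <= c -> psdmx A -> psdmx (c%:C *: A).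
Proof.
move=> c0 pA u; rewrite -scalemxAr -scalemxAl mxE mulr_ge0 ?pA //.
by rewrite ler0c.
Qed.

Lemma psd1 n : psdmx (1%:M : 'M[C]_n).
Proof. by have := @psd_gram n n 1%:M; rewrite trmxC1 mulmx1. Qed.

(** The form takes real values; polarization at [u + v] and at ['i *: u + v] turns this into
    Hermitian symmetry. *)
Lemma psd_herm n (A : 'M[C]_n) : psdmx A -> A^t* = A.
Proof.
move=> pA; pose q (u v : 'rV[C]_n) : C := (u *m A *m v^t*) 0 0.
have qD u v w : q (u + v) w = q u w + q v w by rewrite /q !mulmxDl mxE.
have qDr u v w : q w (u + v) = q w u + q w v.
  by rewrite /q trmxCD mulmxDr mxE.
have qZ c u v : q (c *: u) v = c * q u v by rewrite /q -!scalemxAl mxE.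
have qZr c u v : q v (c *: u) = c^* * q v u.
  by rewrite /q trmxCZ -scalemxAr mxE.
have qr u : (q u u)^* = q u u.
  by apply/CrealP; apply: ger0_real; apply: pA.
have e1 u v : (q u v)^* + (q v u)^* = q u v + q v u.
  have := qr (u + v); rewrite !(qD, qDr) !rmorphD /= !qr -!addrA.
  by move/addrI; rewrite !addrA => /addIr.
have e2 u v : (q u v)^* = q v u.
  have := e1 ('i *: u) v; rewrite qZ qZr !rmorphM /= conjCK conjCi => h.
  apply: (mulfI (neq0Ci C)); move: h (e1 u v); set a := (q u v)^*.
  set b := (q v u)^*; set c := q u v; set d := q v u; set i := 'i => h h'.
  apply: (mulfI (x := 2)); first by rewrite pnatr_eq0.
  suff -> : 2 * (i * d) = i * (c + d) - (i * c + - i * d) by rewrite -h -h'; ring.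
  by ring.
have qE (M : 'M[C]_n) i j :
    (delta_mx (0 : 'I_1) i *m M *m (delta_mx (0 : 'I_1) j)^t*) 0 0 = M i j.
  rewrite -rowE mxE (bigD1 j) //= big1 => [|k kj].
    by rewrite addr0 !mxE !eqxx rmorph1 mulr1.
  by rewrite !mxE (negbTE kj) andbF rmorph0 mulr0.
apply/matrixP => i j; rewrite trmxCE -[RHS]qE -[in LHS](qE A j i).
exact: e2.
Qed.

Lemma psd_hermsym n (A : 'M[C]_n) : A^t* = A -> A \is hermsymmx.
Proof. by move=> h; rewrite is_hermitianmxE expr0 scale1r h. Qed.

End Positive.

(** * Functional calculus through unitary diagonalizations *)

Section FunctionalCalculus.
Variables (R : realType) (n : nat).
Local Notation C := R[i].
Implicit Types (U V : 'M[C]_n) (a b : 'I_n -> R).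

(* Locked, since rewriting with mulmxA would otherwise see through it. *)
Fact udiag_key : unit. Proof. by []. Qed.
Definition udiag U a : 'M[C]_n :=
  locked_with udiag_key (U^t* *m diag_mx (\row_i (a i)%:C) *m U).

Lemma udiagE U a : udiag U a = U^t* *m diag_mx (\row_i (a i)%:C) *m U.
Proof. by rewrite /udiag unlock. Qed.

Lemma eq_mul_diag (A B : 'M[C]_n) d e :
  d = e -> A *m diag_mx d *m B = A *m diag_mx e *m B.
Proof. by move=> ->. Qed.

Lemma mul_diag_diag (A B : 'M[C]_n) (a b : 'rV[C]_n) :
  A *m diag_mx a *m diag_mx b *m B = A *m diag_mx (\row_i (a 0 i * b 0 i)) *m B.
Proof. by rewrite -(mulmxA A) mulmx_diag. Qed.

Lemma unitaryK U : U \is unitarymx -> U *m U^t* = 1%:M.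
Proof. by move/unitarymxP. Qed.

Lemma unitaryKC U : U \is unitarymx -> U^t* *m U = 1%:M.
Proof. by rewrite -trmxC_unitary => /unitarymxP; rewrite trmxCK. Qed.

Lemma eq_udiag U a b : a =1 b -> udiag U a = udiag U b.
Proof. by move=> h; rewrite !udiagE; apply: eq_mul_diag; apply/rowP => i; rewrite !mxE h. Qed.

Lemma udiagM U a b : U \is unitarymx ->
  udiag U a *m udiag U b = udiag U (fun i => a i * b i).
Proof.
move=> uU; rewrite !udiagE !mulmxA (mulmxtVK _ uU).
rewrite mul_diag_diag; apply: eq_mul_diag.
by apply/rowP => i; rewrite !mxE rmorphM.
Qed.

Lemma udiag_cst U (c : R) : U \is unitarymx -> udiag U (fun=> c) = c%:C%:M.
Proof.
move=> uU; have -> : udiag U (fun=> c) = U^t* *m (c%:C)%:M *m U.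
  by rewrite udiagE -diag_const_mx; apply: eq_mul_diag; apply/rowP => i; rewrite !mxE.
by rewrite mul_mx_scalar -scalemxAl (unitaryKC uU) scalemx1.
Qed.

Lemma udiagD U a b : udiag U a + udiag U b = udiag U (fun i => a i + b i).
Proof.
rewrite !udiagE -mulmxDl -mulmxDr -linearD /=; apply: eq_mul_diag.
by apply/rowP => i; rewrite !mxE rmorphD.
Qed.

Lemma udiagZ U (c : R) a : c%:C *: udiag U a = udiag U (fun i => c * a i).
Proof.
rewrite !udiagE scalemxAl scalemxAr -linearZ /=; apply: eq_mul_diag.
by apply/rowP => i; rewrite !mxE rmorphM.
Qed.

Lemma udiagN U a : - udiag U a = udiag U (fun i => - a i).
Proof.
rewrite -scaleN1r; have -> : -1 = (-1)%:C :> C by rewrite rmorphN1.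
by rewrite udiagZ; apply: eq_udiag => i; rewrite mulN1r.
Qed.

Lemma udiag_herm U a : (udiag U a)^t* = udiag U a.
Proof.
rewrite !udiagE !trmxC_mul trmxCK !mulmxA tr_diag_mx map_diag_mx.
apply: eq_mul_diag.
apply/rowP => i; rewrite !mxE; exact: conjc_realC.
Qed.

Lemma udiag_entries U a i j : U \is unitarymx ->
  (U *m udiag U a *m U^t*) i j = (a i)%:C *+ (i == j).
Proof.
move=> uU; rewrite !udiagE !mulmxA (unitaryK uU) mul1mx -mulmxA (unitaryK uU).
by rewrite mulmx1 !mxE.
Qed.

Lemma udiag_psd U a : (forall i, 0 <= a i) -> psdmx (udiag U a).
Proof.
move=> a0; have -> : udiag U a = (diag_mx (\row_i (Num.sqrt (a i))%:C) *m U)^t*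
    *m (diag_mx (\row_i (Num.sqrt (a i))%:C) *m U).
  rewrite trmxC_mul tr_diag_mx map_diag_mx !mulmxA mul_diag_diag.
  rewrite udiagE; apply: eq_mul_diag; apply/rowP => i; rewrite !mxE [X in X * _](conjc_realC).
  by rewrite -rmorphM -expr2 sqr_sqrtr.
exact: psd_gram.
Qed.

Lemma udiag_spec U a i : U \is unitarymx ->
  (row i U *m udiag U a *m (row i U)^t*) 0 0 = (a i)%:C.
Proof.
move=> uU; have := udiag_entries a i i uU; rewrite eqxx mulr1n => <-.
by rewrite -row_mul !mxE; apply: eq_bigr => j _; rewrite !mxE.
Qed.

Lemma psd_udiagE U a : U \is unitarymx -> psdmx (udiag U a) ->
  forall i, 0 <= a i.
Proof. by move=> uU pA i; rewrite -ler0c -(udiag_spec a i uU). Qed.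

Lemma udiag_unit U a : U \is unitarymx -> (forall i, a i != 0) ->
  udiag U a *m udiag U (fun i => (a i)^-1) = 1%:M.
Proof.
move=> uU a0; transitivity (udiag U (fun=> 1)); last exact: udiag_cst.
by rewrite (udiagM _ _ uU); apply: eq_udiag => i; rewrite mulfV.
Qed.

Lemma udiag_unitE U a : U \is unitarymx -> udiag U a \in unitmx ->
  forall i, a i != 0.
Proof.
move=> uU; rewrite udiagE unitmxE !det_mulmx det_diag unitrM => /andP[].
rewrite unitrM => /andP[_]; rewrite unitfE => /prodf_neq0 h _ i.
by have := h i isT; rewrite mxE (fmorph_eq0 (real_complex R)).
Qed.

Lemma udiag_spectral (A : 'M[C]_n) : A^t* = A ->
  A = udiag (spectralmx A) (fun i => Re (spectral_diag A 0 i)).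
Proof.
move=> hA; have hs := psd_hermsym hA.
have sE : spectral_diag A = \row_i (Re (spectral_diag A 0 i))%:C.
  apply/rowP => i; rewrite [RHS]mxE RRe_real //.
  by have /mxOverP := hermitian_spectral_diag_real hs; apply.
have /orthomx_spectralP AE := hermitian_normalmx hs.
by rewrite !udiagE -sE -(invmx_unitary (spectral_unitarymx A)).
Qed.

Lemma herm_udiag (A : 'M[C]_n) : A^t* = A ->
  exists U a, U \is unitarymx /\ A = udiag U a.
Proof.
move=> /udiag_spectral AE; do 2!eexists; split; last exact: AE.
exact: spectral_unitarymx.
Qed.

Lemma psd_udiag (A : 'M[C]_n) : psdmx A ->
  exists U a, [/\ U \is unitarymx, forall i, 0 <= a i & A = udiag U a].
Proof.
move=> pA; have [U [a [uU AE]]] := herm_udiag (psd_herm pA).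
exists U, a; split => //; apply: (psd_udiagE uU); by rewrite -AE.
Qed.

Lemma posdef_udiag (A : 'M[C]_n) : psdmx A -> A \in unitmx ->
  exists U a, [/\ U \is unitarymx, forall i, 0 < a i & A = udiag U a].
Proof.
move=> pA iA; have [U [a [uU a0 AE]]] := psd_udiag pA.
exists U, a; split => // i; rewrite lt0r a0 andbT.
by apply: (udiag_unitE uU); rewrite -AE.
Qed.

Lemma psd_factor (A : 'M[C]_n) : psdmx A -> exists S : 'M[C]_n, A = S^t* *m S.
Proof.
case/psd_udiag => U [a [uU a0 ->]]; exists (udiag U (fun i => Num.sqrt (a i))).
rewrite udiag_herm (udiagM _ _ uU); apply: eq_udiag => i.
by rewrite -expr2 sqr_sqrtr.
Qed.

Lemma intertwine_entries U V a b (Z : 'M[C]_n) :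
  U \is unitarymx -> V \is unitarymx ->
  udiag U a *m Z = Z *m udiag V b ->
  forall i j, (a i)%:C * (U *m Z *m V^t*) i j = (U *m Z *m V^t*) i j * (b j)%:C.
Proof.
move=> uU uV h i j.
have E1 : U *m (udiag U a *m Z) *m V^t* =
    diag_mx (\row_i (a i)%:C) *m (U *m Z *m V^t*).
  by rewrite !udiagE !mulmxA (unitaryK uU) mul1mx.
have E2 : U *m (Z *m udiag V b) *m V^t* =
    U *m Z *m V^t* *m diag_mx (\row_i (b i)%:C).
  by rewrite !udiagE !mulmxA (mulmxtVK _ uV).
move: E2; rewrite -h E1; move: (U *m Z *m V^t*) => K /matrixP /(_ i j).
by rewrite mul_diag_mx mul_mx_diag !mxE.
Qed.

Lemma entries_intertwine U V a b (Z : 'M[C]_n) :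
  U \is unitarymx -> V \is unitarymx ->
  (forall i j, (a i)%:C * (U *m Z *m V^t*) i j
     = (U *m Z *m V^t*) i j * (b j)%:C) ->
  udiag U a *m Z = Z *m udiag V b.
Proof.
move=> uU uV h.
have ZE : Z = U^t* *m (U *m Z *m V^t*) *m V.
  by rewrite !mulmxA (unitaryKC uU) mul1mx (mulmxKtV _ uV).
move: ZE h; move: (U *m Z *m V^t*) => K -> h.
have {h}hK : diag_mx (\row_i (a i)%:C) *m K = K *m diag_mx (\row_i (b i)%:C).
  by apply/matrixP => i j; rewrite mul_diag_mx mul_mx_diag !mxE.
rewrite !udiagE !mulmxA (mulmxtVK _ uU) (mulmxtVK _ uV).
by rewrite -(mulmxA _ _ K) hK !mulmxA.
Qed.

(** In the two eigenbases an entry of [Z] can be nonzero only where [a i = b j], and there the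
    functions agree. *)
Lemma intertwine_fun U V a b (fa fb : R -> R) (Z : 'M[C]_n) :
  U \is unitarymx -> V \is unitarymx ->
  (forall i j, a i = b j -> fa (a i) = fb (b j)) ->
  udiag U a *m Z = Z *m udiag V b ->
  udiag U (fa \o a) *m Z = Z *m udiag V (fb \o b).
Proof.
move=> uU uV fE h; apply: entries_intertwine => // i j /=.
have [/fE -> | ab] := eqVneq (a i) (b j); first by rewrite mulrC.
have := intertwine_entries uU uV h i j; set K := (U *m Z *m V^t*) i j.
move=> /eqP; rewrite mulrC -subr_eq0 -mulrBr mulf_eq0 => /orP[/eqP->|].
  by rewrite mulr0 mul0r.
by rewrite -rmorphB (fmorph_eq0 (real_complex R)) subr_eq0 (negbTE ab).
Qed.

(** [mxfun] uses the diagonalization chosen by [spectralmx]. The identity matrix intertwines it with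
    any other diagonalization, so the choice does not matter. *)
Lemma mxfun_udiag (f : R -> R) U a : U \is unitarymx ->
  mxfun f (udiag U a) = udiag U (f \o a).
Proof.
move=> uU; set A := udiag U a.
have uV := spectral_unitarymx A; pose s i := Re (spectral_diag A 0 i).
have AE : A = udiag (spectralmx A) s by apply: udiag_spectral; exact: udiag_herm.
have -> : mxfun f A = udiag (spectralmx A) (f \o s).
  rewrite /mxfun (invmx_unitary uV) udiagE; apply: eq_mul_diag.
  by apply/rowP => i; rewrite !mxE.
rewrite -[LHS]mulmx1 -[RHS]mul1mx; apply: intertwine_fun => //.
  by move=> i j ->.
by rewrite -AE mulmx1 mul1mx.
Qed.

Lemma mxpow_udiag (s : R) U a : U \is unitarymx ->
  mxpow (udiag U a) s = udiag U (fun i => a i `^ s).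
Proof. exact: mxfun_udiag. Qed.

Lemma tr_udiag U a : U \is unitarymx -> \tr (udiag U a) = (\sum_i a i)%:C.
Proof.
move=> uU; rewrite !udiagE mxtrace_mulC mulmxA (unitaryK uU) mul1mx mxtrace_diag.
by rewrite rmorph_sum; apply: eq_bigr => i _; rewrite mxE.
Qed.

Lemma tr_diag_quad (a b : 'I_n -> R) (K : 'M[C]_n) :
  \tr (K^t* *m diag_mx (\row_i (a i)%:C) *m (K *m diag_mx (\row_i (b i)%:C))) =
  (\sum_i \sum_j a i * b j * absq (K i j))%:C.
Proof.
rewrite [in RHS]exchange_big /= rmorph_sum; apply: eq_bigr => j _.
rewrite mxE rmorph_sum; apply: eq_bigr => i _.
rewrite mul_mx_diag mul_mx_diag !mxE !rmorphM /= absqE.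
move: (K i j) => z.
by rewrite -[LHS]/(z^* * (a i)%:C * (z * (b j)%:C)); ring.
Qed.

(** The passage between trace forms and double sums over eigenvalues; [a] and [b] may belong to
    different eigenbases. *)
Lemma tr_quad U V a b (G : 'M[C]_n) : U \is unitarymx -> V \is unitarymx ->
  \tr (G^t* *m udiag U a *m G *m udiag V b) =
  (\sum_i \sum_j a i * b j * absq ((U *m G *m V^t*) i j))%:C.
Proof.
move=> uU uV; rewrite -tr_diag_quad.
have -> : (U *m G *m V^t*)^t* = V *m G^t* *m U^t*.
  by rewrite (trmxC_mul _ (V^t*)) (trmxC_mul U) trmxCK mulmxA.
have cyc (A B D F M N K : 'M[C]_n) :
    \tr (A *m (B *m M *m D) *m K *m (F *m N *m V)) =
    \tr (V *m A *m B *m M *m (D *m K *m F *m N)).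
  by rewrite !mulmxA mxtrace_mulC !mulmxA.
by rewrite !udiagE cyc.
Qed.

Lemma tr_mul_udiag U a (Z : 'M[C]_n) :
  \tr (Z *m udiag U a) = \sum_i (a i)%:C * (U *m Z *m U^t*) i i.
Proof.
rewrite !udiagE !mulmxA mxtrace_mulC !mulmxA /mxtrace; apply: eq_bigr => i _.
by rewrite mul_mx_diag !mxE mulrC.
Qed.

Lemma psd_tr_mul_ge0 (A B : 'M[C]_n) : psdmx A -> psdmx B -> 0 <= \tr (A *m B).
Proof.
move=> /psd_factor[S ->] /psd_factor[T ->].
rewrite mulmxA mxtrace_mulC !mulmxA -mulmxA -{1}(trmxCK T) -!trmxC_mul.
by rewrite gram_ge0.
Qed.

Lemma psd_tr_quad_ge0 (A B G : 'M[C]_n) : psdmx A -> psdmx B ->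
  0 <= \tr (G^t* *m A *m G *m B).
Proof. by move=> pA pB; apply: psd_tr_mul_ge0 => //; apply: psd_congr. Qed.

Lemma psd_tr_ge0 (A : 'M[C]_n) : psdmx A -> 0 <= \tr A.
Proof. by move=> pA; rewrite -[A]mulmx1; apply: psd_tr_mul_ge0 => //; exact: psd1. Qed.

Lemma posdef_tr_gram_eq0 m (A : 'M[C]_n) (G : 'M[C]_(m, n)) : psdmx A -> A \in unitmx ->
  \tr (A *m G^t* *m G) = 0 -> G = 0.
Proof.
move=> pA uA; have [S AE] := psd_factor pA.
have uS : S \in unitmx by move: uA; rewrite AE unitmx_mul => /andP[].
rewrite AE -!mulmxA mxtrace_mulC !mulmxA => h.
suff GS : G *m S^t* = 0.
  rewrite -[G](@mulmxK _ _ _ (S^t*)); last by rewrite map_unitmx unitmx_tr.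
  by rewrite GS mul0mx.
by apply: gram_eq0; rewrite trmxC_mul trmxCK !mulmxA.
Qed.

Lemma psd_le_tr (A : 'M[C]_n) (c : R) : psdmx A -> \tr A = c%:C ->
  psdmx ((c%:C)%:M - A).
Proof.
case/psd_udiag => U [a [uU a0 ->]]; rewrite tr_udiag // => /complexI <-.
have -> : ((\sum_i a i)%:C)%:M - udiag U a =
    udiag U (fun j => \sum_i a i - a j).
  by rewrite -(udiag_cst _ uU) udiagN udiagD.
apply: udiag_psd => j; rewrite (bigD1 j) //= addrAC subrr add0r sumr_ge0 //.
Qed.

End FunctionalCalculus.

(** * Divided differences of powers as limits of sums of resolvent products *)

Section DividedPower.
Variable R : realType.
Implicit Types (s t u v h x y : R).

Definition divpow s u v : R :=
  if u == v then s * u `^ (s - 1) else (u `^ s - v `^ s) / (u - v).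

(** The integrand l^s / ((l + u) (l + v)) at l = e^t; the substitution contributes the additional
    factor e^t. *)
Let term s t u v : R := expR ((s + 1) * t) / ((expR t + u) * (expR t + v)).

Let fwd s h u v : R^nat := fun j => term s (j%:R * h) u v.
(** The nodes are all integer multiples of [h]; these start at [- h], since [fwd] contains the node
    0. *)
Let bwd s h u v : R^nat := fun j => term s (- (j.+1%:R * h)) u v.

Let psum s h u v : R^nat := fun N => series (fwd s h u v) N + series (bwd s h u v) N.
Let tsum s h u v : R := limn (psum s h u v).

Let term_ge0 s t u v : 0 <= u -> 0 <= v -> 0 <= term s t u v.
Proof.
by move=> u0 v0; rewrite divr_ge0 ?expR_ge0 // mulr_ge0 // addr_ge0 ?expR_ge0.
Qed.

Let expR_lt1 x : x < 0 -> `|expR x| < 1.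
Proof. by move=> x0; rewrite ger0_norm ?expR_ge0 // -expR0 ltr_expR. Qed.

Let fwd_cvg s h u v : 0 < s < 1 -> 0 < h -> 0 <= u -> 0 <= v ->
  cvgn (series (fwd s h u v)).
Proof.
move=> /andP[s0 s1] h0 u0 v0.
apply: (@series_le_cvg _ _ (geometric 1 (expR ((s - 1) * h)))).
- by move=> j; exact: term_ge0.
- by move=> j /=; rewrite mul1r exprn_ge0 ?expR_ge0.
- move=> j /=; rewrite mul1r -expRM_natl /fwd /term.
  set t := j%:R * h; have -> : j%:R * ((s - 1) * h) = (s - 1) * t by rewrite /t; ring.
  have -> : (s + 1) * t = (s - 1) * t + t + t by ring.
  rewrite !expRD ler_pdivrMr; last by rewrite mulr_gt0 // ltr_pwDl ?expR_gt0.
  by rewrite -mulrA ler_wpM2l ?expR_ge0 // ler_pM ?expR_ge0 // lerDl.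
- apply: is_cvg_geometric_series; apply: expR_lt1.
  by rewrite pmulr_llt0 // subr_lt0.
Qed.

Let bwd_cvg s h u v : 0 < s < 1 -> 0 < h -> 0 < u -> 0 <= v ->
  cvgn (series (bwd s h u v)).
Proof.
move=> /andP[s0 s1] h0 u0 v0.
apply: (@series_le_cvg _ _ (geometric (expR (- (s * h)) / u) (expR (- (s * h))))).
- by move=> j; apply: term_ge0 => //; exact: ltW.
- by move=> j /=; rewrite mulr_ge0 ?exprn_ge0 ?divr_ge0 ?expR_ge0 ?ltW.
- move=> j /=; rewrite -expRM_natl /bwd /term.
  set t := - (j.+1%:R * h); rewrite mulrAC -expRD.
  have -> : - (s * h) + j%:R * - (s * h) = s * t by rewrite /t -natr1; ring.
  have -> : (s + 1) * t = s * t + t by ring.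
  rewrite expRD ler_pdivrMr; last by rewrite mulr_gt0 // ltr_pwDl ?expR_gt0 // ltW.
  rewrite -!mulrA ler_wpM2l ?expR_ge0 // ler_pdivlMl //.
  by apply: ler_pM; rewrite ?expR_ge0 ?lerDr ?lerDl ?expR_ge0 // ltW.
- apply: is_cvg_geometric_series; apply: expR_lt1.
  by rewrite oppr_lt0 mulr_gt0.
Qed.

Let psum_cvg s h u v : 0 < s < 1 -> 0 < h -> 0 < u -> 0 <= v ->
  psum s h u v @ \oo --> tsum s h u v.
Proof.
move=> s01 h0 u0 v0; apply: (is_cvgD (fwd_cvg s01 h0 _ v0) (bwd_cvg s01 h0 u0 v0)).
exact: ltW.
Qed.

Let tsum_comb (I : finType) (c u v : I -> R) s h : 0 < s < 1 -> 0 < h ->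
  (forall i, 0 < u i) -> (forall i, 0 <= v i) ->
  (forall l, 0 < l -> 0 <= \sum_i c i / ((l + u i) * (l + v i))) ->
  0 <= \sum_i c i * tsum s h (u i) (v i).
Proof.
move=> s01 h0 u0 v0 H.
have cv : (fun N => \sum_i c i * psum s h (u i) (v i) N) @ \oo -->
    \sum_i c i * tsum s h (u i) (v i).
  apply: cvg_big => [|i _]; first exact: add_continuous.
  by apply: cvgMr; exact: psum_cvg.
rewrite -(cvg_lim _ cv) //; apply: limr_ge; first by apply/cvg_ex; eexists; exact: cv.
apply: nearW => N.
have term_comb t : 0 <= \sum_i c i * term s t (u i) (v i).
  rewrite (eq_bigr (fun i => expR ((s + 1) * t) *
    (c i / ((expR t + u i) * (expR t + v i))))); last first.
    by move=> i _; rewrite mulrCA.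
  by rewrite -mulr_sumr mulr_ge0 ?expR_ge0 // H ?expR_gt0.
rewrite (eq_bigr (fun i => \sum_(0 <= j < N) c i * fwd s h (u i) (v i) j +
  \sum_(0 <= j < N) c i * bwd s h (u i) (v i) j)); last first.
  by move=> i _; rewrite -!mulr_sumr -mulrDr.
rewrite big_split /= addr_ge0 // exchange_big /= sumr_ge0 // => j _;
  exact: term_comb.
Qed.

(** Multiplying [u] and [v] by e^h shifts the nodes by one step. In the partial sums one node passes
    from the forward to the backward series, which is why [g] pairs [N] with [N.+2]. *)
Let tsum_scale s h u v : 0 < s < 1 -> 0 < h -> 0 < u -> 0 <= v ->
  tsum s h (expR h * u) (expR h * v) = expR ((s - 1) * h) * tsum s h u v.
Proof.
move=> s01 h0 u0 v0; apply/cvg_lim => //.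
have tE t : term s (t + h) (expR h * u) (expR h * v) =
    expR ((s - 1) * h) * term s t u v.
  rewrite /term !expRD [expR t * expR h]mulrC -!mulrDr.
  have -> : (s + 1) * (t + h) = (s - 1) * h + (s + 1) * t + h + h by ring.
  rewrite !expRD; field.
  by rewrite !gt_eqF ?expR_gt0 // ltr_pwDl ?expR_gt0 // ltW.
pose g := fun N => expR ((s - 1) * h) * (series (fwd s h u v) N +
   series (bwd s h u v) N.+2).
have gE N : psum s h (expR h * u) (expR h * v) N.+1 = g N.
  rewrite /g /psum /series /= big_nat_recl // [X in _ * (_ + X)]big_nat_recl //.
  have -> : \sum_(0 <= j < N) fwd s h (expR h * u) (expR h * v) j.+1 =
      expR ((s - 1) * h) * \sum_(0 <= j < N) fwd s h u v j.
    rewrite mulr_sumr; apply: eq_bigr => j _.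
    by rewrite /fwd -tE; congr term; rewrite -natr1; ring.
  have -> : \sum_(0 <= j < N.+1) bwd s h (expR h * u) (expR h * v) j =
      expR ((s - 1) * h) * \sum_(0 <= j < N.+1) bwd s h u v j.+1.
    rewrite mulr_sumr; apply: eq_bigr => j _.
    by rewrite /bwd -tE; congr term; rewrite -!natr1; ring.
  have -> : fwd s h (expR h * u) (expR h * v) 0 = expR ((s - 1) * h) * bwd s h u v 0.
    by rewrite /fwd /bwd -tE; congr term; ring.
  by ring.
rewrite -cvg_shiftS.
have -> : [sequence psum s h (expR h * u) (expR h * v) N.+1]_N = g.
  by apply/funext => N; exact: gE.
apply: cvgMr; have -> : tsum s h u v =
    limn (series (fwd s h u v)) + limn (series (bwd s h u v)).
  apply: limD; [apply: fwd_cvg|apply: bwd_cvg] => //; exact: ltW.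
apply: cvgD; first by apply: fwd_cvg => //; exact: ltW.
rewrite (cvg_shiftS (fun N => series (bwd s h u v) N.+1)) (cvg_shiftS (series (bwd s h u v))).
exact: bwd_cvg.
Qed.

(** Partial fractions in each term. Off the diagonal this reduces [tsum] to its values at
    [v = 0]. *)
Let tsum_split s h u v : 0 < s < 1 -> 0 < h -> 0 < u -> 0 < v ->
  u * tsum s h u 0 - v * tsum s h v 0 = (u - v) * tsum s h u v.
Proof.
move=> s01 h0 u0 v0.
have c1 := psum_cvg s01 h0 u0 (lexx 0); have c2 := psum_cvg s01 h0 v0 (lexx 0).
have c3 := psum_cvg s01 h0 u0 (ltW v0).
have : u *: psum s h u 0 - v *: psum s h v 0 @ \oo -->
    u * tsum s h u 0 - v * tsum s h v 0.
  by apply: cvgB; apply: cvgZr.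
have -> : u *: psum s h u 0 - v *: psum s h v 0 = (u - v) *: psum s h u v.
  apply/funext => N; rewrite /psum /series /= !fctE /=.
  rewrite -!big_split /= /GRing.scale /= !mulr_sumr -sumrB; apply: eq_bigr => j _.
  have key t : u * term s t u 0 - v * term s t v 0 = (u - v) * term s t u v.
    rewrite /term addr0; field.
    by rewrite !gt_eqF ?expR_gt0 // addr_gt0 ?expR_gt0.
  by rewrite /fwd /bwd !mulrDr opprD addrACA !key.
move=> c; rewrite -(cvg_lim _ c) //; apply/cvg_lim => //.
exact: cvgZr.
Qed.

Let tsum_anti s h u v u' v' : 0 < s < 1 -> 0 < h -> 0 < u -> 0 <= v ->
  u <= u' -> v <= v' -> tsum s h u' v' <= tsum s h u v.
Proof.
move=> s01 h0 u0 v0 uu vv.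
apply: ler_lim.
- by apply/cvg_ex; eexists; apply: psum_cvg => //; [exact: lt_le_trans uu|exact: le_trans vv].
- by apply/cvg_ex; eexists; apply: psum_cvg.
apply: nearW => N; apply: lerD; apply: ler_sum => j _;
  rewrite ler_wpM2l ?expR_ge0 // lef_pV2 ?posrE.
- rewrite ler_pM ?addr_ge0 ?expR_ge0 ?lerD2l //; exact: ltW.
- by rewrite mulr_gt0 // ltr_pwDl ?expR_gt0 // (le_trans _ uu, le_trans _ vv) // ltW.
- by rewrite mulr_gt0 // ltr_pwDl ?expR_gt0 // ltW.
- rewrite ler_pM ?addr_ge0 ?expR_ge0 ?lerD2l //; exact: ltW.
- by rewrite mulr_gt0 // ltr_pwDl ?expR_gt0 // (le_trans _ uu, le_trans _ vv) // ltW.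
- by rewrite mulr_gt0 // ltr_pwDl ?expR_gt0 // ltW.
Qed.

Let tsum_gt0 s h u v : 0 < s < 1 -> 0 < h -> 0 < u -> 0 <= v -> 0 < tsum s h u v.
Proof.
move=> s01 h0 u0 v0.
have psum1 : 0 < psum s h u v 1.
  rewrite /psum /series /= !big_nat1 addr_gt0 // divr_gt0 ?expR_gt0 // mulr_gt0 //.
  - by rewrite addr_gt0 ?expR_gt0.
  - by rewrite ltr_pwDl ?expR_gt0.
  - by rewrite addr_gt0 ?expR_gt0.
  - by rewrite ltr_pwDl ?expR_gt0.
apply: lt_le_trans psum1 _; apply: nondecreasing_cvgn_le; last first.
  by apply/cvg_ex; eexists; apply: psum_cvg.
apply/nondecreasing_seqP => N; rewrite /psum /series /= !big_nat_recr //=.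
by rewrite lerD // lerDl term_ge0 // ltW.
Qed.

(** The discrete counterpart of u times the integral of l^(s-1) / (l + u), which is a constant
    multiple of u^s. *)
Let phi s h u := u * tsum s h u 0.

Let phi_scale s h u (k : nat) : 0 < s < 1 -> 0 < h -> 0 < u ->
  phi s h (expR (k%:R * h) * u) = expR (k%:R * (s * h)) * phi s h u.
Proof.
move=> s01 h0 u0; elim: k => [|k IHk]; first by rewrite !mul0r expR0 !mul1r.
have -> : expR (k.+1%:R * h) * u = expR h * (expR (k%:R * h) * u).
  by rewrite mulrA -expRD -natr1; congr (expR _ * _); ring.
set w := expR (k%:R * h) * u in IHk *.
have w0 : 0 < w by rewrite mulr_gt0 ?expR_gt0.
transitivity (expR (s * h) * phi s h w).
  have hs := tsum_scale s01 h0 w0 (lexx 0); rewrite mulr0 in hs.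
  by rewrite /phi hs mulrACA -expRD; congr (expR _ * _); ring.
by rewrite IHk mulrA -expRD -natr1; congr (expR _ * _); ring.
Qed.

Let phi_le s h u v : 0 < s < 1 -> 0 < h -> 0 < v -> v <= u ->
  phi s h v <= phi s h u.
Proof.
move=> s01 h0 v0 vu; have u0 := lt_le_trans v0 vu.
rewrite -subr_ge0 /phi tsum_split // mulr_ge0 ?subr_ge0 // ltW //.
by rewrite tsum_gt0 // ltW.
Qed.

(** [phi] is exactly homogeneous along powers of e^h. Enclosing [u] between two consecutive powers
    and using monotonicity leaves an error factor of at most e^(sh). *)
Let phi_bound_ge1 s h u : 0 < s < 1 -> 0 < h -> 1 <= u ->
  expR (- (s * h)) * u `^ s * phi s h 1 <= phi s h u <=
  expR (s * h) * u `^ s * phi s h 1.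
Proof.
move=> s01 h0 u1; have u0 : 0 < u by apply: lt_le_trans u1.
have s0 : 0 < s by case/andP: s01.
have W0 : 0 < phi s h 1 by rewrite /phi mul1r tsum_gt0.
pose k := Num.truncn (ln u / h).
have a0 : 0 <= ln u / h by apply: divr_ge0; [exact: ln_ge0|exact: ltW].
have /andP[k1 k2] := truncn_itv a0.
have {}k1 : k%:R * h <= ln u by rewrite -ler_pdivlMr.
have {}k2 : ln u <= k.+1%:R * h by rewrite -ler_pdivrMr // ltW.
have uE : u `^ s = expR (s * ln u) by rewrite /powR gt_eqF.
have e1 : expR (k%:R * h) * 1 <= u.
  by rewrite mulr1 -(lnK u0) ler_expR.
have e2 : u <= expR (k.+1%:R * h) * 1.
  by rewrite mulr1 -{1}(lnK u0) ler_expR.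
apply/andP; split.
- apply: le_trans (phi_le s01 h0 _ e1); last by rewrite mulr1 expR_gt0.
  rewrite phi_scale // ler_wpM2r ?(ltW W0) // uE -expRD ler_expR.
  have := ler_wpM2l (ltW s0) k2; rewrite -natr1; lra.
- apply: le_trans (phi_le s01 h0 u0 e2) _.
  rewrite phi_scale // ler_wpM2r ?(ltW W0) // uE -expRD ler_expR.
  have := ler_wpM2l (ltW s0) k1; rewrite -natr1; lra.
Qed.

Let phi_bound s h u : 0 < s < 1 -> 0 < h -> 0 < u ->
  expR (- (s * h)) * u `^ s <= phi s h u / phi s h 1 <= expR (s * h) * u `^ s.
Proof.
move=> s01 h0 u0; have W0 : 0 < phi s h 1 by rewrite /phi mul1r tsum_gt0.
rewrite ler_pdivlMr // ler_pdivrMr //.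
(* Homogeneity reduces to arguments at least 1: multiply [u] by a large enough power of e^h. *)
have [k k1] : exists k : nat, - ln u <= k%:R * h.
  exists (Num.truncn (- ln u / h)).+1.
  rewrite -ler_pdivrMr //; have [a0|a0] := leP 0 (- ln u / h).
    by have /andP[_ /ltW] := truncn_itv a0.
  exact: le_trans (ltW a0) _.
have w1 : 1 <= expR (k%:R * h) * u.
  have : 0 <= k%:R * h + ln u by rewrite -lerBlDr sub0r.
  by rewrite -ler_expR expR0 expRD (lnK u0).
have := phi_bound_ge1 s01 h0 w1; rewrite phi_scale //.
have -> : (expR (k%:R * h) * u) `^ s = expR (k%:R * (s * h)) * u `^ s.
  rewrite powRM ?expR_ge0 ?ltW // -expRM; congr (expR _ * _); ring.
have E0 := expR_gt0 (k%:R * (s * h)).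
set e := expR _ in E0 *; set w := u `^ s.
have mv (a b : R) : a * (e * w) * b = e * (a * w * b) by ring.
by rewrite !mv !(ler_pM2l E0).
Qed.

Let cvg_expR (a b : R) : expR (a * h) * b @[h --> 0^'+] --> b.
Proof.
rewrite -[X in _ --> X]mul1r -expR0 -{2}(mulr0 a); apply: cvgMl.
apply: (continuous_cvg _ (@continuous_expR R _)); apply: cvgMr.
by apply: cvg_within_filter; exact: cvg_id.
Qed.

(** Division by [phi s h 1] removes at once the mesh factor of the Riemann sum and the constant of
    the integral representation. *)
Let ratio s h u v := tsum s h u v / phi s h 1.

Let phi_cvg s u : 0 < s < 1 -> 0 < u ->
  phi s h u / phi s h 1 @[h --> 0^'+] --> u `^ s.
Proof.
move=> s01 u0; apply: (squeeze_cvgr (f := fun h => expR (- s * h) * u `^ s)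
  (h := fun h => expR (s * h) * u `^ s)); [|exact: cvg_expR..].
near=> h; rewrite mulNr; apply: phi_bound => //.
Unshelve. all: by end_near. Qed.

(** On the diagonal [tsum_split] is vacuous. It is applied to the pair e^h u, u instead, where by
    antitonicity and scaling [tsum] differs from its diagonal value by a factor of at most
    e^((1-s)h). *)
Let ratio_diag s h u : 0 < s < 1 -> 0 < h -> 0 < u ->
  expR (- (1 + s) * h) * (s * u `^ (s - 1)) <= ratio s h u u <=
  expR ((1 + s) * h) * (s * u `^ (s - 1)).
Proof.
move=> s01 h0 u0; have /andP[s0 s1] := s01.
have W0 : 0 < phi s h 1 by rewrite /phi mul1r tsum_gt0.
have eu0 : 0 < expR h * u by rewrite mulr_gt0 ?expR_gt0.
have ueu : u <= expR h * u by rewrite ler_peMl ?(ltW u0) // -expR0 ler_expR ltW.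
have h1 : expR h - 1 >= h by rewrite lerBrDl expR_ge1Dx.
have E1 : expR h - 1 > 0 by apply: lt_le_trans h1.
have split : (expR (s * h) - 1) * (phi s h u / phi s h 1) =
    (expR h - 1) * u * ratio s h (expR h * u) u.
  have hs : phi s h (expR h * u) - phi s h u = _ := tsum_split s01 h0 eu0 u0.
  have := phi_scale 1 s01 h0 u0; rewrite !mul1r => hp; rewrite hp in hs.
  have {}hs : (expR (s * h) - 1) * phi s h u =
      (expR h - 1) * u * tsum s h (expR h * u) u.
    transitivity (expR (s * h) * phi s h u - phi s h u); first by ring.
    by rewrite hs; ring.
  transitivity ((expR (s * h) - 1) * phi s h u / phi s h 1); first exact: mulrA.
  by rewrite hs /ratio; exact/esym/mulrA.
have up x : expR x - 1 <= x * expR x.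
  rewrite lerBlDr -lerBlDl -mulNr -{1}[expR x]mul1r -mulrDl.
  rewrite -(ler_pM2l (expR_gt0 (- x))) mulr1 mulrCA -expRD addNr expR0 mulr1.
  exact: expR_ge1Dx.
have le1 : ratio s h (expR h * u) u <= ratio s h u u.
  by rewrite ler_pM2r ?invr_gt0 // tsum_anti // ltW.
have le2 : expR ((s - 1) * h) * ratio s h u u <= ratio s h (expR h * u) u.
  rewrite /ratio mulrA -tsum_scale ?(ltW u0) // ler_pM2r ?invr_gt0 //.
  by rewrite tsum_anti // ltW.
have /andP[p1 p2] := phi_bound s01 h0 u0.
have us : u `^ s = u * u `^ (s - 1).
  by rewrite -{2}[u]powRr1 ?(ltW u0) // -powRD ?gt_eqF ?implybT // addrC subrK.
have shE : s * h <= expR (s * h) - 1 by rewrite lerBrDl expR_ge1Dx.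
have sh0 : 0 < s * h by rewrite mulr_gt0.
set q := ratio s h (expR h * u) u in split le1 le2.
set P := phi s h u / phi s h 1 in split p1 p2.
have P0 : 0 < P by apply: lt_le_trans p1; rewrite mulr_gt0 ?expR_gt0 ?powR_gt0.
have qE : q = (expR (s * h) - 1) / (expR h - 1) * (P / u).
  apply: (mulfI (lt0r_neq0 (mulr_gt0 E1 u0))); rewrite -split; field.
  by rewrite !gt_eqF.
have b1 : s * expR (- h) <= (expR (s * h) - 1) / (expR h - 1).
  rewrite ler_pdivlMr // (le_trans _ shE) // -mulrA ler_pM2l //.
  rewrite (le_trans (ler_wpM2l (expR_ge0 _) (up h))) //.
  by rewrite mulrCA -expRD addNr expR0 mulr1.
have b2 : (expR (s * h) - 1) / (expR h - 1) <= s * expR (s * h).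
  rewrite ler_pdivrMr // (le_trans (up _)) // mulrAC -!mulrA ler_pM2l //.
  by rewrite ler_pM2l ?expR_gt0.
have P1 : expR (- (s * h)) * u `^ (s - 1) <= P / u.
  by rewrite ler_pdivlMr // -mulrA [X in _ * X]mulrC -us.
have P2 : P / u <= expR (s * h) * u `^ (s - 1).
  by rewrite ler_pdivrMr // -mulrA [X in _ * X]mulrC -us.
apply/andP; split.
- apply: le_trans le1; rewrite qE.
  have -> : expR (- (1 + s) * h) * (s * u `^ (s - 1)) =
      (s * expR (- h)) * (expR (- (s * h)) * u `^ (s - 1)).
    by rewrite mulNr mulrDl mul1r opprD expRD; ring.
  by apply: ler_pM => //; rewrite mulr_ge0 ?expR_ge0 ?powR_ge0 // ltW.
- have {}le2 : ratio s h u u <= expR ((1 - s) * h) * q.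
    rewrite -(ler_pM2l (expR_gt0 ((s - 1) * h))).
    rewrite [leRHS]mulrA -expRD -mulrDl.
    by rewrite [s - 1 + _]addrC addrA subrK subrr mul0r expR0 [leRHS]mul1r.
  apply: le_trans le2 _.
  have -> : expR ((1 + s) * h) * (s * u `^ (s - 1)) = expR ((1 - s) * h) *
      ((s * expR (s * h)) * (expR (s * h) * u `^ (s - 1))).
    have -> : (1 + s) * h = (1 - s) * h + s * h + s * h by ring.
    by rewrite !expRD; ring.
  rewrite ler_pM2l ?expR_gt0 // qE ler_pM //.
  + by rewrite divr_ge0 // ltW // (lt_le_trans sh0).
  + by rewrite divr_ge0 // ltW.
Qed.

Let ratio_cvg s u v : 0 < s < 1 -> 0 < u -> 0 <= v ->
  ratio s h u v @[h --> 0^'+] --> divpow s u v.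
Proof.
move=> s01 u0 v0; have /andP[s0 s1] := s01.
rewrite /divpow; have [<-|uv] := eqVneq u v.
  apply: (squeeze_cvgr (f := fun h => expR (- (1 + s) * h) * (s * u `^ (s - 1)))
    (h := fun h => expR ((1 + s) * h) * (s * u `^ (s - 1)))); [|exact: cvg_expR..].
  by near=> h; apply: ratio_diag.
have uv0 : u - v != 0 by rewrite subr_eq0.
case: (ltgtP 0 v) v0 => // [v0 _|v0 _]; last first.
  rewrite -v0 powR0 ?gt_eqF // !subr0.
  have -> : (fun h => ratio s h u 0) = (fun h => phi s h u / phi s h 1 / u).
    by apply/funext => h; rewrite /ratio {2}/phi mulrAC [u * _]mulrC mulfK ?gt_eqF.
  by apply: cvgMl; exact: phi_cvg.
have : (phi s h u / phi s h 1 - phi s h v / phi s h 1) / (u - v) @[h --> 0^'+] -->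
    (u `^ s - v `^ s) / (u - v).
  by apply: cvgMl; apply: cvgB; exact: phi_cvg.
apply: cvg_trans; apply: near_eq_cvg; near=> h.
have cancel (a b c : R) : a != 0 -> a * b / c / a = b / c.
  by move=> a0; rewrite ![_ / a]mulrC !mulrA mulVf // mul1r.
by rewrite -mulrBl tsum_split // cancel.
Unshelve. all: by end_near. Qed.

(* divpow s is, up to a positive factor, the integral over l of
   l ^ s / ((l + u) (l + v)); it is obtained here as a limit of sums over
   geometric progressions of l. *)
Lemma divpow_ge0_comb (I : finType) (c u v : I -> R) s : 0 < s <= 1 ->
  (forall i, 0 < u i) -> (forall i, 0 <= v i) ->
  (forall l, 0 < l -> 0 <= \sum_i c i / ((l + u i) * (l + v i))) ->
  0 <= \sum_i c i * divpow s (u i) (v i).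
Proof.
move=> /andP[s0]; rewrite le_eqVlt => /predU1P[-> | s1] u0 v0 H; last first.
  have s01 : 0 < s < 1 by rewrite s0.
  have cv : \sum_i c i * ratio s h (u i) (v i) @[h --> 0^'+] -->
      \sum_i c i * divpow s (u i) (v i).
    apply: cvg_big => [|i _]; first exact: add_continuous.
    by apply: cvgMr; exact: ratio_cvg.
  rewrite -(cvg_lim _ cv) //; apply: limr_ge; first by apply/cvg_ex; eexists; exact: cv.
  near=> h; have h0 : 0 < h by [].
  rewrite (eq_bigr (fun i => c i * tsum s h (u i) (v i) / phi s h 1)); last first.
    by move=> i _; rewrite mulrA.
  by rewrite -mulr_suml divr_ge0 ?tsum_comb // ltW // /phi mul1r tsum_gt0.
(* For s = 1 the integral over l diverges. All divided differences are then 1, the limit of l^2 /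
   ((l + u) (l + v)) for l = h^-1 tending to infinity. *)
have d1 i : divpow 1 (u i) (v i) = 1.
  rewrite /divpow subrr powRr0 mulr1; have [//|uv] := eqVneq.
  by rewrite !powRr1 ?(ltW (u0 _)) // divff // subr_eq0.
have cv : \sum_i c i / ((1 + u i * h) * (1 + v i * h)) @[h --> 0^'+] -->
    \sum_i c i * divpow 1 (u i) (v i).
  apply: cvg_big => [|i _]; first exact: add_continuous.
  apply: cvgMr; rewrite d1 -[X in _ --> X]invr1; apply: cvgV; first exact: oner_neq0.
  have h0 : h @[h --> (0 : R)^'+] --> (0 : R).
    by apply: cvg_within_filter; exact: cvg_id.
  have cv1 (x : R) : 1 + x * h @[h --> 0^'+] --> (1 : R).
    have : 1 + x * h @[h --> 0^'+] --> (1 + x * 0 : R).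
      by apply: cvgD; [exact: cvg_cst|exact: cvgMr].
    by rewrite mulr0 addr0.
  by rewrite -[X in _ --> X]mulr1; apply: cvgM.
rewrite -(cvg_lim _ cv) //; apply: limr_ge; first by apply/cvg_ex; eexists; exact: cv.
near=> h; have h0 : 0 < h by [].
rewrite (eq_bigr (fun i => (h^-1 * h^-1) *
    (c i / ((h^-1 + u i) * (h^-1 + v i))))); last first.
  move=> i _; have := u0 i; have := v0 i => vi ui; field.
  by rewrite !gt_eqF // ltr_pwDl // mulr_ge0 // ltW.
by rewrite -mulr_sumr mulr_ge0 ?H ?invr_gt0 // mulr_ge0 ?invr_ge0 // ltW.
Unshelve. all: by end_near. Qed.

End DividedPower.

(** * Trace inequalities obtained from resolvents *)

Section OperatorInequalities.
Variables (R : realType) (n : nat).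
Local Notation C := R[i].
Implicit Types (U V : 'M[C]_n) (a b : 'I_n -> R).

Lemma Re_tr_mul_udiag U a (Z : 'M[C]_n) :
  Re (\tr (Z *m udiag U a)) = \sum_i a i * Re ((U *m Z *m U^t*) i i).
Proof. by rewrite tr_mul_udiag Re_sum; apply: eq_bigr => i _; rewrite cReMl. Qed.

Lemma Re_tr_quad U V a b (G : 'M[C]_n) : U \is unitarymx -> V \is unitarymx ->
  Re (\tr (G^t* *m udiag U a *m G *m udiag V b)) =
  \sum_i \sum_j a i * b j * absq ((U *m G *m V^t*) i j).
Proof. by move=> uU uV; rewrite tr_quad. Qed.

(* Convexity of the inverse: P = A^-1 lies above its tangent at Q^-1. *)
Lemma inv_tangent (A P Q : 'M[C]_n) : A *m P = 1%:M -> P *m A = 1%:M ->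
  psdmx A -> Q^t* = Q -> P^t* = P -> psdmx (P - Q - Q + Q *m A *m Q).
Proof.
move=> AP PA pA Qh Ph.
suff -> : P - Q - Q + Q *m A *m Q = (P - Q)^t* *m A *m (P - Q) by exact: psd_congr.
rewrite trmxCB Ph Qh mulmxBl PA mulmxBl mul1mx mulmxBr -[Q *m A *m P]mulmxA AP mulmx1.
by rewrite opprB [_ *m Q - Q]addrC addrA.
Qed.

(** Since [Q] inverts [A'], the difference [P - Q] is the tangent defect at [Q] plus the congruence
    [Q *m (A' - A) *m Q]. *)
Lemma inv_antitone (A A' P Q : 'M[C]_n) : A *m P = 1%:M -> P *m A = 1%:M ->
  Q *m A' = 1%:M -> psdmx A -> Q^t* = Q -> P^t* = P -> psdmx (A' - A) ->
  psdmx (P - Q).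
Proof.
move=> AP PA QA' pA Qh Ph AA'.
have -> : P - Q = (P - Q - Q + Q *m A *m Q) + Q^t* *m (A' - A) *m Q.
  rewrite Qh mulmxBr mulmxBl QA' mul1mx.
  by rewrite addrACA subrr addr0 subrK.
by apply: psdD; [exact: inv_tangent|exact: psd_congr].
Qed.

Lemma mxtraceB (A B : 'M[C]_n) : \tr (A - B) = \tr A - \tr B.
Proof. exact: raddfB. Qed.

Lemma tr_quad_sub (G H P P' Q Q' : 'M[C]_n) :
  \tr (G *m P *m H *m Q) - \tr (G *m P' *m H *m Q') =
  \tr (G *m (P - P') *m H *m Q) + \tr (G *m P' *m H *m (Q - Q')).
Proof.
rewrite mulmxBr [in RHS]mulmxBl [in RHS]mulmxBl [in RHS]mulmxBr !mxtraceB.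
by rewrite addrA subrK.
Qed.

Lemma tr_mul_comb (Y A1 A2 A3 A4 : 'M[C]_n) :
  \tr (Y *m A1) - \tr (Y *m A2) - \tr (Y *m A3) + \tr (Y *m A4) =
  \tr (Y *m (A1 - A2 - A3 + A4)).
Proof. by rewrite mulmxDr !mulmxBr mxtraceD !mxtraceB. Qed.

Section Resolvent.
Variables (U : 'M[C]_n) (a : 'I_n -> R) (l : R).
Hypotheses (uU : U \is unitarymx) (a0 : forall i, 0 <= a i) (l0 : 0 < l).

Let la i : 0 < l + a i. Proof. by rewrite ltr_pwDl. Qed.

Lemma shift_udiag : (l%:C)%:M + udiag U a = udiag U (fun i => l + a i).
Proof. by rewrite -(udiag_cst l uU) udiagD. Qed.

Lemma shift_psd : psdmx (udiag U (fun i => l + a i)).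
Proof. by apply: udiag_psd => i; exact: ltW. Qed.

Lemma shift_resolvent :
  udiag U (fun i => l + a i) *m udiag U (fun i => (l + a i)^-1) = 1%:M.
Proof. by apply: udiag_unit => // i; rewrite gt_eqF. Qed.

Lemma resolvent_shift :
  udiag U (fun i => (l + a i)^-1) *m udiag U (fun i => l + a i) = 1%:M.
Proof. by apply: mulmx1C; exact: shift_resolvent. Qed.

Lemma resolvent_psd : psdmx (udiag U (fun i => (l + a i)^-1)).
Proof. by apply: udiag_psd => i; rewrite invr_ge0 ltW. Qed.

End Resolvent.

Lemma resolvent_antitone U V a b l : U \is unitarymx -> V \is unitarymx ->
  (forall i, 0 <= a i) -> (forall i, 0 <= b i) -> 0 < l ->
  psdmx (udiag V b - udiag U a) ->
  psdmx (udiag U (fun i => (l + a i)^-1) - udiag V (fun i => (l + b i)^-1)).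
Proof.
move=> uU uV a0 b0 l0 ab.
apply: (@inv_antitone (udiag U (fun i => l + a i)) (udiag V (fun i => l + b i))).
- exact: shift_resolvent.
- exact: resolvent_shift.
- exact: resolvent_shift.
- exact: shift_psd.
- exact: udiag_herm.
- exact: udiag_herm.
- rewrite -(shift_udiag b l uV) -(shift_udiag a l uU).
  by rewrite opprD addrACA subrr add0r.
Qed.

(** For each l the trace of G^* (l + A)^-1 G (l + B)^-1 decreases when A, and then B, is enlarged;
    [divpow_ge0_comb] transfers this to divided differences. *)
Lemma divpow_form_antitone (s : R) (U V U' V' : 'M[C]_n)
    (a b a' b' : 'I_n -> R) (G : 'M[C]_n) : 0 < s <= 1 ->
  U \is unitarymx -> V \is unitarymx -> U' \is unitarymx -> V' \is unitarymx ->
  (forall i, 0 < a i) -> (forall i, 0 < b i) ->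
  (forall i, 0 < a' i) -> (forall i, 0 < b' i) ->
  psdmx (udiag U' a' - udiag U a) -> psdmx (udiag V' b' - udiag V b) ->
  \sum_i \sum_j divpow s (a' i) (b' j) * absq ((U' *m G *m V'^t*) i j) <=
  \sum_i \sum_j divpow s (a i) (b j) * absq ((U *m G *m V^t*) i j).
Proof.
move=> s01 uU uV uU' uV' a0 b0 a'0 b'0 aa' bb'.
have ge0 (x : 'I_n -> R) : (forall i, 0 < x i) -> forall i, 0 <= x i.
  by move=> h i; exact: ltW.
pose w i j := absq ((U *m G *m V^t*) i j).
pose w' i j := absq ((U' *m G *m V'^t*) i j).
(* [divpow_ge0_comb] takes one signed family, so both double sums are merged, with a boolean that
   selects the side and the sign. *)
pose c (x : bool * ('I_n * 'I_n)) :=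
  if x.1 then w x.2.1 x.2.2 else - w' x.2.1 x.2.2.
pose u (x : bool * ('I_n * 'I_n)) := if x.1 then a x.2.1 else a' x.2.1.
pose v (x : bool * ('I_n * 'I_n)) := if x.1 then b x.2.2 else b' x.2.2.
have split (F : bool * ('I_n * 'I_n) -> R) : \sum_x F x =
    (\sum_i \sum_j F (true, (i, j))) + (\sum_i \sum_j F (false, (i, j))).
  rewrite (eq_bigr (fun x => F (x.1, x.2))); last by case.
  rewrite -(pair_bigA _ (fun (t : bool) x => F (t, x))) /= big_bool /=.
  by congr (_ + _); rewrite pair_bigA; apply: eq_bigr => -[].
have key l : 0 < l -> 0 <= \sum_x c x / ((l + u x) * (l + v x)).
  move=> l0; rewrite split /c /u /v /=.
  have PP := resolvent_antitone uU uU' (ge0 _ a0) (ge0 _ a'0) l0 aa'.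
  have QQ := resolvent_antitone uV uV' (ge0 _ b0) (ge0 _ b'0) l0 bb'.
  have pP := resolvent_psd U' (ge0 _ a'0) l0.
  have pQ := resolvent_psd V (ge0 _ b0) l0.
  set P := udiag U _ in PP; set P' := udiag U' _ in PP pP.
  set Q := udiag V _ in QQ pQ; set Q' := udiag V' _ in QQ.
  have : 0 <= Re (\tr (G^t* *m P *m G *m Q) - \tr (G^t* *m P' *m G *m Q')).
    apply: Re_ge0; rewrite tr_quad_sub.
    by apply: addr_ge0; apply: psd_tr_quad_ge0.
  rewrite cReB !Re_tr_quad // -sumrN => h.
  rewrite (eq_bigr (fun i => \sum_j (l + a i)^-1 * (l + b j)^-1 * w i j)); last first.
    by move=> i _; apply: eq_bigr => j _; rewrite invfM mulrC.
  rewrite [X in _ + X](eq_bigr (fun i => - \sum_j (l + a' i)^-1 * (l + b' j)^-1 * w' i j)) //.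
  by move=> i _; rewrite -sumrN; apply: eq_bigr => j _; rewrite invfM mulNr mulrC.
have := divpow_ge0_comb s01 (c := c) (u := u) (v := v).
have u0 x : 0 < u x by rewrite /u; case: ifP.
have v0 x : 0 <= v x by rewrite /v; case: ifP => _; exact: ltW.
move=> /(_ u0 v0 key); rewrite split /c /u /v /= => h.
rewrite -subr_ge0; apply: le_trans h _.
rewrite le_eqVlt; apply/orP; left; apply/eqP; rewrite -sumrN; congr (_ + _).
  by apply: eq_bigr => i _; apply: eq_bigr => j _; rewrite mulrC.
apply: eq_bigr => i _; rewrite -sumrN; apply: eq_bigr => j _.
by rewrite mulNr mulrC.
Qed.

(** With A = [udiag U a], this is the tangent inequality for (l + Y)^-1 at (l + A)^-1, multiplied by
    Y, traced, and transferred from resolvents to powers. Equality holds at Y = A. *)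
Lemma tr_pow_tangent (s : R) U V a b : 0 < s <= 1 ->
  U \is unitarymx -> V \is unitarymx ->
  (forall i, 0 < a i) -> (forall i, 0 < b i) ->
  \sum_i b i `^ (1 + s) <= (1 - s) * Re (\tr (udiag V b *m udiag U (fun i => a i `^ s))) +
   \sum_i \sum_j divpow s (a i) (a j) * absq ((U *m udiag V b *m U^t*) i j).
Proof.
move=> s01 uU uV a0 b0; set Y := udiag V b; have /andP[s0 s1] := s01.
have ge0 (x : 'I_n -> R) : (forall i, 0 < x i) -> forall i, 0 <= x i.
  by move=> h i; exact: ltW.
pose y i := Re ((U *m Y *m U^t*) i i).
pose w i j := absq ((U *m Y *m U^t*) i j).
(* One summand for each of the four terms of the tangent inequality. Taking [v = 0] encodes x / ((l
   + x) l) = 1/l - 1/(l + x), and the two contributions of 1/l cancel. *)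
pose T := ('I_n + 'I_n + 'I_n + 'I_n * 'I_n)%type.
pose c (x : T) := match x with inl (inl (inl i)) => y i * a i
  | inl (inl (inr i)) => - (b i * b i) | inl (inr i) => - (y i * a i)
  | inr (i, j) => w i j end.
pose u (x : T) := match x with inl (inl (inl i)) => a i
  | inl (inl (inr i)) => b i | inl (inr i) => a i | inr (i, j) => a i end.
pose v (x : T) := match x with inl (inl (inl i)) => 0
  | inl (inl (inr i)) => 0 | inl (inr i) => a i | inr (i, j) => a j end.
have split (F : T -> R) : \sum_x F x = \sum_i F (inl (inl (inl i))) +
    \sum_i F (inl (inl (inr i))) + \sum_i F (inl (inr i)) +
    \sum_i \sum_j F (inr (i, j)).
  rewrite !big_sumType /=; congr (_ + _).
  by rewrite pair_bigA; apply: eq_bigr => -[].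
have pY : psdmx Y by apply: udiag_psd; exact: ge0.
have key l : 0 < l -> 0 <= \sum_x c x / ((l + u x) * (l + v x)).
  move=> l0; rewrite split /c /u /v /=.
  have t1 : \sum_i y i * a i / ((l + a i) * (l + 0)) =
      Re (\tr (Y *m udiag U (fun i => l^-1 - (l + a i)^-1))).
    rewrite Re_tr_mul_udiag; apply: eq_bigr => i _; rewrite -/(y i); have ai := a0 i.
    by field; rewrite !gt_eqF // addr_gt0.
  have t2 : \sum_i - (b i * b i) / ((l + b i) * (l + 0)) =
      - Re (\tr (Y *m udiag V (fun i => l^-1 - (l + b i)^-1))).
    rewrite (udiagM _ _ uV) (tr_udiag _ uV) /= -sumrN; apply: eq_bigr => i _.
    by have bi := b0 i; field; rewrite !gt_eqF // addr_gt0.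
  pose Q := udiag U (fun i => (l + a i)^-1).
  have t3 : \sum_i - (y i * a i) / ((l + a i) * (l + a i)) =
      - Re (\tr (Y *m (Q *m udiag U a *m Q))).
    rewrite /Q !(udiagM _ _ uU) Re_tr_mul_udiag -sumrN; apply: eq_bigr => i _.
    by rewrite -/(y i); have ai := a0 i; field; rewrite !gt_eqF // addr_gt0.
  have t4 : \sum_i \sum_j w i j / ((l + a i) * (l + a j)) =
      Re (\tr (Y *m (Q *m Y *m Q))).
    have := Re_tr_quad (fun i => (l + a i)^-1) (fun i => (l + a i)^-1) Y uU uU.
    rewrite udiag_herm !mulmxA => ->; apply: eq_bigr => i _; apply: eq_bigr => j _.
    by rewrite invfM mulrC.
  rewrite t1 t2 t3 t4 -!cReB -cReD; apply: Re_ge0.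
  rewrite tr_mul_comb; apply: psd_tr_mul_ge0 => //.
  set P := udiag V (fun i => (l + b i)^-1).
  have -> : udiag U (fun i => l^-1 - (l + a i)^-1) -
      udiag V (fun i => l^-1 - (l + b i)^-1) - Q *m udiag U a *m Q + Q *m Y *m Q =
      P - Q - Q + Q *m udiag V (fun i => l + b i) *m Q.
    rewrite -(shift_udiag b l uV) mulmxDr mulmxDl.
    have -> : udiag U (fun i => l^-1 - (l + a i)^-1) = ((l^-1)%:C)%:M - Q.
      by rewrite -(udiag_cst _ uU) udiagN udiagD.
    have -> : udiag V (fun i => l^-1 - (l + b i)^-1) = ((l^-1)%:C)%:M - P.
      by rewrite -(udiag_cst _ uV) udiagN udiagD.
    have QE : Q *m udiag U a *m Q = Q - Q *m (l%:C)%:M *m Q.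
      have := resolvent_shift uU (ge0 _ a0) l0; rewrite -(shift_udiag a l uU).
      move=> /(congr1 (fun Z => Z *m Q)); rewrite mulmxDr mulmxDl mul1mx => h.
      by rewrite -[X in _ = X - _]h addrAC subrr add0r.
    rewrite QE -/Y; move: (Q *m Y *m Q) (Q *m _ *m Q) => A B.
    have cancel (V' : zmodType) (m q p x z : V') :
        m - q - (m - p) - (q - x) + z = p - q - q + (x + z).
      rewrite !opprB (addrC (m - q)) (addrA (p - m)) subrK (addrC x (- q)).
      by rewrite !addrA.
    exact: cancel.
  apply: (@inv_tangent (udiag V (fun i => l + b i)) P Q).
  - exact: shift_resolvent uV (ge0 _ b0) l0.
  - exact: resolvent_shift uV (ge0 _ b0) l0.
  - apply: shift_psd => //; exact: ge0.
  - exact: udiag_herm.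
  - exact: udiag_herm.
have := divpow_ge0_comb s01 (c := c) (u := u) (v := v).
have u0 x : 0 < u x by rewrite /u; case: x => [[[]|]|[]].
have v0 x : 0 <= v x by rewrite /v; case: x => [[[]|]|[]] // *; exact: ltW.
move=> /(_ u0 v0 key); rewrite split /c /u /v /= => h.
have dp0 x : 0 < x -> divpow s x 0 = x `^ s / x.
  by move=> x0; rewrite /divpow gt_eqF // powR0 ?gt_eqF // !subr0.
have dpx x : 0 < x -> divpow s x x = s * (x `^ s / x).
  move=> x0; rewrite /divpow eqxx; congr (_ * _).
  by rewrite powRB ?(gt_eqF x0) ?implybT // powRr1 // ltW.
rewrite Re_tr_mul_udiag mulr_sumr -lerBlDl -subr_ge0; apply: le_trans h _.
rewrite opprB addrA.
have e1 : \sum_i y i * a i * divpow s (a i) 0 = \sum_i a i `^ s * y i.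
  by apply: eq_bigr => i _; rewrite dp0 //; have ai := a0 i; field; rewrite gt_eqF.
have e2 : \sum_i - (b i * b i) * divpow s (b i) 0 = - \sum_i b i `^ (1 + s).
  rewrite -sumrN; apply: eq_bigr => i _; rewrite dp0 // powRD ?(gt_eqF (b0 i)) ?implybT //.
  by rewrite powRr1 ?ltW //; have bi := b0 i; field; rewrite gt_eqF.
have e3 : \sum_i - (y i * a i) * divpow s (a i) (a i) = - s * \sum_i a i `^ s * y i.
  rewrite mulr_sumr; apply: eq_bigr => i _; rewrite dpx //.
  by have ai := a0 i; field; rewrite gt_eqF.
have e4 : \sum_i \sum_j w i j * divpow s (a i) (a j) =
    \sum_i \sum_j divpow s (a i) (a j) * absq ((U *m Y *m U^t*) i j).
  by apply: eq_bigr => i _; apply: eq_bigr => j _; rewrite mulrC.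
rewrite e1 e2 e3 e4 -mulr_sumr -/(y _); move: (\sum_i \sum_j _) => X.
have -> : \sum_i a i `^ s * Re ((U *m Y *m U ^t*) i i) = \sum_i a i `^ s * y i by [].
move: (\sum_i a i `^ s * y i) (\sum_i b i `^ _) => z t; lra.
Qed.

End OperatorInequalities.

(** * Kraus decompositions and GNS symmetry *)

Section Kraus.
Variables (R : realType) (n : nat).
Local Notation C := R[i].
Implicit Types (X Y Z : 'M[C]_n) (Phi : {linear 'M[C]_n -> 'M[C]_n}).

Definition kraus (I : finType) (K : I -> 'M[C]_n) (Phi : 'M[C]_n -> 'M[C]_n) :=
  forall X, Phi X = \sum_a (K a)^t* *m X *m K a.

Lemma matrix_sum_deltaE (Phi : {linear 'M[C]_n -> 'M[C]_n}) X :
  Phi X = \sum_k \sum_l X k l *: Phi (delta_mx k l).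
Proof.
rewrite {1}(matrix_sum_delta X) linear_sum; apply: eq_bigr => k _.
by rewrite linear_sum; apply: eq_bigr => l _; rewrite linearZ.
Qed.

(* Choi: the block matrix of the Phi (delta_mx k l) is positive semidefinite. *)
Lemma cp_kraus Phi : completely_positive Phi ->
  exists (m : nat) (K : 'I_m -> 'M[C]_n), kraus K Phi.
Proof.
move=> cP; pose A := \mxblock_(i < n, j < n) (delta_mx i j : 'M[C]_n).
have pA : psdmx A.
  have -> : A = (\mxrow_(j < n) (delta_mx 0 j : 'rV[C]_n))^t* *m
      (\mxrow_(j < n) (delta_mx 0 j : 'rV[C]_n)).
    have -> : (\mxrow_(j < n) (delta_mx 0 j : 'rV[C]_n))^t* =
        \mxcol_(i < n) (delta_mx i 0 : 'cV[C]_n).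
      by apply/matrixP => k l; rewrite !mxE rmorph_nat andbC.
    rewrite mul_mxcol_mxrow; apply: eq_mxblock => i j.
    by rewrite mul_delta_mx.
  exact: psd_gram.
have [S SE] := psd_factor (cP n A pA).
(* Each row of the factor [S] of the Choi matrix, cut into blocks of length [n], is a Kraus
   operator. *)
have [m [T PE]] : exists (m : nat) (T : 'I_m -> 'M[C]_n), forall k l i j,
    Phi (delta_mx k l) i j = \sum_a (T a k i)^* * T a l j.
  exists (\sum_(i < n) n)%N, (fun a => \matrix_(k, i) S a (tagnat.Rank k i)).
  move=> k l i j; have := congr1 (fun Z : 'M[C]_(\sum_(i < n) n, \sum_(j < n) n) =>
    submxblock (p_ := fun=> n) (q_ := fun=> n) Z k l i j) SE.
  rewrite mxblockK mxblockK => ->; rewrite !mxE; apply: eq_bigr => a _.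
  by rewrite !mxE.
exists m, T => X; apply/matrixP => i j; rewrite matrix_sum_deltaE !summxE.
under eq_bigr => k _.
  rewrite summxE.
  under eq_bigr => l _ do rewrite mxE PE mulr_sumr.
  rewrite exchange_big /=.
  over.
rewrite exchange_big /=; apply: eq_bigr => a _; rewrite mxE.
under [RHS]eq_bigr => l _ do rewrite mxE mulr_suml.
rewrite [RHS]exchange_big; apply: eq_bigr => k _; apply: eq_bigr => l _.
by rewrite !mxE mulrCA mulrA.
Qed.

Section KrausFamily.
Variables (I : finType) (K : I -> 'M[C]_n) (Phi : {linear 'M[C]_n -> 'M[C]_n}).
Hypothesis KPhi : kraus K Phi.

Lemma kraus_trmxC X : Phi (X^t*) = (Phi X)^t*.
Proof.
rewrite !KPhi trmxC_sum; apply: eq_bigr => a _.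
by rewrite !trmxC_mul trmxCK mulmxA.
Qed.

Lemma kraus_psd X : psdmx X -> psdmx (Phi X).
Proof. by move=> pX; rewrite KPhi; apply: psd_sum => a _; exact: psd_congr. Qed.

Hypothesis Phi1 : Phi 1%:M = 1%:M.

Lemma kraus_unital : \sum_a (K a)^t* *m K a = 1%:M.
Proof. by rewrite -Phi1 KPhi; apply: eq_bigr => a _; rewrite mulmx1. Qed.

(** One identity with two uses: [Z = Phi X] gives the Schwarz inequality, and [Z = X] expresses the
    commutators of X with the Kraus operators through [Phi]. *)
Lemma kraus_defect X Z :
  \sum_a (X *m K a - K a *m Z)^t* *m (X *m K a - K a *m Z) =
  Phi (X^t* *m X) - (Phi X)^t* *m Z - Z^t* *m Phi X + Z^t* *m Z.
Proof.
have -> : Z^t* *m Z = \sum_a Z^t* *m ((K a)^t* *m K a) *m Z.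
  by rewrite -mulmx_suml -mulmx_sumr kraus_unital mulmx1.
rewrite -kraus_trmxC !KPhi mulmx_suml mulmx_sumr -!sumrB -big_split /=.
apply: eq_bigr => a _; move: (K a) => k.
have subM (A B D : 'M[C]_n) : (A - B)^t* *m (A - D) =
    A^t* *m A - A^t* *m D - B^t* *m A + B^t* *m D.
  by rewrite trmxCB mulmxBl !mulmxBr opprB addrA addrAC.
have -> : (X *m k - k *m Z)^t* *m (X *m k - k *m Z) =
    (X *m k)^t* *m (X *m k) - (X *m k)^t* *m (k *m Z) - (k *m Z)^t* *m (X *m k) +
    (k *m Z)^t* *m (k *m Z) := subM _ _ _.
by rewrite (trmxC_mul X) (trmxC_mul k) !mulmxA.
Qed.

Lemma kraus_schwarz X : psdmx (Phi (X^t* *m X) - (Phi X)^t* *m Phi X).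
Proof.
have -> : Phi (X^t* *m X) - (Phi X)^t* *m Phi X =
    \sum_a (X *m K a - K a *m Phi X)^t* *m (X *m K a - K a *m Phi X).
  by rewrite kraus_defect subrK.
by apply: psd_sum => a _; exact: psd_gram.
Qed.

(** X^* X is at most its trace times 1, and the Schwarz inequality carries this to [Phi X]. The
    bound is the same for all unital [Phi], hence uniform along a semigroup. *)
Lemma kraus_entry_bound X i j :
  absq ((Phi X) i j) <= Re (\tr (X^t* *m X)).
Proof.
pose c := Re (\tr (X^t* *m X)).
have tE : \tr (X^t* *m X) = c%:C by rewrite Re_real // gram_ge0.
have h1 : psdmx ((c%:C)%:M - (Phi X)^t* *m Phi X).
  have -> : (c%:C)%:M - (Phi X)^t* *m Phi X = Phi ((c%:C)%:M - X^t* *m X) +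
      (Phi (X^t* *m X) - (Phi X)^t* *m Phi X).
    by rewrite linearB /= addrA subrK -scalemx1 linearZ /= Phi1.
  apply: psdD; last exact: kraus_schwarz.
  by apply: kraus_psd; apply: psd_le_tr => //; exact: psd_gram.
have := h1 (delta_mx 0 j); rewrite -rowE mxE (bigD1 j) //= big1 => [|k kj].
  rewrite addr0 !mxE !eqxx rmorph1 mulr1 mulr1n.
  under eq_bigr => k _ do rewrite !mxE -absqE.
  rewrite -rmorph_sum -rmorphB ler0c subr_ge0 => /(le_trans _); apply.
  rewrite (bigD1 i) //= lerDl sumr_ge0 // => k _; exact: absq_ge0.
by rewrite !mxE (negbTE kj) andbF rmorph0 mulr0.
Qed.

End KrausFamily.

Lemma tr_mul_eq0 (A : 'M[C]_n) : (forall Z, \tr (Z *m A) = 0) -> A = 0.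
Proof. by move=> h; apply: gram_eq0. Qed.

Section GnsSymmetric.
Variables (tau : 'M[C]_n) (Phi : {linear 'M[C]_n -> 'M[C]_n}).
Hypotheses (tau_unit : tau \in unitmx) (Phi_gns : gns_symmetric tau Phi).
Hypothesis Phi_trmxC : forall X, Phi (X^t*) = (Phi X)^t*.

Lemma gns_tr X Y : \tr (tau *m X *m Phi Y) = \tr (tau *m Phi X *m Y).
Proof. by have := Phi_gns (X^t*) Y; rewrite Phi_trmxC !trmxCK. Qed.

(** Symmetry moves [Phi] to the test matrix [Z], cyclicity of the trace carries tau to the other
    side of it, and symmetry moves [Phi] back. *)
Lemma gns_modular X : Phi (tau *m X *m invmx tau) = tau *m Phi X *m invmx tau.
Proof.
set Y := tau *m X *m invmx tau.
have YE : Y *m tau = tau *m X by rewrite /Y -mulmxA mulVmx // mulmx1.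
suff h : Phi Y *m tau = tau *m Phi X by rewrite -h mulmxK.
apply/eqP; rewrite -subr_eq0; apply/eqP.
apply: tr_mul_eq0 => Z; rewrite mulmxBr linearB /=; apply/eqP; rewrite subr_eq0.
apply/eqP; rewrite [RHS]mxtrace_mulC -gns_tr [RHS]mxtrace_mulC -YE.
rewrite [in LHS]mulmxA [LHS]mxtrace_mulC [in LHS]mulmxA gns_tr.
by rewrite [in RHS]mulmxA [RHS]mxtrace_mulC [in RHS]mulmxA.
Qed.

Lemma gns_modular_eigen X (q : C) : tau *m X = q *: (X *m tau) ->
  tau *m Phi X = q *: (Phi X *m tau).
Proof.
move=> h; have := gns_modular X; rewrite h -scalemxAl mulmxK // linearZ /= => e.
by rewrite -[tau *m Phi X](mulmxKV tau_unit) -e -scalemxAl.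
Qed.

End GnsSymmetric.

End Kraus.

(** * Kraus operators that are eigenvectors of the modular operator *)

Section ModularKraus.
Variables (R : realType) (n : nat).
Local Notation C := R[i].
Variables (U : 'M[C]_n) (d : 'I_n -> R).
Hypotheses (uU : U \is unitarymx) (d0 : forall i, 0 < d i).
Local Notation tau := (udiag U d).

Lemma udiag_posunit : tau \in unitmx.
Proof.
exact: (mulmx1_unit (udiag_unit uU (fun i => lt0r_neq0 (d0 i)))).1.
Qed.

Let E k l : 'M[C]_n := U^t* *m delta_mx k l *m U.

Let EE k l : U *m E k l *m U^t* = delta_mx k l.
Proof. by rewrite /E !mulmxA (unitaryK uU) mul1mx (mulmxtVK _ uU). Qed.

Let modular_entries (Z : 'M[C]_n) (q : R) : tau *m Z = q%:C *: (Z *m tau) ->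
  forall i j, ((d i)%:C - q%:C * (d j)%:C) * (U *m Z *m U^t*) i j = 0.
Proof.
rewrite scalemxAr udiagZ => h i j; have := intertwine_entries uU uU h i j.
by rewrite rmorphM mulrBl => ->; rewrite [X in _ - X]mulrC subrr.
Qed.

Let conjUK Z : Z = U^t* *m (U *m Z *m U^t*) *m U.
Proof. by rewrite !mulmxA (unitaryKC uU) mul1mx (mulmxKtV _ uU). Qed.

Let E_dec Z : Z = \sum_k \sum_l (U *m Z *m U^t*) k l *: E k l.
Proof.
rewrite [LHS]conjUK {1}(matrix_sum_delta (U *m Z *m U^t*)) mulmx_sumr mulmx_suml.
apply: eq_bigr => k _; rewrite mulmx_sumr mulmx_suml; apply: eq_bigr => l _.
by rewrite -scalemxAr -scalemxAl.
Qed.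

Let E_modular k l : tau *m E k l = (d k / d l)%:C *: (E k l *m tau).
Proof.
rewrite scalemxAr udiagZ; apply: entries_intertwine => // i j; rewrite EE !mxE.
case: (i =P k) => [->|]; last by rewrite mulr0 mul0r.
case: (j =P l) => [->|]; last by rewrite mulr0 mul0r.
by rewrite mulr1 mul1r divfK // gt_eqF.
Qed.

Lemma gns_entries (Phi : {linear 'M[C]_n -> 'M[C]_n}) :
  gns_symmetric tau Phi -> (forall X, Phi (X^t*) = (Phi X)^t*) ->
  forall k l i j, d i / d j != d k / d l -> (U *m Phi (E k l) *m U^t*) i j = 0.
Proof.
move=> gP cP k l i j dd.
have := gns_modular_eigen udiag_posunit gP cP (E_modular k l).
move=> /modular_entries /(_ i j) /eqP; rewrite mulf_eq0 => /orP[|/eqP //].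
rewrite -rmorphM -rmorphB (fmorph_eq0 (real_complex R)) subr_eq0 => /eqP e.
by case/eqP: dd; rewrite e mulfK // gt_eqF.
Qed.

(** Multiplying entries by [h (d i / d j)] in the eigenbasis of tau is a function of the modular
    operator, with which a GNS-symmetric map commutes. *)
Lemma gns_schur (Phi : {linear 'M[C]_n -> 'M[C]_n}) (h : R -> R) X Y :
  gns_symmetric tau Phi -> (forall X, Phi (X^t*) = (Phi X)^t*) ->
  (forall i j, (U *m Y *m U^t*) i j = (h (d i / d j))%:C * (U *m X *m U^t*) i j) ->
  forall i j, (U *m Phi Y *m U^t*) i j =
    (h (d i / d j))%:C * (U *m Phi X *m U^t*) i j.
Proof.
move=> gP cP XY i j.
have PE Z : (U *m Phi Z *m U^t*) i j = \sum_k \sum_l (U *m Z *m U^t*) k l *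
    (U *m Phi (E k l) *m U^t*) i j.
  rewrite {1}(E_dec Z) linear_sum mulmx_sumr mulmx_suml summxE; apply: eq_bigr => k _.
  rewrite linear_sum mulmx_sumr mulmx_suml summxE; apply: eq_bigr => l _.
  by rewrite linearZ /= -scalemxAr -scalemxAl mxE.
rewrite !PE mulr_sumr; apply: eq_bigr => k _; rewrite mulr_sumr; apply: eq_bigr => l _.
rewrite XY; have [->|dd] := eqVneq (d i / d j) (d k / d l); first by rewrite mulrA.
by rewrite (gns_entries gP cP dd) !mulr0.
Qed.

(** Cut every Kraus operator into its parts with a fixed ratio d k / d i. A product of parts with
    distinct ratios d k / d i and d l / d j contributes to an entry with d i / d j != d k / d l, and
    these entries of [Phi] vanish by [gns_entries]; dropping the cross terms leaves [Phi]
    unchanged. *)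
Lemma modular_kraus (Phi : {linear 'M[C]_n -> 'M[C]_n}) :
  completely_positive Phi -> gns_symmetric tau Phi ->
  exists (I : finType) (K : I -> 'M[C]_n) (r : I -> R),
   [/\ kraus K Phi, forall a, 0 < r a
     & forall a, tau *m K a = (r a)%:C *: (K a *m tau)].
Proof.
move=> cP gP; have [m [K KP]] := cp_kraus cP; have hP := kraus_trmxC KP.
(* Several pairs may share a ratio; as an index type, [seq_sub rs] counts each ratio once. *)
pose rs := [seq d x.1 / d x.2 | x : 'I_n * 'I_n].
have rsP k i : d k / d i \in rs by apply/mapP; exists (k, i); rewrite ?mem_enum.
pose k0 (a : 'I_m) : 'M[C]_n := U *m K a *m U^t*.
pose kq (x : 'I_m * seq_sub rs) : 'M[C]_n :=
  \matrix_(k, i) (k0 x.1 k i *+ (d k / d i == ssval x.2)).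
pose K' (x : 'I_m * seq_sub rs) : 'M[C]_n := U^t* *m kq x *m U.
exists ('I_m * seq_sub rs)%type, K', (fun x => ssval x.2); split.
- move=> X; pose Psi (Z : 'M[C]_n) := \sum_x (K' x)^t* *m Z *m K' x.
  rewrite -/(Psi X).
  have PsiD : {morph Psi : Y Z / Y + Z}.
    by move=> Y Z; rewrite /Psi -big_split; apply: eq_bigr => a _ /=;
      rewrite mulmxDr mulmxDl.
  have Psi0 : Psi 0 = 0.
    by rewrite /Psi big1 // => a _; rewrite mulmx0 mul0mx.
  have PsiZ c Z : Psi (c *: Z) = c *: Psi Z.
    by rewrite /Psi scaler_sumr; apply: eq_bigr => a _; rewrite -scalemxAr -scalemxAl.
  have conjE (L : 'M[C]_n) k l i j :
      (U *m (L^t* *m E k l *m L) *m U^t*) i j =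
      ((U *m L *m U^t*) k i)^* * (U *m L *m U^t*) l j.
    have -> : U *m (L^t* *m E k l *m L) *m U^t* =
        (U *m L *m U^t*)^t* *m delta_mx k l *m (U *m L *m U^t*).
      by rewrite !trmxC_mul trmxCK /E !mulmxA.
    move: (U *m L *m U^t*) => T; rewrite mxE (bigD1 l) //= big1 => [|l' ll'].
      rewrite addr0 mxE (bigD1 k) //= big1 => [|k' kk'].
        by rewrite addr0 !mxE !eqxx mulr1.
      by rewrite [delta_mx _ _ _ _]mxE (negbTE kk') mulr0.
    rewrite mxE big1 ?mul0r // => k' _.
    by rewrite [delta_mx _ _ _ _]mxE (negbTE ll') andbF mulr0.
  rewrite {1}(E_dec X) [in RHS](E_dec X) linear_sum (big_morph Psi PsiD Psi0).
  apply: eq_bigr => k _; rewrite linear_sum (big_morph Psi PsiD Psi0).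
  apply: eq_bigr => l _; rewrite linearZ PsiZ /=; congr (_ *: _).
  suff h : U *m Phi (E k l) *m U^t* = U *m Psi (E k l) *m U^t*.
    by rewrite [LHS]conjUK h -conjUK.
  apply/matrixP => i j; rewrite /Psi mulmx_sumr mulmx_suml summxE.
  rewrite [RHS](eq_bigr _ (fun x _ => conjE (K' x) k l i j)).
  have kqE x : U *m K' x *m U^t* = kq x.
    by rewrite /K' !mulmxA (unitaryK uU) mul1mx (mulmxtVK _ uU).
  rewrite [RHS](eq_bigr (fun x => (k0 x.1 k i)^* * k0 x.1 l j *+
     ((d k / d i == ssval x.2) && (d l / d j == ssval x.2)))); last first.
    move=> x _; rewrite kqE !mxE; case: (_ == _) => /=; first by rewrite mulr1n mulrnAr.
    by rewrite !mulr0n rmorph0 mul0r.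
  rewrite -[RHS](pair_bigA _ (fun a (q : seq_sub rs) => (k0 a k i)^* * k0 a l j *+
     ((d k / d i == ssval q) && (d l / d j == ssval q)))) /=.
  have [e|dd] := eqVneq (d k / d i) (d l / d j); last first.
    rewrite (gns_entries gP hP); last first.
      apply: contra dd => /eqP e; rewrite eqr_div ?(gt_eqF (d0 _)) //.
      have := congr1 (fun z => z * (d j * d l)) e => /= {}e.
      have ej : d i / d j * (d j * d l) = d i * d l by field; rewrite gt_eqF.
      have el : d k / d l * (d j * d l) = d k * d j by field; rewrite gt_eqF.
      have {}e : d i * d l = d k * d j by rewrite -el -e ej.
      by rewrite -e mulrC.
    rewrite big1 // => a _; rewrite big1 // => q _.
    case: eqP => //= <-; rewrite eq_sym (negbTE dd); exact: mulr0n.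
  rewrite KP mulmx_sumr mulmx_suml summxE; apply: eq_bigr => a _.
  rewrite conjE -/(k0 a) (bigD1 (SeqSub (rsP k i))) //= -e eqxx mulr1n.
  rewrite big1 ?addr0 // => q; rewrite -(inj_eq val_inj) /= => qq.
  by rewrite eq_sym (negbTE qq).
- by case=> a [q qP] /=; case/mapP: qP => x _ ->; rewrite divr_gt0.
- case=> a [q qP] /=; rewrite scalemxAr udiagZ; apply: entries_intertwine => // k i.
  rewrite /K' !mulmxA (unitaryK uU) mul1mx (mulmxtVK _ uU) mxE /=.
  case: eqP => [<-|_]; last by rewrite mulr0n mulr0 mul0r.
  by rewrite mulr1n divfK ?gt_eqF // mulrC.
Qed.

(* Duality under the GNS inner product exchanges K and its adjoint. *)
Lemma modular_kraus_dual (Phi : {linear 'M[C]_n -> 'M[C]_n}) (I : finType)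
    (K : I -> 'M[C]_n) (r : I -> R) :
  kraus K Phi -> gns_symmetric tau Phi -> (forall a, 0 < r a) ->
  (forall a, tau *m K a = (r a)%:C *: (K a *m tau)) ->
  forall X, Phi X = \sum_a ((r a)^-1)%:C *: (K a *m X *m (K a)^t*).
Proof.
move=> KP gP r0 rK X; have hP := kraus_trmxC KP.
apply/eqP; rewrite -subr_eq0; apply/eqP.
suff h : tau *m (Phi X - \sum_a ((r a)^-1)%:C *: (K a *m X *m (K a)^t*)) = 0.
  by rewrite -[LHS](mulKmx udiag_posunit) h mulmx0.
apply: tr_mul_eq0 => Z; rewrite !mulmxBr linearB /=.
apply/eqP; rewrite subr_eq0; apply/eqP.
rewrite mxtrace_mulC -(gns_tr gP hP) KP !mulmx_sumr !linear_sum /=.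
apply: eq_bigr => a _; rewrite -!scalemxAr.
have Kt : K a *m tau = ((r a)^-1)%:C *: (tau *m K a).
  by rewrite rK scalerA -rmorphM mulVf ?gt_eqF // scale1r.
have -> : \tr (tau *m X *m ((K a)^t* *m Z *m K a)) =
    \tr (K a *m tau *m X *m (K a)^t* *m Z).
  by rewrite !mulmxA mxtrace_mulC !mulmxA.
rewrite Kt -!scalemxAl [in RHS]mxtraceZ [in LHS]mxtraceZ.
by rewrite [in RHS]mxtrace_mulC !mulmxA.
Qed.

Lemma modular_powR (K : 'M[C]_n) (q s : R) : 0 < q ->
  tau *m K = q%:C *: (K *m tau) ->
  mxpow tau s *m K = (q `^ s)%:C *: (K *m mxpow tau s).
Proof.
move=> q0; rewrite (mxpow_udiag _ _ uU) !scalemxAr !udiagZ => h.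
have -> : udiag U (fun i => q `^ s * d i `^ s) =
    udiag U (@powR R ^~ s \o (fun i => q * d i)).
  by apply: eq_udiag => i /=; rewrite powRM // ltW.
apply: (intertwine_fun (fa := @powR R ^~ s) (fb := @powR R ^~ s) uU uU _ h).
by move=> i j ->.
Qed.

End ModularKraus.

(** * A real-valued matrix norm *)

Section MatrixNorm.
Variables (R : realType) (n : nat).
Local Notation C := R[i].
Implicit Types (X Y Z : 'M[C]_n).

(** The norm of a complex matrix is a nonnegative element of [C]; its real part carries the same
    information and lives in [R]. *)
Definition mxn X : R := Re `|X|.

Lemma mxnE X : (mxn X)%:C = `|X|.
Proof. by rewrite /mxn Re_real. Qed.

Lemma mxn_ge0 X : 0 <= mxn X.
Proof. by rewrite -ler0c mxnE. Qed.

Lemma mxnD X Y : mxn (X + Y) <= mxn X + mxn Y.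
Proof. by rewrite -lecR rmorphD /= !mxnE ler_normD. Qed.

Lemma mxnZ (c : R) X : mxn (c%:C *: X) = `|c| * mxn X.
Proof.
apply: complexI; rewrite rmorphM /= !mxnE normrZ; congr (_ * _).
by rewrite normc_def /= expr0n addr0 sqrtr_sqr.
Qed.

Lemma mxnN X : mxn (- X) = mxn X.
Proof. by apply: complexI; rewrite !mxnE normrN. Qed.

Lemma mxn0 : mxn 0 = 0.
Proof. by apply: complexI; rewrite mxnE normr0. Qed.

Lemma mxn_eq0 X : mxn X = 0 -> X = 0.
Proof.
by move=> /(congr1 (real_complex R)) /=; rewrite mxnE => /eqP; rewrite normr_eq0 => /eqP.
Qed.

Lemma absq_norm (z : C) : (absq z)%:C = `|z| ^+ 2.
Proof. by rewrite absqE normCK mulrC. Qed.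

Lemma mxn_entry X i j : absq (X i j) <= mxn X ^+ 2.
Proof.
rewrite -lecR absq_norm rmorphXn /= mxnE ler_sqr ?nnegrE ?normr_ge0 //.
rewrite [leRHS]/Num.norm /= mx_normE.
by rewrite -[leLHS]nngE num_le; apply: (le_bigmax _ _ (i, j)).
Qed.

Lemma mxn_le X (c : R) : 0 <= c -> (forall i j, absq (X i j) <= c ^+ 2) ->
  mxn X <= c.
Proof.
move=> c0 h; have [->//|x0] := eqVneq (mxn X) 0.
have [|[i j]] := @mx_norm_neq0 _ _ _ X.
  by apply: contra x0 => /eqP e; rewrite -(inj_eq (@complexI R)) mxnE; exact/eqP.
rewrite -[mx_norm X]/(`|X|) -mxnE /= => e.
by rewrite -ler_sqr ?nnegrE ?mxn_ge0 // -lecR rmorphXn /= e -absq_norm lecR.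
Qed.

Lemma tr_gram X : Re (\tr (X^t* *m X)) = \sum_i \sum_j absq (X i j).
Proof.
rewrite /mxtrace Re_sum exchange_big; apply: eq_bigr => j _; rewrite mxE Re_sum.
by apply: eq_bigr => i _; rewrite !mxE -absqE.
Qed.

Lemma mxn_tr_mul (A X : 'M[C]_n) :
  `|Re (\tr (A *m X))| <= (\sum_i \sum_j Num.sqrt (absq (A i j))) * mxn X.
Proof.
have Re_le (z : C) : `|Re z| <= Num.sqrt (absq z).
  by rewrite -sqrtr_sqr ler_wsqrtr // /absq lerDl sqr_ge0.
rewrite /mxtrace Re_sum mulr_suml; apply: le_trans (ler_norm_sum _ _ _) _.
apply: ler_sum => i _; rewrite mxE Re_sum mulr_suml.
apply: le_trans (ler_norm_sum _ _ _) _; apply: ler_sum => j _.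
apply: le_trans (Re_le _) _; rewrite absqM sqrtrM ?absq_ge0 //.
rewrite ler_wpM2l ?sqrtr_ge0 // -[leRHS]ger0_norm ?mxn_ge0 // -sqrtr_sqr.
by rewrite ler_wsqrtr // mxn_entry.
Qed.

End MatrixNorm.

(** * The semigroup and its generator *)

Section Semigroup.
Variables (R : realType) (n : nat).
Local Notation C := R[i].
Variables (P : R -> {linear 'M[C]_n -> 'M[C]_n}) (L : {linear 'M[C]_n -> 'M[C]_n}).
Hypotheses (P_qms : qms P) (L_gen : generator_of P L).
Implicit Types (X Y Z : 'M[C]_n) (t h e l : R).

(** The factor [n] compares the Hilbert-Schmidt norm with the largest modulus of an entry. What
    matters is that it does not depend on [t]. *)
Lemma qms_bound t X : 0 <= t -> mxn (P t X) <= n%:R * mxn X.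
Proof.
move=> t0; have [m [K KP]] := cp_kraus (qms_cp P_qms t0).
apply: mxn_le => [|i j]; first by rewrite mulr_ge0 // mxn_ge0.
apply: le_trans (kraus_entry_bound KP (qms_unital P_qms t0) X i j) _.
rewrite tr_gram (le_trans (y := \sum_(i < n) \sum_(j < n) mxn X ^+ 2)) //.
  by apply: ler_sum => a _; apply: ler_sum => b _; exact: mxn_entry.
rewrite le_eqVlt; apply/orP; left; apply/eqP.
under eq_bigr => a _ do rewrite sumr_const card_ord -[_ *+ _]mulr_natl.
by rewrite sumr_const card_ord -[_ *+ _]mulr_natl mulrA -expr2 exprMn.
Qed.

Lemma generator_near X e : 0 < e ->
  \forall h \near 0^'+, mxn (P h X - X - h%:C *: L X) <= e * h.
Proof.
move=> e0; have ec : (0 : C) < e%:C by rewrite ltcR.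
have /(cvgr_dist_lt (V := 'M[C]_n)) /(_ _ ec) H := @L_gen X.
near=> h; have h0 : 0 < h by [].
have : `|L X - (h^-1)%:C *: (P h X - X)| < e%:C by near: h.
rewrite -mxnE ltcR => /ltW; rewrite -(ler_pM2r h0) => /(le_trans _); apply.
rewrite mulrC -[X in X * _](ger0_norm (ltW h0)) -mxnZ -mxnN le_eqVlt.
apply/orP; left; apply/eqP; congr mxn; rewrite scalerBr scalerA -rmorphM.
by rewrite mulfV ?gt_eqF // scale1r opprB.
Unshelve. all: by end_near. Qed.

(** The choice of [e] makes the error terms at most [- v * h / 2] in total, so they cannot
    compensate the negative main term [v * h]. *)
Lemma perturbation_lt0 (e h kA kB v x y a b : R) : 0 < h -> 0 < 1 + kA + kB ->
  v < 0 -> e = - v / 2 / (1 + kA + kB) -> v = x + y ->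
  `|a| <= kA * (e * h) -> `|b| <= kB * (e * h) ->
  0 <= a + h * x + (b + h * y) -> False.
Proof.
move=> h0 s0 v0 eE vE; rewrite !ler_norml => /andP[_ bX] /andP[_ bY] H0.
have {}eE : e * (1 + kA + kB) = - v / 2 by rewrite eE divfK // gt_eqF.
have e0 : 0 < e.
  by rewrite -(pmulr_lgt0 _ s0) eE divr_gt0 // oppr_gt0.
have : h * (e * (1 + kA + kB) - e + v) < 0 by rewrite pmulr_rlt0 // eE; lra.
rewrite vE; lra.
Qed.

(** Transfers inequalities from the semigroup, where Kraus operators are available, to the
    generator. There are two traces because each application compares two of them, with different
    arguments. *)
Lemma generator_limit_ge0 (A B X Y : 'M[C]_n) :
  (forall h, 0 < h -> 0 <= Re (\tr (A *m (P h X - X)) + \tr (B *m (P h Y - Y)))) ->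
  0 <= Re (\tr (A *m L X) + \tr (B *m L Y)).
Proof.
move=> H; set v := Re _.
pose kA := \sum_i \sum_j Num.sqrt (absq (A i j)).
pose kB := \sum_i \sum_j Num.sqrt (absq (B i j)).
have k0 (D : 'M[C]_n) : 0 <= \sum_i \sum_j Num.sqrt (absq (D i j)).
  by rewrite sumr_ge0 // => i _; rewrite sumr_ge0 // => j _; rewrite sqrtr_ge0.
rewrite leNgt; apply/negP => v0.
pose e := - v / 2 / (1 + kA + kB).
have s0 : 0 < 1 + kA + kB by have := k0 A; have := k0 B; rewrite -/kA -/kB; lra.
have e0 : 0 < e by rewrite !divr_gt0 // oppr_gt0.
suff : False by [].
have [h [h0 [hX hY]]] := filter_ex (filterI (nbhs_right_gt 0)
  (filterI (generator_near X e0) (generator_near Y e0))).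
have dec (D Z : 'M[C]_n) : Re (\tr (D *m (P h Z - Z))) =
    Re (\tr (D *m (P h Z - Z - h%:C *: L Z))) + h * Re (\tr (D *m L Z)).
  by rewrite -cReMl -mxtraceZ scalemxAr -cReD -mxtraceD -mulmxDr subrK.
apply: (perturbation_lt0 h0 s0 v0 (erefl e) (cReD _ _)
  (le_trans (mxn_tr_mul A _) (ler_wpM2l (k0 A) hX))
  (le_trans (mxn_tr_mul B _) (ler_wpM2l (k0 B) hY))).
by have := H h h0; rewrite cReD !dec.
Qed.

(** [D h] is o(h) at 0 from the right, and the semigroup law bounds [D t] by [N] times a constant
    times the norm of [D (t / N)]. For large [N] this is arbitrarily small. *)
Lemma generator_eigen X l t : L X = l%:C *: X -> 0 <= t ->
  P t X = (expR (l * t))%:C *: X.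
Proof.
move=> LX; rewrite le_eqVlt => /predU1P[<-|t0].
  by rewrite (qms0 P_qms) mulr0 expR0 scale1r.
pose D h := (expR (- (l * h)))%:C *: P h X - X.
suff D0 : D t = 0.
  have /eqP := D0; rewrite subr_eq0 => /eqP/(congr1 (fun Z => (expR (l * t))%:C *: Z)).
  by rewrite scalerA -rmorphM -expRD subrr expR0 scale1r.
apply: mxn_eq0; apply/eqP; rewrite eq_le mxn_ge0 andbT.
(* Bounds the norm of e^(-lr) P_r for all r in [0, t]. *)
pose M := n%:R * expR (`|l| * t).
have M0 : 0 <= M by rewrite mulr_ge0 // expR_ge0.
have tele h N : 0 <= h -> N%:R * h <= t -> mxn (D (N%:R * h)) <= N%:R * (M * mxn (D h)).
  move=> h0; elim: N => [|N IHN] Nt.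
    rewrite !mul0r /D mulr0 oppr0 expR0 scale1r (qms0 P_qms) subrr.
    by rewrite mxn0.
  have Nh : N%:R * h <= t.
    by apply: le_trans Nt; rewrite ler_wpM2r // ler_nat.
  have -> : D (N.+1%:R * h) = D (N%:R * h) +
      (expR (- (l * (N%:R * h))))%:C *: P (N%:R * h) (D h).
    have PD : P (N%:R * h) (D h) =
        (expR (- (l * h)))%:C *: P (N%:R * h) (P h X) - P (N%:R * h) X.
      by rewrite /D linearB linearZ.
    rewrite PD scalerBr scalerA -rmorphM -expRD.
    rewrite /D -natr1 mulrDl mul1r (qmsD P_qms); [|exact: mulr_ge0|exact: h0].
    rewrite [RHS]addrC addrA subrK; congr (_ - _); congr ((expR _)%:C *: _); ring.
  apply: le_trans (mxnD _ _) _; rewrite -natr1 mulrDl mul1r; apply: lerD; first exact: IHN.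
  rewrite mxnZ ger0_norm ?expR_ge0 //.
  apply: le_trans (ler_wpM2l (expR_ge0 _) (qms_bound _ _)) _; first by rewrite mulr_ge0.
  rewrite mulrCA mulrA /M -!mulrA ler_wpM2l //; rewrite ler_wpM2r ?mxn_ge0 // ler_expR.
  rewrite -mulrN; apply: le_trans (ler_norm _) _; rewrite normrM normrN.
  by rewrite ler_wpM2l // ger0_norm // mulr_ge0.
have small e : 0 < e -> \forall h \near (0 : R)^'+, mxn (D h) <= e * h.
  move=> e0.
  (* Half of [e] is spent on the error of the difference quotient, amplified by e^(-lh), and half on
     the quadratic remainder of e^(-lh) (1 + lh) - 1. *)
  pose e1 := e / 2 / expR `|l|.
  pose e2 := e / 2 / (1 + l ^+ 2 * mxn X).
  have s0 : 0 < 1 + l ^+ 2 * mxn X by rewrite ltr_pwDl // mulr_ge0 ?sqr_ge0 ?mxn_ge0.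
  have e10 : 0 < e1 by rewrite !divr_gt0 // expR_gt0.
  have e20 : 0 < e2 by rewrite !divr_gt0.
  near=> h; have h0 : 0 < h by [].
  have h1 : h <= 1 by near: h; exact: nbhs_right_le.
  have hl : `|l| * h <= 1.
    have : h <= (1 + `|l|)^-1 by near: h; apply: nbhs_right_le; rewrite invr_gt0 ltr_pwDl.
    rewrite -(ler_pM2l (x := 1 + `|l|)) ?ltr_pwDl // mulfV ?gt_eqF ?ltr_pwDl //.
    by apply: le_trans; rewrite ler_wpM2r ?(ltW h0) // lerDr.
  have he2 : h <= e2 by near: h; exact: nbhs_right_le.
  have hg : mxn (P h X - X - h%:C *: L X) <= e1 * h by near: h; exact: generator_near.
  pose a := expR (- (l * h)).
  have -> : D h = a%:C *: (P h X - X - h%:C *: L X) + (a * (1 + l * h) - 1)%:C *: X.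
    have -> : (a * (1 + l * h) - 1)%:C *: X = a%:C *: X + a%:C *: (h%:C *: L X) - X.
      have -> : a * (1 + l * h) = a + a * (h * l) by ring.
      by rewrite rmorphB rmorph1 rmorphD scalerBl scale1r scalerDl !rmorphM LX !scalerA mulrA.
    have cancel (V : zmodType) (p x w z : V) : p - z = p - x - w + (x + w - z).
      by rewrite -[p - x - w]addrA -opprD addrA subrK.
    by rewrite /D -/a !scalerBr; exact: cancel.
  have a0 : 0 < a := expR_gt0 _.
  have al : a <= expR `|l|.
    rewrite ler_expR -mulrN; apply: le_trans (ler_norm _) _; rewrite normrM normrN.
    by rewrite ler_piMr // ger0_norm // ltW.
  have lh : 0 <= 1 + l * h.
    have := ler_norm (- (l * h)); rewrite normrN normrM [`|h|]ger0_norm ?(ltW h0) //.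
    lra.
  have up : a * (1 + l * h) <= 1.
    rewrite -(ler_pM2l (expR_gt0 (l * h))) mulrA -expRD subrr expR0 mul1r mulr1.
    exact: expR_ge1Dx.
  have lo : 1 - (l * h) ^+ 2 <= a * (1 + l * h).
    have -> : 1 - (l * h) ^+ 2 = (1 - l * h) * (1 + l * h) by ring.
    by rewrite ler_wpM2r // expR_ge1Dx.
  apply: le_trans (mxnD _ _) _; rewrite !mxnZ (ger0_norm (ltW a0)).
  rewrite (splitr e) mulrDl; apply: lerD.
    apply: le_trans (ler_wpM2l (ltW a0) hg) _.
    apply: le_trans (ler_wpM2r _ al) _; first by rewrite mulr_ge0 // ltW.
    by rewrite /e1 mulrA mulrCA mulfV ?gt_eqF ?expR_gt0 // mulr1.
  have ab : `|a * (1 + l * h) - 1| <= (l * h) ^+ 2 by rewrite ler0_norm ?subr_le0 //; lra.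
  apply: le_trans (ler_wpM2r (mxn_ge0 _) ab) _.
  have -> : (l * h) ^+ 2 * mxn X = (l ^+ 2 * mxn X * h) * h by ring.
  rewrite ler_wpM2r ?(ltW h0) //.
  apply: le_trans (ler_wpM2l _ he2) _; first by rewrite mulr_ge0 ?sqr_ge0 ?mxn_ge0.
  have e20' : 0 <= e / 2 by rewrite divr_ge0 // ltW.
  rewrite /e2 mulrA ler_pdivrMr // mulrC.
  by rewrite ler_wpM2l // lerDr.
suff le_e : forall e, 0 < e -> mxn (D t) <= e.
  rewrite leNgt; apply/negP => Dt0.
  by have := le_e _ (divr_gt0 Dt0 (ltr0n R 2)); rewrite leNgt ltr_pdivrMr ?ltr_pMr ?ltr1n.
move=> e e0.
have e'0 : 0 < e / (1 + t * M).
  by rewrite divr_gt0 // ltr_pwDl // mulr_ge0 // ltW.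
have /(_ _ e'0) := small.
rewrite /at_right /within /= => -[/= d d0 hd].
(* Chosen larger than [t / d], so that the step [t / N%:R] lies where [small] applies. *)
pose N := (Num.truncn (t / d)).+1; have N0 : 0 < N%:R :> R by rewrite ltr0n.
have /andP[_ tN] := truncn_itv (ltW (divr_gt0 t0 d0)).
have h0 : 0 < t / N%:R by rewrite divr_gt0.
have hE : N%:R * (t / N%:R) = t by rewrite mulrC divfK // gt_eqF.
have hs : mxn (D (t / N%:R)) <= e / (1 + t * M) * (t / N%:R).
  apply: hd => //=; rewrite sub0r normrN ger0_norm ?(ltW h0) //.
  by rewrite ltr_pdivrMr // mulrC -ltr_pdivrMr.
have := tele _ N (ltW h0); rewrite hE => /(_ (lexx _)) /le_trans; apply.
apply: le_trans (ler_wpM2l (ltW N0) (ler_wpM2l M0 hs)) _.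
have -> : N%:R * (M * (e / (1 + t * M) * (t / N%:R))) =
   (N%:R * (t / N%:R)) * M / (1 + t * M) * e by ring.
by rewrite hE ler_piMl ?(ltW e0) // ler_pdivrMr ?mul1r ?lerDr // ltr_pwDl // mulr_ge0 // ltW.
Unshelve. all: by end_near. Qed.

Lemma generator_eigen_le0 X l : L X = l%:C *: X -> X != 0 -> l <= 0.
Proof.
move=> LX X0; rewrite leNgt; apply/negP => l0.
have x0 : 0 < mxn X.
  by rewrite lt0r mxn_ge0 andbT; apply: contra X0 => /eqP/mxn_eq0 ->.
(* At this time the growth factor is e^n >= 1 + n, which exceeds the uniform bound [n]. *)
have t0 : 0 <= n%:R / l :> R by rewrite divr_ge0 // ltW.
have := qms_bound X t0; rewrite (generator_eigen LX t0) mxnZ ger0_norm ?expR_ge0 //.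
rewrite ler_pM2r // mulrC divfK ?gt_eqF // leNgt => /negP; apply.
by apply: lt_le_trans (expR_ge1Dx _); rewrite ltrDr.
Qed.

End Semigroup.

(** * Eigenbases that are orthonormal for the GNS product *)

Section GnsSpectral.
Variables (R : realType) (n : nat).
Local Notation C := R[i].
Variables (U : 'M[C]_n) (d : 'I_n -> R).
Hypotheses (uU : U \is unitarymx) (d0 : forall i, 0 < d i).
Local Notation tau := (udiag U d).
Local Notation T := (udiag U (fun i => Num.sqrt (d i))).
Local Notation Ti := (udiag U (fun i => (Num.sqrt (d i))^-1)).

Lemma sqrt_udiagK : T *m Ti = 1%:M.
Proof. by apply: udiag_unit => // i; rewrite sqrtr_eq0 -ltNge. Qed.

Lemma udiag_sqrtK : Ti *m T = 1%:M.
Proof. exact: mulmx1C sqrt_udiagK. Qed.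

Lemma sqrt_udiagM : T *m T = tau.
Proof.
rewrite (udiagM _ _ uU); apply: eq_udiag => i.
by rewrite -expr2 sqr_sqrtr // ltW.
Qed.

Lemma herm_form m (M : 'M[C]_m) :
  (forall v w : 'rV[C]_m, (v *m M *m w^t*) 0 0 = ((w *m M *m v^t*) 0 0)^*) ->
  M^t* = M.
Proof.
have qE i j : (delta_mx (0 : 'I_1) i *m M *m (delta_mx (0 : 'I_1) j)^t*) 0 0 = M i j.
  rewrite -rowE mxE (bigD1 j) //= big1 => [|k kj].
    by rewrite addr0 !mxE !eqxx rmorph1 mulr1.
  by rewrite !mxE (negbTE kj) andbF rmorph0 mulr0.
move=> h; apply/matrixP => i j; rewrite trmxCE -[RHS]qE h; congr (_^*).
by rewrite qE.
Qed.

Lemma mxvec_dot (Z W : 'M[C]_n) : (mxvec W *m (mxvec Z)^t*) 0 0 = \tr (Z^t* *m W).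
Proof.
rewrite mxE (reindex _ (curry_mxvec_bij n n)) /= /mxtrace.
rewrite (eq_bigr (fun x => W x.1 x.2 * (Z x.1 x.2)^*)); last first.
  by case=> i j _; rewrite /= mxvecE !mxE mxvecE.
rewrite -(pair_bigA _ (fun i j => W i j * (Z i j)^*)) exchange_big /=.
by apply: eq_bigr => j _; rewrite mxE; apply: eq_bigr => i _; rewrite !mxE mulrC.
Qed.

Let sandwich_l (Z F : 'M[C]_n) :
  \tr (tau *m (Z *m Ti)^t* *m F) = \tr (Z^t* *m (F *m T)).
Proof.
rewrite trmxC_mul udiag_herm -sqrt_udiagM.
move: sqrt_udiagK; move: T Ti => t ti tK; move: (Z^t*) => z.
by rewrite !mulmxA -(mulmxA t t ti) tK mulmx1 -(mulmxA t z F) mxtrace_mulC.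
Qed.

Let sandwich_r (F W : 'M[C]_n) :
  \tr (tau *m F^t* *m (W *m Ti)) = \tr ((F *m T)^t* *m W).
Proof.
rewrite trmxC_mul udiag_herm -sqrt_udiagM.
move: udiag_sqrtK; move: T Ti => t ti tK; move: (F^t*) => f.
rewrite -(mulmxA t t f) -(mulmxA t (t *m f)) mxtrace_mulC -!mulmxA tK mulmx1.
by rewrite !mulmxA.
Qed.

(** Right multiplication by tau^(1/2) carries the GNS product to the Hilbert-Schmidt one. Conjugated
    in this way [Phi] becomes [psi], whose matrix of size n^2 is Hermitian and hence
    diagonalizable. *)
Lemma gns_eigenbasis (Phi : {linear 'M[C]_n -> 'M[C]_n}) :
  gns_symmetric tau Phi ->
  exists (B : 'I_(n * n) -> 'M[C]_n) (m : 'I_(n * n) -> R),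
  [/\ forall a, Phi (B a) = (m a)%:C *: B a,
      forall a b, \tr (tau *m (B a)^t* *m B b) = (a == b)%:R
    & forall X, exists c : 'I_(n * n) -> C, X = \sum_a c a *: B a].
Proof.
move=> gP; have [psi psiE] : exists psi : {linear 'M[C]_n -> 'M[C]_n},
    forall Z, psi Z = Phi (Z *m Ti) *m T.
  by exists (mulmxr T \o Phi \o mulmxr Ti).
have psi_sym Z W : \tr (Z^t* *m psi W) = \tr ((psi Z)^t* *m W).
  rewrite !psiE -(sandwich_l Z) -(sandwich_r _ W); exact: gP.
pose M := lin_mx psi.
have Mh : M^t* = M.
  apply: herm_form => v w; rewrite -(vec_mxK v) -(vec_mxK w) !mul_vec_lin !mxvec_dot.
  rewrite (psi_sym (vec_mx w) (vec_mx v)) -mxtraceC.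
  by rewrite trmxC_mul trmxCK.
have [W [m [uW ME]]] := herm_udiag Mh.
have WM a : row a W *m M = (m a)%:C *: row a W.
  have : W *m M = diag_mx (\row_i (m i)%:C) *m W.
    by rewrite ME udiagE !mulmxA (unitaryK uW) mul1mx.
  by move=> /(congr1 (row a)); rewrite !row_mul row_diag_mx -scalemxAl -rowE mxE.
exists (fun a => vec_mx (row a W) *m Ti), m; split.
- move=> a; have := mul_vec_lin psi (vec_mx (row a W)).
  rewrite vec_mxK WM => /(congr1 (@vec_mx _ n n)); rewrite linearZ /= mxvecK psiE => h.
  by rewrite scalemxAl h -mulmxA sqrt_udiagK mulmx1.
- move=> a b; rewrite -sqrt_udiagM trmxC_mul udiag_herm -!mulmxA (mulmxA T Ti).
  rewrite sqrt_udiagK mul1mx mxtrace_mulC -!mulmxA udiag_sqrtK mulmx1.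
  rewrite -mxvec_dot !vec_mxK -[RHS]/(((a == b)%:R : C)) eq_sym.
  have := unitaryK uW => /matrixP /(_ b a); rewrite !mxE => <-.
  by apply: eq_bigr => k _; rewrite !mxE.
- move=> X; exists (fun a => (mxvec (X *m T) *m W^t*) 0 a).
  have : mxvec (X *m T) = mxvec (X *m T) *m W^t* *m W by rewrite (mulmxKtV _ uW).
  rewrite mulmx_sum_row => /(congr1 (fun v => vec_mx v *m Ti)).
  rewrite mxvecK -mulmxA sqrt_udiagK mulmx1 => e; rewrite [LHS]e.
  move: (mxvec _ *m _) => v; rewrite linear_sum mulmx_suml; apply: eq_bigr => a _.
  by rewrite linearZ -scalemxAl.
Qed.

Section Eigenbasis.
Variables (I : finType) (B : I -> 'M[C]_n).
Hypothesis B_orth : forall a b, \tr (tau *m (B a)^t* *m B b) = (a == b)%:R.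
Hypothesis B_gen : forall X, exists c : I -> C, X = \sum_a c a *: B a.

Lemma gns_dot_basis (c e : I -> C) :
  \tr (tau *m (\sum_a c a *: B a)^t* *m (\sum_a e a *: B a)) =
  \sum_a (c a)^* * e a.
Proof.
rewrite trmxC_sum [X in X *m _]mulmx_sumr mulmx_suml linear_sum; apply: eq_bigr => a _ /=.
rewrite mulmx_sumr linear_sum (bigD1 a) //= big1 => [|b ba].
  by rewrite addr0 trmxCZ -!scalemxAr -scalemxAl !mxtraceZ B_orth eqxx mulr1 mulrC.
by rewrite trmxCZ -!scalemxAr -scalemxAl !mxtraceZ B_orth eq_sym (negbTE ba) !mulr0.
Qed.

Lemma gns_symmetric_basis (Phi : {linear 'M[C]_n -> 'M[C]_n}) (m : I -> R) :
  (forall a, Phi (B a) = (m a)%:C *: B a) -> gns_symmetric tau Phi.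
Proof.
move=> PB X Y; have [c ->] := B_gen X; have [e ->] := B_gen Y.
have PE (g : I -> C) : Phi (\sum_a g a *: B a) = \sum_a (g a * (m a)%:C) *: B a.
  by rewrite linear_sum; apply: eq_bigr => a _; rewrite linearZ /= PB scalerA.
rewrite !PE !gns_dot_basis; apply: eq_bigr => a _.
have -> : (c a * (m a)%:C)^* = (c a)^* * (m a)%:C.
  by rewrite rmorphM; congr (_ * _); exact: conjc_realC.
by rewrite mulrA mulrAC.
Qed.

Lemma basis_neq0 a : B a != 0.
Proof.
apply/eqP => b0; have := B_orth a a; rewrite b0 mulmx0 mxtrace0 eqxx.
by move=> /eqP; rewrite eq_sym oner_eq0.
Qed.

End Eigenbasis.

End GnsSpectral.

(** * Limits in the real and complex numbers *)

Section Convergence.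
Variable R : realType.
Local Notation C := R[i].

Lemma cvg_realC (T : Type) (F : set_system T) (FF : Filter F) (f : T -> R) (l : R) :
  f x @[x --> F] --> l -> (f x)%:C @[x --> F] --> (l%:C : C).
Proof.
move=> fl; apply/(@cvgrPdist_lt _ C) => e e0.
have eE : e = (Re e)%:C by rewrite Re_real // ltW.
have e0' : 0 < Re e by rewrite -ltcR -eE.
have /cvgrPdist_lt /(_ _ e0') h := fl.
near=> x; have hx : `|l - f x| < Re e by near: x.
rewrite -rmorphB eE normc_def /= expr0n addr0 sqrtr_sqr ltcR.
exact: hx.
Unshelve. all: by end_near. Qed.

Lemma cvg_expR_decay (m : R) : m < 0 -> expR (m * t) @[t --> +oo] --> (0 : R).
Proof.
move=> m0; apply/cvgrPdist_lt => e e0; near=> t.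
rewrite sub0r normrN ger0_norm ?expR_ge0 // -(lnK e0) ltr_expR.
by rewrite mulrC -ltr_ndivrMr //; near: t; apply: nbhs_pinfty_gt; rewrite num_real.
Unshelve. all: by end_near. Qed.

Lemma cvg_ge0C (T : Type) (F : set_system T) (FF : ProperFilter F) (f : T -> C) (l : C) :
  f x @[x --> F] --> l -> (\forall x \near F, 0 <= f x) -> 0 <= l.
Proof.
move=> fl f0.
have close e : 0 < e -> exists z : C, 0 <= z /\ `|l - z| < e%:C.
  move=> e0; have e0' : (0 : C) < e%:C by rewrite ltcR.
  have /(@cvgrPdist_lt _ C) /(_ _ e0') h := fl.
  by have [x [hx fx]] := filter_ex (filterI h f0); exists (f x).
have Im_le (z : C) : (`|Im z|)%:C <= `|z|.
  by rewrite normc_def lecR -sqrtr_sqr ler_wsqrtr // lerDr sqr_ge0.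
have Re_le (z : C) : (`|Re z|)%:C <= `|z|.
  by rewrite normc_def lecR -sqrtr_sqr ler_wsqrtr // lerDl sqr_ge0.
rewrite lecE /=; apply/andP; split.
  apply/negPn/negP => i0; have e0 : 0 < `|Im l| by rewrite normr_gt0.
  have [z [z0 /(le_lt_trans (Im_le _))]] := close _ e0.
  rewrite ltcR; move: z0; rewrite lecE /= => /andP[/eqP zi _].
  by case: l z zi {fl close i0 e0} => [a b] [c e] /= ->; rewrite subr0 ltxx.
rewrite leNgt; apply/negP => l0; have e0 : 0 < - Re l by rewrite oppr_gt0.
have [z [z0 /(le_lt_trans (Re_le _))]] := close _ e0.
rewrite ltcR; move: z0; rewrite lecE /= => /andP[_ zr].
rewrite cReB ltr_norml => /andP[+ _]; rewrite opprK; lra.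
Qed.

End Convergence.

(** * The limit of the semigroup as a conditional expectation *)

Section ConditionalExpectation.
Variables (R : realType) (n : nat).
Local Notation C := R[i].
Variables (P : R -> {linear 'M[C]_n -> 'M[C]_n}) (L : {linear 'M[C]_n -> 'M[C]_n}).
Hypotheses (P_qms : qms P) (L_gen : generator_of P L).
Variables (U : 'M[C]_n) (d : 'I_n -> R).
Hypotheses (uU : U \is unitarymx) (d0 : forall i, 0 < d i).
Local Notation sigma := (udiag U d).
Hypothesis L_gns : gns_symmetric sigma L.
Implicit Types (X Y Z : 'M[C]_n).

Lemma qms_trmxC t X : 0 <= t -> P t (X^t*) = (P t X)^t*.
Proof.
by move=> t0; have [m [K KP]] := cp_kraus (qms_cp P_qms t0); exact: (kraus_trmxC KP).
Qed.

Lemma eigen_cvg X l : L X = l%:C *: X ->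
  P t X @[t --> +oo] --> (if l == 0 then X else 0 : 'M[C]_n).
Proof.
move=> LX; have [->|X0] := eqVneq X 0.
  rewrite if_same; have -> : (fun t => P t 0) = (fun=> 0 : 'M[C]_n).
    by apply/funext => t; rewrite linear0.
  exact: cvg_cst.
have l0 := generator_eigen_le0 P_qms L_gen LX X0.
have PX : \forall t \near +oo, (expR (l * t))%:C *: X = P t X.
  near=> t; have t0 : 0 <= t by near: t; apply: nbhs_pinfty_ge; rewrite num_real.
  by rewrite (generator_eigen P_qms L_gen LX t0).
apply: cvg_trans (near_eq_cvg PX) _.
have [l00|ln0] := eqVneq l 0.
  have -> : (fun t => (expR (l * t))%:C *: X) = (fun=> X).
    by apply/funext => t; rewrite l00 mul0r expR0 scale1r.
  exact: cvg_cst.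
rewrite -(scale0r X); apply: (@cvgZl _ 'M[C]_n).
have -> : (0 : C) = (0 : R)%:C by rewrite rmorph0.
by apply: cvg_realC; apply: cvg_expR_decay; rewrite lt_neqAle ln0.
Unshelve. all: by end_near. Qed.

Lemma qms_is_cvg X : cvg (P t X @[t --> +oo]).
Proof.
have [B [m [LB _ Bgen]]] := gns_eigenbasis uU d0 L_gns; have [c ->] := Bgen X.
have -> : (fun t => P t (\sum_a c a *: B a)) = (fun t => \sum_a c a *: P t (B a)).
  by apply/funext => t; rewrite linear_sum; apply: eq_bigr => a _; rewrite linearZ.
apply/cvg_ex; exists (\sum_a c a *: (if m a == 0 then B a else 0)).
apply: cvg_big => [|a _]; first exact: add_continuous.
by apply: (@cvgZr _ 'M[C]_n); exact: eigen_cvg.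
Qed.

Lemma cond_exp_cvg X : P t X @[t --> +oo] --> cond_exp P X.
Proof. exact: qms_is_cvg. Qed.

Lemma cvg_cond_exp X Y : P t X @[t --> +oo] --> Y -> cond_exp P X = Y.
Proof. by move=> h; apply/cvg_lim => //; exact: norm_hausdorff. Qed.

Lemma cond_exp_linear : linear (cond_exp P).
Proof.
move=> c X Y; apply: cvg_cond_exp.
have -> : (fun t => P t (c *: X + Y)) = (fun t => c *: P t X + P t Y).
  by apply/funext => t; rewrite linearP.
apply: (@cvgD _ 'M[C]_n); last exact: cond_exp_cvg.
by apply: (@cvgZr _ 'M[C]_n); exact: cond_exp_cvg.
Qed.

(** Linearity of the limit rests on convergence of every orbit, so the hypotheses on the semigroup
    become arguments. *)
Definition condE : {linear 'M[C]_n -> 'M[C]_n} :=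
  HB.pack (cond_exp P)
    (GRing.isLinear.Build C 'M[C]_n 'M[C]_n *:%R (cond_exp P) cond_exp_linear).

Lemma condE_eigen X l : L X = l%:C *: X -> condE X = if l == 0 then X else 0.
Proof. by move=> /eigen_cvg/cvg_cond_exp. Qed.

Lemma condE_cp : completely_positive condE.
Proof.
move=> k A pA u.
have entry i j x y : (P t (submxblock A i j)) x y @[t --> +oo] -->
    (condE (submxblock A i j)) x y.
  have := @cond_exp_cvg (submxblock A i j).
  apply: (@continuous_cvg _ _ _ _ _ _ (fun M : 'M[C]_n => M x y)).
  exact: coord_continuous.
pose q t := (u *m (\mxblock_(i < k, j < k) P t (submxblock A i j)) *m u^t*) 0 0.
apply: (@cvg_ge0C _ _ (+oo : set_system R) _ q); last first.
  near=> t; have t0 : 0 <= t by near: t; apply: nbhs_pinfty_ge; rewrite num_real.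
  exact: (qms_cp P_qms t0 pA).
rewrite /q mxE.
have -> : (fun t => (u *m (\mxblock_(i < k, j < k) P t (submxblock A i j)) *m u^t*) 0 0)
  = (fun t => \sum_y (\sum_x u 0 x *
      (\mxblock_(i < k, j < k) P t (submxblock A i j)) x y) * (u^t*) y 0).
  by apply/funext => t; rewrite mxE; apply: eq_bigr => y _; rewrite mxE.
apply: cvg_big => [|y _]; first exact: add_continuous.
apply: cvgMl; rewrite mxE; apply: cvg_big => [|x _]; first exact: add_continuous.
apply: cvgMr; rewrite mxE.
have -> : (fun t => (\mxblock_(i < k, j < k) P t (submxblock A i j)) x y) =
    (fun t => P t (submxblock A (tagnat.sig1 x) (tagnat.sig1 y)) (tagnat.sig2 x)
      (tagnat.sig2 y)).
  by apply/funext => t; rewrite mxE.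
exact: entry.
Unshelve. all: by end_near. Qed.

Lemma generator1 : L 1%:M = 0.
Proof.
apply: mxn_eq0; apply/eqP; rewrite eq_le mxn_ge0 andbT leNgt; apply/negP => l0.
have [h [h0 hh]] := filter_ex (filterI (nbhs_right_gt (0 : R))
  (generator_near L_gen 1%:M (divr_gt0 l0 (ltr0n R 2)))).
move: hh; rewrite (qms_unital P_qms) ?(ltW h0) // subrr sub0r mxnN mxnZ.
rewrite ger0_norm ?(ltW h0) // mulrC ler_pM2r // leNgt ltr_pdivrMr //.
by rewrite ltr_pMr // ltr1n.
Qed.

Lemma condE1 : condE 1%:M = 1%:M.
Proof. by rewrite (@condE_eigen _ 0) ?eqxx // generator1 rmorph0 scale0r. Qed.

Lemma condE_fixed X : L X = 0 -> condE X = X.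
Proof. by move=> LX; rewrite (@condE_eigen _ 0) ?eqxx // LX rmorph0 scale0r. Qed.

Lemma qms_fixed X t : L X = 0 -> 0 <= t -> P t X = X.
Proof.
move=> LX t0; rewrite (@generator_eigen _ _ _ _ P_qms L_gen X 0) //.
  by rewrite mul0r expR0 scale1r.
by rewrite LX rmorph0 scale0r.
Qed.

Lemma generator_condE X : L (condE X) = 0.
Proof.
have [B [m [LB _ Bgen]]] := gns_eigenbasis uU d0 L_gns; have [c ->] := Bgen X.
have EB a : condE (c a *: B a) = c a *: (if m a == 0 then B a else 0).
  by rewrite linearZ /= -(condE_eigen (LB a)).
rewrite !linear_sum big1 // => a _; rewrite EB linearZ /=.
case: eqP => [m0|_]; last by rewrite linear0 scaler0.
by rewrite LB m0 rmorph0 scale0r scaler0.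
Qed.

Lemma qms_gns t : 0 <= t -> gns_symmetric sigma (P t).
Proof.
move=> t0; have [B [m [LB Borth Bgen]]] := gns_eigenbasis uU d0 L_gns.
apply: (gns_symmetric_basis Borth Bgen) => a.
exact: (generator_eigen P_qms L_gen (LB a)).
Qed.

Lemma condE_gns : gns_symmetric sigma condE.
Proof.
have [B [m [LB Borth Bgen]]] := gns_eigenbasis uU d0 L_gns.
apply: (gns_symmetric_basis Borth Bgen (m := fun a => (m a == 0)%:R)) => a.
rewrite (condE_eigen (LB a)).
by case: eqP => _; rewrite ?rmorph1 ?rmorph0 ?scale1r ?scale0r.
Qed.

Lemma condE_trmxC X : condE (X^t*) = (condE X)^t*.
Proof. by have [m [K KP]] := cp_kraus condE_cp; exact: (kraus_trmxC KP). Qed.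

Lemma condE_psd X : psdmx X -> psdmx (condE X).
Proof. by have [m [K KP]] := cp_kraus condE_cp; exact: (kraus_psd KP). Qed.

(** The converse of [qms_gns], for a possibly different weight. The limit lemma yields an inequality
    between real parts, and exchanging X and Y makes it an equality. *)
Lemma generator_gns (V : 'M[C]_n) (e : 'I_n -> R) :
  (forall t, 0 <= t -> gns_symmetric (udiag V e) (P t)) ->
  gns_symmetric (udiag V e) L.
Proof.
move=> Pg; set tau := udiag V e.
have th : tau^t* = tau by exact: udiag_herm.
have trE X Y : Re (\tr (tau *m X^t* *m Y)) = Re (\tr (tau *m Y^t* *m X)).
  rewrite -cRe_conj -mxtraceC !trmxC_mul trmxCK th.
  by rewrite mulmxA mxtrace_mulC mulmxA.
have half X Y : 0 <= Re (\tr (tau *m X^t* *m L Y) - \tr (tau *m Y^t* *m L X)).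
  have trN (M N : 'M[C]_n) : - \tr (M *m N) = \tr ((- M) *m N).
    by rewrite mulNmx; exact/esym/raddfN.
  rewrite trN.
  apply: (generator_limit_ge0 L_gen) => h h0.
  have := congr1 (@complex.Re R) (Pg h (ltW h0) X Y); rewrite [RHS]trE => e1.
  have trB (M N N' : 'M[C]_n) : Re (\tr (M *m (N - N'))) =
      Re (\tr (M *m N)) - Re (\tr (M *m N')).
    by rewrite mulmxBr -cReB; congr Re; exact: raddfB.
  rewrite -(trN (tau *m Y^t*)) cReB !trB.
  rewrite e1 [Re (\tr (tau *m X^t* *m Y))]trE.
  by rewrite subrr.
have Re_eq X Y : Re (\tr (tau *m X^t* *m L Y)) = Re (\tr (tau *m (L X)^t* *m Y)).
  rewrite (trE (L X) Y); have := half X Y; rewrite cReB subr_ge0 => ab.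
  have := half Y X; rewrite cReB subr_ge0 => ba.
  by apply/eqP; rewrite eq_le ab ba.
(* Replacing X by 'i X turns the equality of real parts into that of imaginary parts. *)
move=> X Y; have iE (z : C) : Re ('i * z) = - Im z by case: z => a b /=; ring.
have LiX : L ('i *: X) = 'i *: L X by exact: linearZ.
have := Re_eq ('i *: X) Y; rewrite LiX !trmxCZ -!scalemxAr -!scalemxAl.
rewrite !mxtraceZ conjCi !mulNr !cReN !iE !opprK => im.
by apply/eqP; rewrite eq_complex im Re_eq !eqxx.
Qed.

End ConditionalExpectation.

(** * The invariant state obtained from rho *)

Section ConditionedState.
Variables (R : realType) (n : nat).
Local Notation C := R[i].
Variables (P : R -> {linear 'M[C]_n -> 'M[C]_n}) (L : {linear 'M[C]_n -> 'M[C]_n}).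
Hypotheses (P_qms : qms P) (L_gen : generator_of P L).
Variables (U : 'M[C]_n) (d : 'I_n -> R).
Hypotheses (uU : U \is unitarymx) (d0 : forall i, 0 < d i).
Local Notation sigma := (udiag U d).
Hypothesis L_gns : gns_symmetric sigma L.
Implicit Types (X Y Z : 'M[C]_n).

Local Notation E := (condE P_qms L_gen uU d0 L_gns).

Let sigma_psd : psdmx sigma. Proof. by apply: udiag_psd => i; exact: ltW. Qed.
Let sigma_unit : sigma \in unitmx. Proof. exact: udiag_posunit. Qed.

Lemma cond_exp_adjE X rho : hsdot X (cond_exp_adj P rho) = hsdot (E X) rho.
Proof. exact: (adjsupE E X rho). Qed.

(* A fixed point commutes with the Kraus operators of P t. *)
Lemma fixed_mulr t z X : 0 <= t -> P t z = z -> P t (X *m z) = P t X *m z.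
Proof.
move=> t0 Pz; have [m [K KP]] := cp_kraus (qms_cp P_qms t0).
have P1 := qms_unital P_qms t0.
have inv Y : \tr (sigma *m P t Y) = \tr (sigma *m Y).
  have := gns_tr (qms_gns P_qms L_gen uU d0 L_gns t0)
    (fun W => qms_trmxC P_qms W t0) 1%:M Y.
  by rewrite P1 mulmx1.
pose G a := z *m K a - K a *m z.
(* By [kraus_defect] the squared GNS norms of the commutators add up to Tr(sigma (P_t(z^* z) - z^*
   z)), which is 0 as sigma is invariant. *)
have G0 : \sum_a \tr (sigma *m (G a)^t* *m G a) = 0.
  under eq_bigr => a _ do rewrite -mulmxA.
  rewrite -linear_sum -mulmx_sumr (kraus_defect KP P1) Pz subrK mulmxBr linearB /=.
  by rewrite inv subrr.
have Ka a : z *m K a = K a *m z.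
  apply/eqP; rewrite -subr_eq0; apply/eqP.
  apply: (posdef_tr_gram_eq0 sigma_psd sigma_unit).
  have h b : 0 <= \tr (sigma *m (G b)^t* *m G b).
    by rewrite -mulmxA; apply: psd_tr_mul_ge0 => //; exact: psd_gram.
  apply/eqP; rewrite eq_le h andbT -[leRHS]G0 (bigD1 a) //= lerDl.
  by apply: sumr_ge0 => b _; exact: h.
rewrite !KP mulmx_suml; apply: eq_bigr => a _.
by rewrite -!mulmxA Ka.
Qed.

Section State.
Variable rho : 'M[C]_n.
Hypotheses (rho_psd : psdmx rho) (rho_tr : \tr rho = 1).
Local Notation tau := (cond_exp_adj P rho).

Lemma quad_hsdot (u : 'rV[C]_n) Y : (u *m Y *m u^t*) 0 0 = hsdot (u^t* *m u) Y.
Proof.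
by rewrite mx11_trace /hsdot trmxC_mul trmxCK mxtrace_mulC mulmxA.
Qed.

Lemma quad_cond_exp_adj (u : 'rV[C]_n) :
  (u *m tau *m u^t*) 0 0 = \tr (E (u^t* *m u) *m rho).
Proof.
rewrite quad_hsdot cond_exp_adjE /hsdot -condE_trmxC; congr (\tr (condE _ _ _ _ _ _ *m _)).
by rewrite trmxC_mul trmxCK.
Qed.

Lemma cond_exp_adj_psd : psdmx tau.
Proof.
move=> u; rewrite quad_cond_exp_adj; apply: psd_tr_mul_ge0 => //.
by apply: condE_psd; exact: psd_gram.
Qed.

Lemma cond_exp_adj_tr : \tr tau = 1.
Proof.
have := cond_exp_adjE 1%:M rho.
by rewrite /hsdot condE1 trmxC1 !mul1mx rho_tr.
Qed.

Hypothesis rho_unit : rho \in unitmx.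

(** A null eigenvector [v] of tau gives Tr(rho E(v^* v)) = 0. Full rank of rho forces E(v^* v) = 0,
    and then invariance of sigma under E forces v = 0. *)
Lemma cond_exp_adj_udiag : exists (V : 'M[C]_n) (e : 'I_n -> R),
  [/\ V \is unitarymx, forall i, 0 < e i & tau = udiag V e].
Proof.
have [V [e [uV e0 tE]]] := psd_udiag cond_exp_adj_psd.
exists V, e; split => // i; rewrite lt0r e0 andbT; apply/eqP => ei.
pose v := row i V; have vv : v *m v^t* = 1%:M.
  apply/matrixP => a b; rewrite !ord1 mxE.
  have /matrixP /(_ i i) := unitaryK uV; rewrite !mxE eqxx => <-.
  by apply: eq_bigr => k _; rewrite !mxE.
have pv := condE_psd P_qms L_gen uU d0 L_gns (psd_gram v).
have [S SE] := psd_factor pv.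
have S0 : S = 0.
  apply: (posdef_tr_gram_eq0 rho_psd rho_unit).
  rewrite -mulmxA -SE mxtrace_mulC -quad_cond_exp_adj tE udiag_spec //.
  by rewrite ei rmorph0.
have v0 : v = 0.
  apply: (posdef_tr_gram_eq0 sigma_psd sigma_unit); rewrite -mulmxA.
  have := gns_tr (condE_gns P_qms L_gen uU d0 L_gns)
    (condE_trmxC P_qms L_gen uU d0 L_gns) 1%:M (v^t* *m v).
  by rewrite condE1 mulmx1 SE S0 mulmx0 mulmx0 mxtrace0 => <-.
by move: vv => /matrixP /(_ 0 0); rewrite v0 mul0mx !mxE => /eqP;
  rewrite eq_sym oner_eq0.
Qed.

Lemma cond_exp_adj_factor : exists2 z, L z = 0 & tau = sigma *m z.
Proof.
(* By GNS symmetry the adjoint of E sends sigma x to sigma E(x); this is the case x = sigma^-1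
   rho. *)
exists (E (invmx sigma *m rho)); first exact: generator_condE.
apply/eqP; rewrite -subr_eq0; apply/eqP; apply: tr_mul_eq0 => Z.
have h X : \tr (X^t* *m tau) = \tr (X^t* *m (sigma *m E (invmx sigma *m rho))).
  have := cond_exp_adjE X rho; rewrite /hsdot => ->.
  rewrite [RHS]mxtrace_mulC -(gns_tr (condE_gns P_qms L_gen uU d0 L_gns)
    (condE_trmxC P_qms L_gen uU d0 L_gns)).
  by rewrite mulKVmx // condE_trmxC mxtrace_mulC.
by have := h (Z^t*); rewrite trmxCK mulmxBr linearB /= => ->; rewrite subrr.
Qed.

(** Write tau = sigma z. The factor z is absorbed into the first argument, which becomes X z^*, and
    z^* passes through P_t because it is a fixed point. *)
Lemma qms_gns_cond_exp_adj t : 0 <= t -> gns_symmetric tau (P t).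
Proof.
move=> t0 X Y; have [z Lz ->] := cond_exp_adj_factor.
have Pz : P t (z^t*) = z^t*.
  by rewrite (qms_trmxC P_qms) // (qms_fixed P_qms L_gen Lz t0).
have := qms_gns P_qms L_gen uU d0 L_gns t0 (X *m z^t*) Y.
by rewrite (fixed_mulr _ t0 Pz) !trmxC_mul trmxCK !mulmxA.
Qed.

Lemma generator_gns_cond_exp_adj : gns_symmetric tau L.
Proof.
have [V [e [_ _ tE]]] := cond_exp_adj_udiag; rewrite tE.
apply: (generator_gns L_gen) => t t0; rewrite -tE.
exact: qms_gns_cond_exp_adj.
Qed.

End State.

End ConditionedState.

(** * Finiteness and attainment of the subalgebra index *)

Section Index.
Variables (R : realType) (n : nat).
Local Notation C := R[i].
Variables (P : R -> {linear 'M[C]_n -> 'M[C]_n}) (L : {linear 'M[C]_n -> 'M[C]_n}).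
Hypotheses (P_qms : qms P) (L_gen : generator_of P L).
Variables (U : 'M[C]_n) (d : 'I_n -> R).
Hypotheses (uU : U \is unitarymx) (d0 : forall i, 0 < d i).
Local Notation sigma := (udiag U d).
Hypothesis L_gns : gns_symmetric sigma L.
Hypothesis sigma_tr : \tr sigma = 1.
Implicit Types (X Y Z : 'M[C]_n).

Local Notation E := (condE P_qms L_gen uU d0 L_gns).

Lemma weighted_cauchy_schwarz (I : finType) (r x : I -> R) : (forall a, 0 < r a) ->
  (\sum_a x a) ^+ 2 <= (\sum_a r a) * (\sum_a (r a)^-1 * x a ^+ 2).
Proof.
move=> r0; have [S0|S0] := leP (\sum_a r a) 0.
  have noI (a : I) : False.
    have := r0 a; rewrite ltNge (le_trans _ S0) // (bigD1 a) //= lerDl.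
    by apply: sumr_ge0 => b _; exact: ltW.
  by rewrite !big1 ?expr0n ?mul0r // => a _; case: (noI a).
set S := \sum_a r a in S0 *; set A := \sum_a x a; pose m := A / S.
have : 0 <= \sum_a r a * ((r a)^-1 * x a - m) ^+ 2.
  by apply: sumr_ge0 => a _; rewrite mulr_ge0 ?sqr_ge0 // ltW.
rewrite (eq_bigr (fun a => (r a)^-1 * x a ^+ 2 - 2 * m * x a + m ^+ 2 * r a)); last first.
  by move=> a _; have ra := r0 a; field; rewrite gt_eqF.
rewrite big_split sumrB /= -!mulr_sumr -/S -/A; set B := \sum_a _ => h.
have := mulr_ge0 (ltW S0) h.
have -> : S * (B - 2 * m * A + m ^+ 2 * S) = S * B - A ^+ 2.
  by rewrite /m; field; rewrite gt_eqF.
by rewrite subr_ge0.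
Qed.

Lemma absq_sum (I : finType) (r : I -> R) (x : I -> C) : (forall a, 0 < r a) ->
  absq (\sum_a x a) <= (\sum_a r a) * (\sum_a (r a)^-1 * absq (x a)).
Proof.
move=> r0; have ImS : Im (\sum_a x a) = \sum_a Im (x a).
  by apply: (big_morph (@complex.Im R)) => [[? ?] [? ?]|].
rewrite {1}/absq Re_sum ImS.
apply: le_trans (lerD (weighted_cauchy_schwarz _ r0) (weighted_cauchy_schwarz _ r0)) _.
rewrite -mulrDr -big_split /= le_eqVlt; apply/orP; left; apply/eqP; congr (_ * _).
by apply: eq_bigr => a _; rewrite -mulrDr.
Qed.

Lemma row_mul_absq (x y : 'rV[C]_n) (A : 'M[C]_n) :
  (y *m (A^t* *m (x^t* *m x) *m A) *m y^t*) 0 0 = (absq ((x *m A *m y^t*) 0 0))%:C.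
Proof.
have -> : y *m (A^t* *m (x^t* *m x) *m A) *m y^t* =
    (x *m A *m y^t*)^t* *m (x *m A *m y^t*).
  by rewrite !trmxC_mul trmxCK !mulmxA.
by move: (x *m A *m y^t*) => z; rewrite mxE big_ord1 trmxCE absqE.
Qed.

(* E = E o E has the Kraus operators K_a^* K_b up to positive weights, and the
   identity is a combination of those with a = b. *)
Lemma condE_lower : exists2 c : R, 0 < c &
  forall u : 'rV[C]_n, psdmx (c%:C *: E (u^t* *m u) - u^t* *m u).
Proof.
have E1 := condE1 P_qms L_gen uU d0 L_gns.
have Egns := condE_gns P_qms L_gen uU d0 L_gns.
have [I [K [r [KE r0 rK]]]] := modular_kraus uU d0 (condE_cp P_qms L_gen uU d0 L_gns) Egns.
have dual := modular_kraus_dual uU d0 KE Egns r0 rK.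
have S0 : 0 <= \sum_a r a by apply: sumr_ge0 => a _; exact: ltW.
(* The summand 1 keeps the constant positive even for an empty Kraus family. *)
exists (\sum_a r a + 1); first by rewrite ltr_wpDl.
move=> u v; set c := \sum_a r a in S0 *; pose X := u^t* *m u; rewrite -/X.
(* The Kraus operators resolve the identity, so [u *m v^t*] is the sum of the [x a]. Cauchy-Schwarz
   with weights [r] bounds its square by the diagonal part a = b of the double sum [EE]. *)
pose x a := (u *m ((K a)^t* *m K a) *m v^t*) 0 0.
have EE : (v *m E X *m v^t*) 0 0 =
    (\sum_a \sum_b (r a)^-1 * absq ((u *m ((K a)^t* *m K b) *m v^t*) 0 0))%:C.
  have -> : E X = \sum_a \sum_b ((r a)^-1)%:C *:
      (((K a)^t* *m K b)^t* *m X *m ((K a)^t* *m K b)).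
    rewrite -[LHS](condE_fixed P_qms L_gen uU d0 L_gns (generator_condE P_qms L_gen uU d0 L_gns X)).
    rewrite {1}KE; under eq_bigr => b _ do rewrite dual mulmx_sumr mulmx_suml.
    rewrite exchange_big; apply: eq_bigr => a _; apply: eq_bigr => b _ /=.
    by rewrite -scalemxAr -scalemxAl trmxC_mul trmxCK !mulmxA.
  rewrite mulmx_sumr mulmx_suml summxE rmorph_sum; apply: eq_bigr => a _.
  rewrite mulmx_sumr mulmx_suml summxE rmorph_sum; apply: eq_bigr => b _.
  by rewrite -scalemxAr -scalemxAl mxE row_mul_absq rmorphM.
have XE : (v *m X *m v^t*) 0 0 = (absq (\sum_a x a))%:C.
  have -> : v *m X *m v^t* = v *m (1%:M^t* *m (u^t* *m u) *m 1%:M) *m v^t*.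
    by rewrite trmxC1 mul1mx mulmx1.
  rewrite row_mul_absq; congr (absq _)%:C.
  rewrite -(kraus_unital KE E1) mulmx_sumr mulmx_suml summxE.
  by apply: eq_bigr => a _.
rewrite mulmxBr mulmxBl mxE [X in _ + X]mxE XE -scalemxAr -scalemxAl mxE EE.
rewrite -rmorphM -rmorphB ler0c subr_ge0.
apply: le_trans (absq_sum _ r0) _; rewrite -/c.
have nn a b : 0 <= (r a)^-1 * absq ((u *m ((K a)^t* *m K b) *m v^t*) 0 0).
  by rewrite mulr_ge0 ?absq_ge0 // invr_ge0 ltW.
apply: (@le_trans _ _ (c * \sum_a \sum_b (r a)^-1 * absq ((u *m ((K a)^t* *m K b) *m v^t*) 0 0))).
  rewrite ler_wpM2l //; apply: ler_sum => a _.
  rewrite (bigD1 a) //= lerDl; apply: sumr_ge0 => b _; exact: nn.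
rewrite ler_wpM2r ?lerDl //; apply: sumr_ge0 => a _; apply: sumr_ge0 => b _.
exact: nn.
Qed.

Lemma quad_real (A : 'M[C]_n) (u : 'rV[C]_n) : psdmx A ->
  exists2 x : R, 0 <= x & (u *m A *m u^t*) 0 0 = x%:C.
Proof.
move=> /(_ u) pA; exists (Re ((u *m A *m u^t*) 0 0)); first exact: Re_ge0.
by rewrite Re_real.
Qed.

Local Notation iset := [set c : R | 0 < c /\
    forall rho, density rho -> lemx rho (c%:C *: cond_exp_adj P rho)].

(** The dual form of [condE_lower]. It ensures that the index is a genuine infimum and not the
    default value for the empty set. *)
Lemma index_set_nonempty : iset !=set0.
Proof.
have [c c0 cE] := condE_lower; exists c; split => // rho [rho_psd rho_tr] u.
rewrite mulmxBr mulmxBl mxE [X in _ + X]mxE -scalemxAr -scalemxAl mxE.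
rewrite (quad_cond_exp_adj P_qms L_gen uU d0 L_gns) quad_hsdot /hsdot trmxC_mul trmxCK.
have := psd_tr_mul_ge0 (cE u) rho_psd.
by rewrite mulmxBl mxtraceB -scalemxAl mxtraceZ.
Qed.

(** The infimum is itself admissible: at a fixed vector u the condition reads y <= c x, which is
    closed in c. If x = 0, any admissible constant gives y <= 0. *)
Lemma subalg_index_le rho : density rho ->
  lemx rho ((subalg_index P)%:C *: cond_exp_adj P rho).
Proof.
move=> rhoD u; have [rho_psd rho_tr] := rhoD.
have tau_psd := cond_exp_adj_psd P_qms L_gen uU d0 L_gns rho_psd.
have [x x0 xE] := quad_real u tau_psd; have [y y0 yE] := quad_real u rho_psd.
rewrite mulmxBr mulmxBl mxE [X in _ + X]mxE -scalemxAr -scalemxAl mxE xE yE.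
rewrite -rmorphM -rmorphB ler0c subr_ge0.
have bnd c : iset c -> y <= c * x.
  move=> [_ /(_ rho rhoD) /(_ u)].
  rewrite mulmxBr mulmxBl mxE [X in _ + X]mxE -scalemxAr -scalemxAl mxE xE yE.
  by rewrite -rmorphM -rmorphB ler0c subr_ge0.
have [x00|xn0] := eqVneq x 0.
  by have [c /bnd] := index_set_nonempty; rewrite x00 !mulr0.
rewrite -ler_pdivrMr ?lt0r ?xn0 //; apply: lb_le_inf; first exact: index_set_nonempty.
by move=> c /bnd; rewrite ler_pdivrMr // lt0r xn0.
Qed.

(** Take traces in the inequality for the density sigma. Positivity of the index follows, which its
    power with exponent [p - 2] calls for. *)
Lemma subalg_index_ge1 : 1 <= subalg_index P.
Proof.
apply: lb_le_inf; first exact: index_set_nonempty.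
move=> c [c0 cS].
have sigmaD : density sigma by split => //; apply: udiag_psd => i; exact: ltW.
have := psd_tr_ge0 (cS _ sigmaD); rewrite mxtraceB mxtraceZ sigma_tr.
rewrite (cond_exp_adj_tr P_qms L_gen uU d0 L_gns sigma_tr) mulr1.
by rewrite -[1 in X in X -> _](rmorph1 (real_complex R)) -rmorphB ler0c subr_ge0.
Qed.

End Index.

(** * Homogeneity of divided differences and the weight function *)

Section DivpowFacts.
Variable R : realType.
Implicit Types (s u v c x : R).

Lemma powR_inv c x : 0 < c -> c^-1 `^ x = (c `^ x)^-1.
Proof. by move=> c0; rewrite -powR_inv1 ?(ltW c0) // -powRrM mulN1r powRN. Qed.

Lemma divpow_ge0 s u v : 0 < s -> 0 < u -> 0 < v -> 0 <= divpow s u v.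
Proof.
move=> s0 u0 v0; rewrite /divpow; case: (ltgtP u v) => uv.
- rewrite -mulrNN -invrN !opprB divr_ge0 ?subr_ge0 ?ge0_ler_powR ?nnegrE //;
    by rewrite ?ltW.
- by rewrite divr_ge0 ?subr_ge0 ?ge0_ler_powR ?nnegrE // ?ltW.
- by rewrite mulr_ge0 ?powR_ge0 // ltW.
Qed.

(** The degree [s - 1] becomes, at s = p - 1, the exponent [p - 2] of the index. *)
Lemma divpow_scale s c u v : 0 < c -> 0 < u -> 0 < v ->
  divpow s (c * u) (c * v) = c `^ (s - 1) * divpow s u v.
Proof.
move=> c0 u0 v0; rewrite /divpow (inj_eq (mulfI (lt0r_neq0 c0))).
have cs : c `^ (s - 1) = c `^ s / c.
  by rewrite powRB ?(gt_eqF c0) ?implybT // powRr1 // ltW.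
case: eqVneq => [_|uv]; first by rewrite powRM ?ltW //; ring.
have uv0 : u - v != 0 by rewrite subr_eq0.
rewrite !powRM ?ltW // cs -!mulrBr; field.
by rewrite uv0 gt_eqF.
Qed.

Lemma divpow_sqr s u v : (u - v) * (u `^ s - v `^ s) = (u - v) ^+ 2 * divpow s u v.
Proof.
rewrite /divpow; case: eqVneq => [->|uv]; first by rewrite subrr expr0n !mul0r.
by field; rewrite subr_eq0.
Qed.

Lemma divpow11 s : divpow s 1 1 = s.
Proof. by rewrite /divpow eqxx powR1 mulr1. Qed.

(* The function of the modular operator for which the quadratic form of the
   divided difference becomes a weighted GNS form. *)
Definition beckner_weight p x : R := x `^ p^-1 * divpow (p - 1) (x `^ p^-1) 1.

Lemma beckner_weight_ge0 p x : 1 < p -> 0 < x -> 0 <= beckner_weight p x.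
Proof.
move=> p1 x0; rewrite mulr_ge0 ?powR_ge0 // divpow_ge0 ?powR_gt0 //.
by rewrite subr_gt0.
Qed.

Lemma beckner_weight1 p : beckner_weight p 1 = p - 1.
Proof. by rewrite /beckner_weight !powR1 mul1r divpow11. Qed.

(** Used with [x] and [y] eigenvalues of tau and [q] the modular ratio of a Kraus operator, or 1. It
    matches the kernel at tau^(1/p) with a GNS weight. *)
Lemma beckner_weightE p q x y : 1 < p -> 0 < q -> 0 < x -> 0 < y ->
  y * beckner_weight p (x / (q * y)) =
  q `^ (- p^-1) * (x `^ p^-1 * y `^ p^-1) *
  divpow (p - 1) (q `^ (- p^-1) * x `^ p^-1) (y `^ p^-1).
Proof.
move=> p1 q0 x0 y0; have p0 : p != 0 by rewrite gt_eqF // (lt_trans _ p1).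
rewrite /beckner_weight.
have -> : (x / (q * y)) `^ p^-1 = q `^ (- p^-1) * x `^ p^-1 / y `^ p^-1.
  rewrite powRM ?ltW ?invr_gt0 ?mulr_gt0 // powR_inv ?mulr_gt0 // powRM ?ltW //.
  by rewrite powRN invfM; ring.
set w := q `^ (- p^-1) * x `^ p^-1; set b := y `^ p^-1.
have b0 : 0 < b by rewrite powR_gt0.
have w0 : 0 < w by rewrite mulr_gt0 // powR_gt0.
have := divpow_scale (p - 1) b0 (divr_gt0 w0 b0) (@ltr01 R).
rewrite mulr1 mulrC divfK ?gt_eqF // => ->.
have -> : b `^ (p - 1 - 1) = y / b / b.
  rewrite !powRB ?(gt_eqF b0) ?implybT // powRr1 ?(ltW b0) // -powRrM mulVf //.
  by rewrite powRr1 // ltW.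
have -> : q `^ (- p^-1) * (x `^ p^-1 * b) = w * b by rewrite mulrA.
by field; exact: lt0r_neq0.
Qed.

End DivpowFacts.

(** * Moving a power of tau past a Kraus operator *)

Section TwistedKraus.
Variables (R : realType) (n : nat).
Local Notation C := R[i].
Variables (T K : 'M[C]_n) (q : R).
Hypotheses (q0 : q != 0) (Th : T^t* = T) (TK : T *m K = q%:C *: (K *m T)).

Lemma twist_r : K *m T = (q^-1)%:C *: (T *m K).
Proof. by rewrite TK scalerA -rmorphM (mulVf q0) scale1r. Qed.

Lemma twist_adj_l : T *m K^t* = (q^-1)%:C *: (K^t* *m T).
Proof.
have := congr1 (fun Z => Z^t*) twist_r.
by rewrite trmxCZr (trmxC_mul K T) (trmxC_mul T K) Th.
Qed.

Lemma twist_adj_r : K^t* *m T = q%:C *: (T *m K^t*).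
Proof. by rewrite twist_adj_l scalerA -rmorphM (mulfV q0) scale1r. Qed.

Lemma twist_conj Z :
  T *m (K^t* *m Z *m K) *m T =
  (q^-1 * q^-1)%:C *: (K^t* *m (T *m Z *m T) *m K).
Proof.
rewrite !mulmxA twist_adj_l -!scalemxAl -(mulmxA _ K T) twist_r.
by rewrite -scalemxAr scalerA -rmorphM !mulmxA.
Qed.

Lemma twist_conj_dual Z :
  T *m (K *m Z *m K^t*) *m T = (q * q)%:C *: (K *m (T *m Z *m T) *m K^t*).
Proof.
rewrite !mulmxA TK -!scalemxAl -(mulmxA _ (K^t*) T) twist_adj_r.
by rewrite -scalemxAr scalerA -rmorphM !mulmxA.
Qed.

(** Rescaling one side by q^-2 turns the commutator of [T *m X *m T] with [K] into a sandwich of the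
    plain commutator of [X]. *)
Lemma twist_comm X :
  (q^-1 * q^-1)%:C *: (T *m X *m T *m K) - K *m (T *m X *m T) =
  (q^-1)%:C *: (T *m (X *m K - K *m X) *m T).
Proof.
rewrite mulmxBr mulmxBl scalerBr -(mulmxA (T *m X) T K) TK -scalemxAr scalerA.
rewrite -rmorphM -mulrA (mulVf q0) mulr1 !mulmxA; congr (_ - _).
by rewrite twist_r -!scalemxAl.
Qed.

End TwistedKraus.

(** * Comparison with a GNS form for a single unital map *)

Section KrausEstimate.
Variables (R : realType) (n : nat).
Local Notation C := R[i].
Variables (U : 'M[C]_n) (d : 'I_n -> R).
Hypotheses (uU : U \is unitarymx) (d0 : forall i, 0 < d i).
Local Notation tau := (udiag U d).
Variables (p : R).
Hypothesis p12 : 1 < p <= 2.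
Local Notation s := (p - 1).
Let g i := d i `^ (p^-1 / 2).
Local Notation T := (udiag U (fun i => d i `^ (p^-1 / 2))).
Variables (X : 'M[C]_n) (W : 'M[C]_n) (y : 'I_n -> R).
Hypotheses (uW : W \is unitarymx) (y0 : forall i, 0 < y i).
Hypothesis TXT : T *m X *m T = udiag W y.
Variable (c : R).
Hypothesis c0 : 0 < c.
Hypothesis Y_le : psdmx (udiag U (fun i => c * d i `^ p^-1) - udiag W y).
Variable X' : 'M[C]_n.
Hypothesis X'E : forall i j, (U *m X' *m U^t*) i j =
  (Num.sqrt (beckner_weight p (d i / d j)))%:C * (U *m X *m U^t*) i j.

Let p0 : 0 < p. Proof. by case/andP: p12 => /(lt_trans ltr01). Qed.
Let s01 : 0 < s <= 1.
Proof. by case/andP: p12 => p1 p2; rewrite subr_gt0 p1 lerBlDr. Qed.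
Let g0 i : 0 < g i. Proof. exact: powR_gt0. Qed.
Let gg i : g i * g i = d i `^ p^-1.
Proof.
rewrite -powRD -?splitr //; apply/implyP => _; exact: lt0r_neq0.
Qed.

Section OneKraus.
Variables (K : 'M[C]_n) (r : R).
Hypotheses (r0 : 0 < r) (tK : tau *m K = r%:C *: (K *m tau)).
Let q := r `^ (p^-1 / 2).
Let w := r `^ (- p^-1).

Let q0 : 0 < q. Proof. exact: powR_gt0. Qed.
Let w0 : 0 < w. Proof. exact: powR_gt0. Qed.
Let wE : w = q^-1 * q^-1.
Proof.
rewrite /w powRN -invfM -powRD -?splitr //; apply/implyP => _; exact: lt0r_neq0.
Qed.

Let Th : T^t* = T. Proof. exact: udiag_herm. Qed.
Let qn0 : q != 0. Proof. exact: lt0r_neq0. Qed.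

Let power_kraus : T *m K = q%:C *: (K *m T).
Proof.
by have := modular_powR uU d0 (p^-1 / 2) r0 tK; rewrite (mxpow_udiag _ _ uU).
Qed.

Let G := w%:C *: (udiag W y *m K) - K *m udiag W y.

Let GE : G = (q^-1)%:C *: (T *m (X *m K - K *m X) *m T).
Proof.
rewrite /G -TXT wE; exact: (twist_comm qn0 power_kraus).
Qed.

Let WG i j : absq ((W *m G *m W^t*) i j) =
  (w * y i - y j) ^+ 2 * absq ((W *m K *m W^t*) i j).
Proof.
have -> : W *m G *m W^t* =
    w%:C *: (diag_mx (\row_i (y i)%:C) *m (W *m K *m W^t*)) -
    (W *m K *m W^t*) *m diag_mx (\row_i (y i)%:C).
  have e1 : W *m (udiag W y *m K) *m W^t* =
      diag_mx (\row_i (y i)%:C) *m (W *m K *m W^t*).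
    by rewrite udiagE !mulmxA (unitaryK uW) mul1mx.
  have e2 : W *m (K *m udiag W y) *m W^t* =
      (W *m K *m W^t*) *m diag_mx (\row_i (y i)%:C).
    by rewrite udiagE !mulmxA (mulmxtVK _ uW).
  by rewrite /G mulmxBr mulmxBl e2 -scalemxAr -scalemxAl e1.
move: (W *m K *m W^t*) => k; rewrite mul_diag_mx mul_mx_diag !mxE.
have -> : w%:C * ((y i)%:C * k i j) - k i j * (y j)%:C = (w * y i - y j)%:C * k i j.
  by rewrite rmorphB rmorphM; ring.
by rewrite absqM absqr.
Qed.

(** [K] has nonzero entries only where d a = r * d b. There the multipliers to the left and to the
    right of [K] both have the argument [d i / (r * d j)]. *)
Let comm_entries i j : (U *m (X' *m K - K *m X') *m U^t*) i j =
  (Num.sqrt (beckner_weight p (d i / (r * d j))))%:C *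
  (U *m (X *m K - K *m X) *m U^t*) i j.
Proof.
set k := U *m K *m U^t*.
have mulU A B : U *m (A *m B) *m U^t* = (U *m A *m U^t*) *m (U *m B *m U^t*).
  by rewrite !mulmxA (mulmxKtV _ uU).
have kE a b : k a b = 0 \/ d a = r * d b.
  have := tK; rewrite scalemxAr udiagZ => h.
  have /eqP := intertwine_entries uU uU h a b; rewrite -/k mulrC -subr_eq0 -mulrBr.
  rewrite mulf_eq0 => /orP[/eqP|]; first by left.
  by rewrite -rmorphB (fmorph_eq0 (real_complex R)) subr_eq0 => /eqP; right.
have cE A : (U *m (A *m K - K *m A) *m U^t*) i j =
    \sum_l ((U *m A *m U^t*) i l * k l j - k i l * (U *m A *m U^t*) l j).
  rewrite mulmxBr mulmxBl (mulU A K) (mulU K A) -/k sumrB.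
  have aux (a b : 'M[C]_n) : (a *m b - b *m a) i j =
      \sum_l a i l * b l j - \sum_l b i l * a l j by rewrite !mxE.
  exact: aux.
rewrite !cE mulr_sumr; apply: eq_bigr => l _; rewrite mulrBr !X'E.
move: ((U *m X *m U^t*) i l) ((U *m X *m U^t*) l j) => a b; congr (_ - _).
  by case: (kE l j) => ->; rewrite ?mulr0 // mulrA.
case: (kE i l) => [->|e]; first by rewrite !mul0r mulr0.
have -> : d i / (r * d j) = d l / d j.
  by rewrite e invfM mulrACA mulfV ?gt_eqF // mul1r.
by rewrite mulrCA.
Qed.

(** The origin of [beckner_weight]. In the eigenbasis of tau the sandwich in [G] contributes w (d_i
    d_j)^(1/p), and the weight is what this factor and the divided difference leave after division
    by d_j. *)
Let UG i j : divpow s (w * d i `^ p^-1) (d j `^ p^-1) * absq ((U *m G *m U^t*) i j) =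
  d j * absq ((U *m (X' *m K - K *m X') *m U^t*) i j).
Proof.
have p1 : 1 < p by case/andP: p12.
rewrite comm_entries absqM absqr sqr_sqrtr; last first.
  by rewrite beckner_weight_ge0 // divr_gt0 // mulr_gt0.
rewrite [RHS]mulrA (beckner_weightE p1 r0 (d0 i) (d0 j)) -/w.
have -> : U *m G *m U^t* = (q^-1)%:C *: (diag_mx (\row_i (g i)%:C) *m
    (U *m (X *m K - K *m X) *m U^t*) *m diag_mx (\row_i (g i)%:C)).
  rewrite GE; move: (X *m K - K *m X) => D; rewrite -scalemxAr -scalemxAl.
  by congr (_ *: _); rewrite udiagE !mulmxA (unitaryK uU) mul1mx (mulmxtVK _ uU).
move: (U *m _ *m U^t*) => k; rewrite mxE mul_mx_diag mul_diag_mx !mxE !absqM !absqr.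
by rewrite -!gg wE; ring.
Qed.

(** The matrix [G] stays fixed; only the operators in the kernel grow, from w Y and Y to w c
    tau^(1/p) and c tau^(1/p). The common factor c then comes out by homogeneity. *)
Lemma one_kraus_estimate :
  c `^ (p - 2) * Re (\tr (tau *m (X' *m K - K *m X')^t* *m (X' *m K - K *m X'))) <=
  \sum_i \sum_j (w * y i - y j) * ((w * y i) `^ s - y j `^ s) *
    absq ((W *m K *m W^t*) i j).
Proof.
have -> : \sum_i \sum_j (w * y i - y j) * ((w * y i) `^ s - y j `^ s) *
    absq ((W *m K *m W^t*) i j) =
    \sum_i \sum_j divpow s (w * y i) (y j) * absq ((W *m G *m W^t*) i j).
  apply: eq_bigr => i _; apply: eq_bigr => j _.
  by rewrite WG divpow_sqr; ring.
have -> : Re (\tr (tau *m (X' *m K - K *m X')^t* *m (X' *m K - K *m X'))) =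
    \sum_i \sum_j d j * absq ((U *m (X' *m K - K *m X') *m U^t*) i j).
  have := Re_tr_quad (fun=> 1) d (X' *m K - K *m X') uU uU.
  rewrite (udiag_cst 1 uU) rmorph1 mulmx1 => h.
  rewrite -mulmxA mxtrace_mulC h; apply: eq_bigr => i _; apply: eq_bigr => j _.
  by rewrite mul1r.
have wy i : 0 < w * y i by rewrite mulr_gt0.
have bp i : 0 < d i `^ p^-1 by rewrite powR_gt0.
have wb i : 0 < w * (c * d i `^ p^-1) by rewrite !mulr_gt0.
have cb i : 0 < c * d i `^ p^-1 by rewrite mulr_gt0.
have le_w : psdmx (udiag U (fun i => w * (c * d i `^ p^-1)) - udiag W (fun i => w * y i)).
  have zE V (a : 'I_n -> R) : udiag V (fun i => w * a i) = w%:C *: udiag V a.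
    by exact/esym/udiagZ.
  rewrite (zE U) (zE W) -scalerBr; exact: (psdZ (ltW w0) Y_le).
apply: le_trans (divpow_form_antitone G s01 uW uW uU uU wy y0 wb cb le_w Y_le).
rewrite mulr_sumr; apply: ler_sum => i _; rewrite mulr_sumr; apply: ler_sum => j _.
rewrite -UG mulrA ler_wpM2r ?absq_ge0 // [w * (c * _)]mulrCA divpow_scale //; last first.
  by rewrite mulr_gt0.
by have -> : p - 2 = s - 1 by ring.
Qed.

(** Multiply out the product of differences. Since w^p = r^-1 and w^(p-1) = r^-1 q^2, the terms
    carry the weights 1 and r^-1 of the Kraus form and of its GNS dual. *)
Lemma kraus_sum_expand :
  \sum_i \sum_j (w * y i - y j) * ((w * y i) `^ s - y j `^ s) *
    absq ((W *m K *m W^t*) i j) =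
  Re (\tr (udiag W (fun i => y i `^ p) *m (K^t* *m K))) +
  r^-1 * Re (\tr (udiag W (fun i => y i `^ p) *m (K *m K^t*))) -
  Re (\tr (udiag W (fun i => y i `^ s) *m (T *m (K^t* *m X *m K) *m T))) -
  r^-1 * Re (\tr (udiag W (fun i => y i `^ s) *m (T *m (K *m X *m K^t*) *m T))).
Proof.
have W1 : udiag W (fun=> 1) = 1%:M by rewrite (udiag_cst 1 uW) rmorph1.
have q1 := Re_tr_quad (fun=> 1) (fun i => y i `^ p) K uW uW.
have q2 := Re_tr_quad (fun i => y i `^ p) (fun=> 1) K uW uW.
have q3 := Re_tr_quad y (fun i => y i `^ s) K uW uW.
have q4 := Re_tr_quad (fun i => y i `^ s) y K uW uW.
rewrite W1 mulmx1 in q1; rewrite W1 mulmx1 in q2.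
have -> : Re (\tr (udiag W (fun i => y i `^ p) *m (K^t* *m K))) =
   \sum_i \sum_j 1 * y j `^ p * absq ((W *m K *m W^t*) i j).
  by rewrite mxtrace_mulC q1.
have -> : Re (\tr (udiag W (fun i => y i `^ p) *m (K *m K^t*))) =
   \sum_i \sum_j y i `^ p * 1 * absq ((W *m K *m W^t*) i j).
  by rewrite -q2 mulmxA mxtrace_mulC mulmxA.
have -> : Re (\tr (udiag W (fun i => y i `^ s) *m (T *m (K^t* *m X *m K) *m T))) =
   w * \sum_i \sum_j y i * y j `^ s * absq ((W *m K *m W^t*) i j).
  by rewrite (twist_conj qn0 Th power_kraus) TXT -wE -scalemxAr mxtraceZ cReMl mxtrace_mulC q3.
have -> : Re (\tr (udiag W (fun i => y i `^ s) *m (T *m (K *m X *m K^t*) *m T))) =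
   (q * q) * \sum_i \sum_j y i `^ s * y j * absq ((W *m K *m W^t*) i j).
  rewrite (twist_conj_dual qn0 Th power_kraus) TXT -scalemxAr mxtraceZ cReMl -q4 !mulmxA.
  by rewrite mxtrace_mulC !mulmxA.
rewrite !mulr_sumr -!sumrN -!big_split /=; apply: eq_bigr => i _.
rewrite !mulr_sumr -!sumrN -!big_split /=; apply: eq_bigr => j _.
have p_n0 : p != 0 := lt0r_neq0 p0.
have ps x : 0 < x -> x `^ p = x `^ s * x.
  move=> x0; rewrite -{3}[x]powRr1 ?(ltW x0) // -powRD ?subrK //.
  by rewrite (negbTE p_n0).
have ws : w `^ s = r^-1 * (q * q).
  rewrite /w -powRrM -powRD -?splitr; last by apply/implyP => _; exact: lt0r_neq0.
  rewrite -(powR_inv1 (ltW r0)) -powRD; last by apply/implyP => _; exact: lt0r_neq0.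
  by congr (_ `^ _); field.
have wp : w * w `^ s = r^-1.
  rewrite mulrC -ps // /w -powRrM mulNr mulVf // powR_inv1 //; exact: ltW.
rewrite powRM ?ltW // !ps //; move: (absq _) => A.
transitivity ((w * w `^ s) * (y i `^ s * y i) * A - w * y i * y j `^ s * A
  - w `^ s * y i `^ s * y j * A + y j `^ s * y j * A); first by ring.
by rewrite wp ws; ring.
Qed.

End OneKraus.

Variable Phi : {linear 'M[C]_n -> 'M[C]_n}.
Hypotheses (Phi_cp : completely_positive Phi) (Phi1 : Phi 1%:M = 1%:M).
Hypothesis Phi_gns : gns_symmetric tau Phi.

(** Summed over the Kraus operators, both sides come out doubled: the left one by invariance of tau,
    the right one because the family and its dual both represent [Phi]. *)
Lemma beckner_estimate :
  c `^ (p - 2) * Re (\tr (tau *m X'^t* *m (X' - Phi X'))) <=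
  Re (\tr (udiag W (fun i => y i `^ s) *m (T *m (X - Phi X) *m T))).
Proof.
have [I [K [r [KP r0 rK]]]] := modular_kraus uU d0 Phi_cp Phi_gns.
have dual := modular_kraus_dual uU d0 KP Phi_gns r0 rK.
have hP := kraus_trmxC KP.
have K1 := kraus_unital KP Phi1.
have K1' : \sum_a ((r a)^-1)%:C *: (K a *m (K a)^t*) = 1%:M.
  by rewrite -Phi1 dual; apply: eq_bigr => a _; rewrite mulmx1.
have inv Z : \tr (tau *m Phi Z) = \tr (tau *m Z).
  by have := gns_tr Phi_gns hP 1%:M Z; rewrite Phi1 mulmx1.
have half (a b : R) : 2 * a <= 2 * b -> a <= b by rewrite ler_pM2l // ltr0n.
apply: half; rewrite mulrCA.
have -> : 2 * Re (\tr (tau *m X'^t* *m (X' - Phi X'))) =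
    \sum_a Re (\tr (tau *m (X' *m K a - K a *m X')^t* *m (X' *m K a - K a *m X'))).
  under [RHS]eq_bigr => a _ do rewrite -mulmxA.
  rewrite -Re_sum -linear_sum -mulmx_sumr (kraus_defect KP Phi1) -hP.
  rewrite /= -tr_mul_comb inv !(mulmxA tau) -(gns_tr Phi_gns hP (X'^t*) X').
  rewrite mulmxBr mxtraceB !cReD !cReN.
  move: (Re _) (Re _) => a b; ring.
rewrite mulr_sumr.
apply: le_trans (ler_sum _ (fun a _ => one_kraus_estimate (r0 a) (rK a))) _.
rewrite (eq_bigr _ (fun a _ => kraus_sum_expand (r0 a) (rK a))).
rewrite le_eqVlt; apply/orP; left; apply/eqP.
set S := udiag W (fun i => y i `^ s); set Q := udiag W (fun i => y i `^ p).
rewrite !big_split !sumrN /=.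
have -> : \sum_a Re (\tr (Q *m ((K a)^t* *m K a))) = Re (\tr Q).
  by rewrite -Re_sum -linear_sum -mulmx_sumr K1 mulmx1.
have -> : \sum_a (r a)^-1 * Re (\tr (Q *m (K a *m (K a)^t*))) = Re (\tr Q).
  have -> : \tr Q = \sum_a \tr (Q *m (((r a)^-1)%:C *: (K a *m (K a)^t*))).
    by rewrite -{1}(mulmx1 Q) -K1' mulmx_sumr; exact: raddf_sum.
  rewrite Re_sum.
  by apply: eq_bigr => a _; rewrite -scalemxAr -cReMl -mxtraceZ.
have trS (F : I -> 'M[C]_n) : \tr (S *m (T *m (\sum_a F a) *m T)) =
    \sum_a \tr (S *m (T *m F a *m T)).
  by rewrite mulmx_sumr mulmx_suml mulmx_sumr; exact: raddf_sum.
have -> : \sum_a Re (\tr (S *m (T *m ((K a)^t* *m X *m K a) *m T))) =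
    Re (\tr (S *m (T *m Phi X *m T))).
  by rewrite KP trS Re_sum.
have -> : \sum_a (r a)^-1 * Re (\tr (S *m (T *m (K a *m X *m (K a)^t*) *m T))) =
    Re (\tr (S *m (T *m Phi X *m T))).
  rewrite dual trS Re_sum.
  apply: eq_bigr => a _.
  by rewrite -cReMl -mxtraceZ -!(scalemxAr, scalemxAl).
have SY : S *m udiag W y = Q.
  rewrite (udiagM _ _ uW); apply: eq_udiag => i.
  rewrite -{2}[y i]powRr1 ?ltW // -powRD ?subrK //.
  by rewrite (negbTE (lt0r_neq0 p0)).
have e : Re (\tr (S *m (T *m (X - Phi X) *m T))) =
    Re (\tr Q) - Re (\tr (S *m (T *m Phi X *m T))).
  by rewrite mulmxBr mulmxBl mulmxBr mxtraceB cReB TXT SY.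
apply: etrans (congr1 ( *%R 2) (esym e)); ring.
Qed.

End KrausEstimate.

(** * The spectral gap through eigenvalues of the generator *)

Section Poincare.
Variables (R : realType) (n : nat).
Local Notation C := R[i].
Variables (P : R -> {linear 'M[C]_n -> 'M[C]_n}) (L : {linear 'M[C]_n -> 'M[C]_n}).
Hypotheses (P_qms : qms P) (L_gen : generator_of P L).
Variables (V : 'M[C]_n) (e : 'I_n -> R).
Hypotheses (uV : V \is unitarymx) (e0 : forall i, 0 < e i).
Local Notation tau := (udiag V e).
Hypothesis L_gns : gns_symmetric tau L.
Implicit Types (X Y Z : 'M[C]_n).

Local Notation E := (condE P_qms L_gen uV e0 L_gns).

(** All forms are diagonal in a GNS eigenbasis, and the kernel of L contributes 0 to both sides. *)
Lemma gns_poincare (g : R) :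
  (forall B m, L B = m%:C *: B -> m != 0 -> B != 0 -> g <= - m) ->
  forall Y, g * (Re (\tr (tau *m Y^t* *m Y)) - Re (\tr (tau *m Y^t* *m E Y))) <=
    - Re (\tr (tau *m Y^t* *m L Y)).
Proof.
move=> gap Y; have [B [m [LB Borth Bgen]]] := gns_eigenbasis uV e0 L_gns.
have [c ->] := Bgen Y.
have -> : L (\sum_a c a *: B a) = \sum_a (c a * (m a)%:C) *: B a.
  by rewrite linear_sum; apply: eq_bigr => a _; rewrite linearZ /= LB scalerA.
have -> : E (\sum_a c a *: B a) = \sum_a (c a * ((m a == 0)%:R : R)%:C) *: B a.
  rewrite linear_sum; apply: eq_bigr => a _.
  rewrite linearZ /= -scalerA; congr (_ *: _).
  have := condE_eigen P_qms L_gen uV e0 L_gns (LB a); rewrite /= => ->.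
  by case: eqP => _; rewrite ?rmorph1 ?rmorph0 ?scale1r ?scale0r.
have dotE (k : 'I_(n * n) -> R) :
    Re (\tr (tau *m (\sum_a c a *: B a)^t* *m (\sum_a (c a * (k a)%:C) *: B a))) =
    \sum_a k a * absq (c a).
  rewrite (gns_dot_basis Borth) Re_sum; apply: eq_bigr => a _.
  by rewrite mulrA -absqE mulrC cReMl.
have dot1 : Re (\tr (tau *m (\sum_a c a *: B a)^t* *m (\sum_a c a *: B a))) =
    \sum_a absq (c a).
  rewrite (gns_dot_basis Borth) Re_sum; apply: eq_bigr => a _.
  by rewrite -absqE.
rewrite !dotE dot1 -sumrB -sumrN mulr_sumr; apply: ler_sum => a _.
have [m0|mn0] := eqVneq (m a) 0; first by rewrite m0 mul1r subrr mulr0 mul0r oppr0.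
rewrite mul0r subr0 -mulNr ler_wpM2r ?absq_ge0 //.
exact: gap (LB a) mn0 (basis_neq0 Borth a).
Qed.

Lemma wdotZ (tau0 : 'M[C]_n) (f : R -> R) (c : C) X Y :
  wdot tau0 f X (c *: Y) = c * wdot tau0 f X Y.
Proof.
rewrite /wdot /modular_fun linearZ /= -scalemxAl linearZ /= -scalemxAl.
by rewrite /hsdot -scalemxAr mxtraceZ.
Qed.

(** E annihilates an eigenvector with nonzero eigenvalue, and the weighted norm cancels from its
    Rayleigh quotient, whatever [tau0] and [f] are. *)
Lemma spectral_gap_le_eigen (tau0 : 'M[C]_n) (f : R -> R) B m :
  L B = m%:C *: B -> m != 0 -> B != 0 -> (spectral_gap P L tau0 f <= (- m)%:E)%E.
Proof.
move=> LB mn0 Bn0; have m_le0 := generator_eigen_le0 P_qms L_gen LB Bn0.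
have EB : cond_exp P B = 0.
  by have := condE_eigen P_qms L_gen uV e0 L_gns LB; rewrite (negbTE mn0).
apply: (@le_trans _ _ (- Re (wdot tau0 f B (L B)) /
   Re (wdot tau0 f (B - cond_exp P B) (B - cond_exp P B)))%:E).
  apply: ereal_inf_lbound; exists B => //= /(_ 1 ler01).
  rewrite (generator_eigen P_qms L_gen LB ler01) mulr1 => /eqP.
  rewrite -subr_eq0 -{2}[B]scale1r -scalerBl scaler_eq0 (negbTE Bn0) orbF.
  rewrite -(rmorph1 (real_complex R)) -rmorphB (fmorph_eq0 (real_complex R)).
  by rewrite subr_eq0 -expR0 (inj_eq (@expR_inj R)) (negbTE mn0).
rewrite lee_fin EB subr0 LB wdotZ cReMl; set w := Re _.
(* If the denominator vanishes, the quotient is 0 by convention, still at most [- m]. *)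
have [->|w0] := eqVneq w 0; first by rewrite mulr0 oppr0 mul0r oppr_ge0.
by rewrite mulNr mulfK.
Qed.

End Poincare.

(** * Powers of the reference state and the relative density of rho *)

Section ReferenceState.
Variables (R : realType) (n : nat).
Local Notation C := R[i].
Variables (P : R -> {linear 'M[C]_n -> 'M[C]_n}) (L : {linear 'M[C]_n -> 'M[C]_n}).
Hypotheses (P_qms : qms P) (L_gen : generator_of P L).
Variables (V : 'M[C]_n) (e : 'I_n -> R).
Hypotheses (uV : V \is unitarymx) (e0 : forall i, 0 < e i).
Local Notation tau := (udiag V e).
Hypothesis L_gns : gns_symmetric tau L.
Variables (rho : 'M[C]_n).
Hypotheses (rho_psd : psdmx rho) (rho_tr : \tr rho = 1) (rho_unit : rho \in unitmx).
Hypothesis tauE : forall X, hsdot (cond_exp P X) rho = hsdot X tau.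
Implicit Types (X Y Z : 'M[C]_n).

Local Notation E := (condE P_qms L_gen uV e0 L_gns).
Local Notation pw x := (udiag V (fun i => e i `^ x)).

Lemma pwM x y : pw x *m pw y = pw (x + y).
Proof.
rewrite (udiagM _ _ uV); apply: eq_udiag => i.
by rewrite -powRD //; apply/implyP => _; exact: lt0r_neq0.
Qed.

Lemma pw0 : pw 0 = 1%:M.
Proof.
transitivity (udiag V (fun=> 1)); last exact: udiag_cst.
by apply: eq_udiag => i; rewrite powRr0.
Qed.

Lemma pw1 : pw 1 = tau.
Proof. by apply: eq_udiag => i; rewrite powRr1 // ltW. Qed.

Lemma pw_herm x : (pw x)^t* = pw x.
Proof. exact: udiag_herm. Qed.

Lemma mul_pw (A : 'M[C]_n) x y : A *m pw x *m pw y = A *m pw (x + y).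
Proof. by rewrite -mulmxA pwM. Qed.

Lemma pw_sandwich x y (A : 'M[C]_n) :
  pw x *m (pw y *m A *m pw y) *m pw x = pw (x + y) *m A *m pw (x + y).
Proof.
have mul5 (a b a' b' : 'M[C]_n) : a *m (b *m A *m b') *m a' = (a *m b) *m A *m (b' *m a').
  by rewrite !mulmxA.
have yx : pw y *m pw x = pw (x + y).
  by apply: etrans (pwM y x) _; apply: eq_udiag => i; rewrite addrC.
exact: etrans (mul5 _ _ _ _) (congr2 (fun M N => M *m A *m N) (pwM x y) yx).
Qed.

Lemma sandwich_entries (a b : 'I_n -> R) (A : 'M[C]_n) i j :
  (V *m (udiag V a *m A *m udiag V b) *m V^t*) i j =
  (a i * b j)%:C * (V *m A *m V^t*) i j.
Proof.
rewrite !udiagE.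
have -> : V *m (V^t* *m diag_mx (\row_i (a i)%:C) *m V *m A *m
    (V^t* *m diag_mx (\row_i (b i)%:C) *m V)) *m V^t* =
    diag_mx (\row_i (a i)%:C) *m (V *m A *m V^t*) *m diag_mx (\row_i (b i)%:C).
  by rewrite !mulmxA (unitaryK uV) mul1mx (mulmxtVK _ uV).
rewrite mul_mx_diag mul_diag_mx !mxE rmorphM; ring.
Qed.

Lemma conj_inj (A B : 'M[C]_n) :
  (forall i j, (V *m A *m V^t*) i j = (V *m B *m V^t*) i j) -> A = B.
Proof.
move=> h; have cK D : D = V^t* *m (V *m D *m V^t*) *m V.
  by rewrite !mulmxA (unitaryKC uV) mul1mx (mulmxKtV _ uV).
have {h} : V *m A *m V^t* = V *m B *m V^t* by apply/matrixP.
by move=> h; rewrite [LHS]cK h -cK.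
Qed.

Let half : R := 2^-1.
Let X := pw (- half) *m rho *m pw (- half).

Lemma condE_pw Z : E (pw half *m Z *m pw (- half)) = pw half *m E Z *m pw (- half).
Proof.
apply: conj_inj => i j; rewrite sandwich_entries.
have h k l : e k `^ half * e l `^ (- half) = (e k / e l) `^ half.
  by rewrite powRM ?powR_inv ?powRN // ?invr_ge0 ltW.
rewrite h; apply: (gns_schur uV e0 (h := fun z => z `^ half)
  (condE_gns P_qms L_gen uV e0 L_gns) (condE_trmxC P_qms L_gen uV e0 L_gns)) => k l.
by rewrite sandwich_entries h.
Qed.

Let hh : half + half = 1. Proof. by rewrite /half; field. Qed.

(** E commutes with conjugation by tau^(1/2), so it is also symmetric for Tr(tau^(1/2) A^* tau^(1/2)
    B). Hence tau^(1/2) E(X) tau^(1/2) is the image of rho under the adjoint of E, namely tau. *)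
Lemma condE_density : E X = 1%:M.
Proof.
suff h : pw half *m E X *m pw half = pw half *m pw half.
  have c1 Z : pw (- half) *m (pw half *m Z *m pw half) *m pw (- half) = Z.
    by rewrite !mulmxA pwM addNr pw0 mul1mx mul_pw subrr pw0 mulmx1.
  have c2 : pw (- half) *m (pw half *m pw half) *m pw (- half) = 1%:M.
    exact: etrans (congr1 (fun Z => pw (- half) *m (Z *m pw half) *m pw (- half))
      (esym (mulmx1 (pw half)))) (c1 1%:M).
  exact: etrans (esym (c1 (E X)))
    (etrans (congr1 (fun Z => pw (- half) *m Z *m pw (- half)) h) c2).
apply/eqP; rewrite -subr_eq0; apply/eqP; apply: tr_mul_eq0 => Z'.
rewrite -[Z']trmxCK; move: (Z'^t*) => Z {Z'}.
rewrite mulmxBr mxtraceB; apply/eqP; rewrite subr_eq0; apply/eqP.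
have -> : \tr (Z^t* *m (pw half *m pw half)) = \tr ((E Z)^t* *m rho).
  by rewrite pwM hh pw1; exact/esym/tauE.
have -> : rho = pw half *m X *m pw half.
  rewrite /X !mulmxA pwM subrr pw0 mul1mx -mulmxA pwM.
  by rewrite addNr pw0 mulmx1.
have key : \tr (tau *m (pw half *m Z *m pw (- half))^t* *m E X) =
    \tr (tau *m (pw half *m E Z *m pw (- half))^t* *m X).
  by have := condE_gns P_qms L_gen uV e0 L_gns (pw half *m Z *m pw (- half)) X;
    rewrite condE_pw.
have red (A B : 'M[C]_n) : \tr (tau *m (pw half *m A *m pw (- half))^t* *m B) =
    \tr (A^t* *m (pw half *m B *m pw half)).
  have adj3 (a b : 'M[C]_n) : (a *m A *m b)^t* = b^t* *m A^t* *m a^t*.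
    by rewrite !trmxC_mul mulmxA.
  have cyc (t a b D : 'M[C]_n) : t *m b = a ->
      \tr (t *m (b *m D *m a) *m B) = \tr (D *m (a *m B *m a)).
    move=> tb; have -> : t *m (b *m D *m a) *m B = (t *m b) *m (D *m a *m B) by rewrite !mulmxA.
    by rewrite mxtrace_mulC tb !mulmxA.
  have tau_pw : tau *m pw (- half) = pw half.
    apply: etrans (congr1 (mulmx^~ _) (esym pw1)) _; apply: etrans (pwM _ _) _.
    by apply: eq_udiag => i; rewrite -hh addrK.
  have adj : (pw half *m A *m pw (- half))^t* = pw (- half) *m A^t* *m pw half.
    exact: etrans (adj3 _ _) (congr2 (fun M N => M *m A^t* *m N) (pw_herm _) (pw_herm _)).
  exact: etrans (congr1 (fun M => \tr (tau *m M *m B)) adj) (cyc _ _ _ _ tau_pw).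
by rewrite -!red.
Qed.

End ReferenceState.

(** * Both sides of the Beckner inequality in terms of the spectrum of Y *)

Section BecknerTerms.
Variables (R : realType) (n : nat).
Local Notation C := R[i].
Variables (V : 'M[C]_n) (e : 'I_n -> R).
Hypotheses (uV : V \is unitarymx) (e0 : forall i, 0 < e i).
Local Notation tau := (udiag V e).
Local Notation pw x := (udiag V (fun i => e i `^ x)).
Variables (p : R) (rho : 'M[C]_n).
Hypotheses (p12 : 1 < p <= 2) (rho_psd : psdmx rho) (rho_tr : \tr rho = 1).
Hypothesis tau_tr : \tr tau = 1.
Local Notation X := (weight tau (- 1) rho).
Local Notation Y := (weight tau p^-1 X).
Variables (W : 'M[C]_n) (y : 'I_n -> R).
Hypotheses (uW : W \is unitarymx) (y0 : forall i, 0 < y i) (YE : Y = udiag W y).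

Let p0 : 0 < p. Proof. by case/andP: p12 => /(lt_trans ltr01). Qed.
Let pn0 : p != 0. Proof. exact: lt0r_neq0. Qed.
Let s01 : 0 < p - 1 <= 1.
Proof. by case/andP: p12 => p1 p2; rewrite subr_gt0 p1 lerBlDr. Qed.

Lemma weight_udiag s Z : weight tau s Z = pw (s / 2) *m Z *m pw (s / 2).
Proof. by rewrite /weight !(mxpow_udiag _ _ uV). Qed.

Lemma weight_weight s t Z : weight tau s (weight tau t Z) = weight tau (s + t) Z.
Proof.
by rewrite !weight_udiag (pw_sandwich uV e0) mulrDl.
Qed.

Lemma pdivergenceE : pdivergence p tau rho = (p * (p - 1))^-1 * (\sum_i y i `^ p - 1).
Proof.
rewrite /pdivergence /wnorm YE /absmx udiag_herm (udiagM _ _ uW) (mxpow_udiag _ _ uW).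
rewrite (mxpow_udiag _ _ uW) (tr_udiag _ uW) /=.
rewrite -powRrM mulVf // powRr1; last by apply: sumr_ge0 => i _; exact: powR_ge0.
congr (_ * (_ - _)); apply: eq_bigr => i _; congr (_ `^ _).
by rewrite -expr2 powR12_sqrt ?sqr_ge0 // sqrtr_sqr ger0_norm // ltW.
Qed.

Lemma dirichletE (L : {linear 'M[C]_n -> 'M[C]_n}) :
  dirichlet p tau L X = - (p / (p - 1) * p / 4) *
   Re (\tr (udiag W (fun i => y i `^ (p - 1)) *m
     (pw (p^-1 / 2) *m L X *m pw (p^-1 / 2)))).
Proof.
rewrite /dirichlet YE (mxpow_udiag _ _ uW) (mxpow_udiag _ _ uV).
congr (_ * Re _); set S := udiag W _; rewrite weight_udiag.
set Z := L X.
have a1 : 2^-1 + - (p / (p - 1))^-1 / 2 = p^-1 / 2.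
  have := pn0; have : p - 1 != 0 by case/andP: s01 => /lt0r_neq0.
  by move=> h1 h2; field; rewrite h1 h2.
rewrite (pw_sandwich uV e0) a1.
by rewrite -!mulmxA mxtrace_mulC -!mulmxA.
Qed.

(** All powers of tau cancel and leave the trace of rho. This evaluates the linear term of
    [tr_pow_tangent]. *)
Lemma reference_tr : Re (\tr (Y *m pw ((p - 1) / p))) = 1.
Proof.
rewrite weight_weight weight_udiag (mul_pw uV e0) mxtrace_mulC mulmxA (pwM uV e0).
have -> : (p^-1 - 1) / 2 + (p - 1) / p + (p^-1 - 1) / 2 = 0 by field; exact: pn0.
by rewrite (pw0 e uV) mul1mx rho_tr.
Qed.

(** Hoelder's inequality for Y and tau^((p-1)/p), whose product has trace 1: Young's inequality at
    each pair of eigenvalues, weighted by the squared overlaps of the eigenvectors. *)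
Lemma sum_powR_ge1 : 1 <= \sum_i y i `^ p.
Proof.
have p1 : 1 < p by case/andP: p12.
have pp : 0 < p - 1 by case/andP: s01.
have idU (U : 'M[C]_n) : U \is unitarymx -> udiag U (fun=> 1) = 1%:M.
  by move=> uU; rewrite (udiag_cst 1 uU) rmorph1.
have := reference_tr; rewrite YE; set b := fun i => e i `^ ((p - 1) / p).
have -> : Re (\tr (udiag W y *m udiag V b)) =
    \sum_i \sum_j y i * b j * absq ((W *m 1%:M *m V^t*) i j).
  by rewrite -(Re_tr_quad _ _ _ uW uV) trmxC1 mul1mx mulmx1.
set w := fun i j => absq ((W *m 1%:M *m V^t*) i j) => tr1.
have w0 i j : 0 <= w i j by exact: absq_ge0.
have young i j : y i * b j <= y i `^ p / p + e j * ((p - 1) / p).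
  have c0 : 0 < p / (p - 1) by rewrite divr_gt0.
  have cc : p^-1 + (p / (p - 1))^-1 = 1 by field; rewrite pn0 (lt0r_neq0 pp).
  have := conjugate_powR (ltW (y0 i)) (powR_ge0 (e j) ((p - 1) / p)) p0 c0 cc.
  rewrite /b -powRrM.
  have -> : (p - 1) / p * (p / (p - 1)) = 1 by field; rewrite pn0 (lt0r_neq0 pp).
  by rewrite powRr1 ?(ltW (e0 j)) // invf_div.
have sumE : \sum_i \sum_j (y i `^ p / p * 1 * w i j + 1 * (e j * ((p - 1) / p)) * w i j) =
    (\sum_i y i `^ p) / p + (p - 1) / p.
  under eq_bigr => i _ do rewrite big_split; rewrite big_split /=.
  rewrite -(Re_tr_quad _ _ 1%:M uW uV) -(Re_tr_quad _ _ 1%:M uW uV).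
  rewrite (idU _ uW) (idU _ uV) trmxC1 !mul1mx !mulmx1.
  rewrite (tr_udiag _ uW) (tr_udiag _ uV) /= -mulr_suml -mulr_suml.
  have -> : \sum_i e i = 1.
    by apply: (@complexI R); rewrite -(tr_udiag _ uV) tau_tr.
  by rewrite mul1r.
have : 1 <= (\sum_i y i `^ p) / p + (p - 1) / p.
  rewrite -sumE -[leLHS]tr1; apply: ler_sum => i _; apply: ler_sum => j _.
  by rewrite -mulrDl mulr1 mul1r; exact: (ler_wpM2r (w0 i j) (young i j)).
by rewrite -mulrDl ler_pdivlMr // mul1r -lerBlDr opprB addrC subrK.
Qed.

(** The square root of [beckner_weight] applied to the modular operator; in a quadratic form the
    weight itself reappears. *)
Definition schur_multiplier (Z : 'M[C]_n) : 'M[C]_n :=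
  V^t* *m (\matrix_(i, j) ((Num.sqrt (beckner_weight p (e i / e j)))%:C *
    (V *m Z *m V^t*) i j)) *m V.

Lemma schur_multiplierE Z i j : (V *m schur_multiplier Z *m V^t*) i j =
  (Num.sqrt (beckner_weight p (e i / e j)))%:C * (V *m Z *m V^t*) i j.
Proof.
by rewrite /schur_multiplier !mulmxA (unitaryK uV) mul1mx (mulmxtVK _ uV) mxE.
Qed.

(** The kernel identity at ratio 1: the GNS norm of X' is the quadratic term of [tr_pow_tangent] at
    tau^(1/p). *)
Lemma schur_multiplier_gram :
  Re (\tr (tau *m (schur_multiplier X)^t* *m schur_multiplier X)) =
  \sum_i \sum_j divpow (p - 1) (e i `^ p^-1) (e j `^ p^-1) *
    absq ((V *m Y *m V^t*) i j).
Proof.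
have p1 : 1 < p by case/andP: p12.
set G := schur_multiplier X.
have -> : \tr (tau *m G^t* *m G) = \tr (G^t* *m udiag V (fun=> 1) *m G *m tau).
  by rewrite (udiag_cst 1 uV) rmorph1 mulmx1 -mulmxA mxtrace_mulC.
rewrite (Re_tr_quad _ _ _ uV uV); apply: eq_bigr => i _; apply: eq_bigr => j _.
rewrite schur_multiplierE; move: (weight tau (- 1) rho) => Z.
rewrite weight_udiag (sandwich_entries uV) !absqM !absqr.
have eij : 0 < e i / e j by rewrite divr_gt0.
rewrite sqr_sqrtr ?beckner_weight_ge0 // mul1r.
have h k : (e k `^ (p^-1 / 2)) ^+ 2 = e k `^ p^-1.
  rewrite expr2 -powRD -?splitr //; apply/implyP => _; exact: lt0r_neq0.
rewrite exprMn !h.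
have := beckner_weightE p1 (@ltr01 R) (e0 i) (e0 j).
by rewrite powR1 !mul1r => bE; rewrite mulrA bE; ring.
Qed.

End BecknerTerms.

(** * The inequality for one density *)

Section BecknerInequality.
Variables (R : realType) (n : nat).
Local Notation C := R[i].
Variables (P : R -> {linear 'M[C]_n -> 'M[C]_n}) (L : {linear 'M[C]_n -> 'M[C]_n}).
Hypotheses (P_qms : qms P) (L_gen : generator_of P L).
Variables (V : 'M[C]_n) (e : 'I_n -> R).
Hypotheses (uV : V \is unitarymx) (e0 : forall i, 0 < e i).
Local Notation tau := (udiag V e).
Hypothesis L_gns : gns_symmetric tau L.
Variables (p : R) (rho : 'M[C]_n).
Hypotheses (p12 : 1 < p <= 2) (rho_psd : psdmx rho) (rho_tr : \tr rho = 1)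
  (rho_unit : rho \in unitmx).
Hypothesis tau_tr : \tr tau = 1.
Local Notation pw x := (udiag V (fun i => e i `^ x)).
Local Notation X := (weight tau (- 1) rho).
Local Notation Y := (weight tau p^-1 X).
Local Notation E := (condE P_qms L_gen uV e0 L_gns).

Lemma weight_eigen s : exists (W : 'M[C]_n) (y : 'I_n -> R),
  [/\ W \is unitarymx, forall i, 0 < y i & weight tau s rho = udiag W y].
Proof.
have pwU x : pw x \in unitmx.
  by apply: (udiag_posunit uV) => i; exact: powR_gt0.
apply: posdef_udiag.
  rewrite (weight_udiag _ uV) -[X in X *m _ *m _](udiag_herm V).
  exact: psd_congr.
by rewrite (weight_udiag _ uV) !unitmx_mul !pwU rho_unit.
Qed.

Lemma pdivergence_ge0 : 0 <= pdivergence p tau rho.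
Proof.
have [W [y [uW y0 YE]]] := weight_eigen (p^-1 - 1).
have {}YE : Y = udiag W y by rewrite (weight_weight uV e0).
rewrite (pdivergenceE p12 uW y0 YE); have /andP[p1 _] := p12.
rewrite mulr_ge0 ?invr_ge0 ?mulr_ge0 ?subr_ge0 ?(ltW p1) //.
  by rewrite ltW // (lt_trans ltr01).
exact: (sum_powR_ge1 uV e0 p12 rho_tr tau_tr uW y0 YE).
Qed.

Hypothesis tauE : forall Z, hsdot (cond_exp P Z) rho = hsdot Z tau.
Variables (c g : R).
Hypotheses (c0 : 0 < c) (rho_le : lemx rho (c%:C *: tau)) (g0 : 0 <= g).
Hypothesis gap : forall B m, L B = m%:C *: B -> m != 0 -> B != 0 -> g <= - m.

Lemma condE_weight : E X = 1%:M.
Proof.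
by rewrite (weight_udiag _ uV) mulN1r; exact: (condE_density P_qms L_gen uV e0 L_gns tauE).
Qed.

Local Notation X' := (schur_multiplier V e p X).

Lemma condE_schur_multiplier : E X' = (Num.sqrt (p - 1))%:C%:M.
Proof.
apply: (conj_inj uV) => i j.
rewrite (gns_schur uV e0 (h := fun z => Num.sqrt (beckner_weight p z))
  (condE_gns P_qms L_gen uV e0 L_gns) (condE_trmxC P_qms L_gen uV e0 L_gns)
  (schur_multiplierE e uV p X)).
rewrite condE_weight mulmx1 mul_mx_scalar -scalemxAl (unitaryK uV) !mxE.
case: eqVneq => [->|_]; last by rewrite !mulr0.
by rewrite divff ?beckner_weight1 // lt0r_neq0.
Qed.

Lemma condE_schur_gram : Re (\tr (tau *m X'^t* *m E X')) = p - 1.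
Proof.
have fixedE : E (E X') = E X' by rewrite condE_fixed // generator_condE.
rewrite -fixedE (condE_gns P_qms L_gen uV e0 L_gns) condE_schur_multiplier.
have sh : (Num.sqrt (p - 1))%:C%:M^t* = (Num.sqrt (p - 1))%:C%:M :> 'M[C]_n.
  by rewrite -(udiag_cst _ uV) udiag_herm.
rewrite sh !mul_mx_scalar !mxtraceZ tau_tr mulr1 -rmorphM /= -expr2 sqr_sqrtr //.
by case/andP: p12 => /ltW p1 _; rewrite subr_ge0.
Qed.

Section Spectral.
Variables (W : 'M[C]_n) (y : 'I_n -> R).
Hypotheses (uW : W \is unitarymx) (y0 : forall i, 0 < y i) (YE : Y = udiag W y).
Local Notation T := (pw (p^-1 / 2)).
Local Notation S := (udiag W (fun i => y i `^ (p - 1))).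

(** The index inequality rho <= c tau, sandwiched by the power (1/p - 1)/2 of tau. *)
Let weighted_le : psdmx (udiag V (fun i => c * e i `^ p^-1) - udiag W y).
Proof.
have h (A : 'M[C]_n) : psdmx A -> psdmx (weight tau (p^-1 - 1) A).
  move=> pA; rewrite (weight_udiag _ uV) -[Z in Z *m _ *m _](udiag_herm V).
  exact: psd_congr.
have := h _ rho_le; rewrite -YE (weight_weight uV e0) !(weight_udiag _ uV).
rewrite mulmxBr mulmxBl -scalemxAr -scalemxAl.
have -> : pw ((p^-1 - 1) / 2) *m tau *m pw ((p^-1 - 1) / 2) = pw p^-1.
  rewrite -(pw1 V e0) (pwM uV e0) (pwM uV e0); apply: eq_udiag => i.
  by congr (_ `^ _); field; case/andP: p12 => /(lt_trans ltr01)/lt0r_neq0.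
by rewrite udiagZ.
Qed.

Lemma dirichlet_estimate :
  c `^ (p - 2) * - Re (\tr (tau *m X'^t* *m L X')) <=
  - Re (\tr (S *m (T *m L X *m T))).
Proof.
pose A := - (T *m S *m T); pose B := (c `^ (p - 2))%:C *: (tau *m X'^t*).
have trA Z : Re (\tr (A *m Z)) = - Re (\tr (S *m (T *m Z *m T))).
  have -> : \tr (A *m Z) = - \tr (T *m S *m T *m Z) by rewrite /A mulNmx; exact: raddfN.
  rewrite cReN; congr (- Re _).
  by rewrite -!mulmxA mxtrace_mulC -!mulmxA.
have trB Z : Re (\tr (B *m Z)) = c `^ (p - 2) * Re (\tr (tau *m X'^t* *m Z)).
  by rewrite /B -scalemxAl mxtraceZ cReMl.
have trN (D Z Z' : 'M[C]_n) : Re (\tr (D *m (Z - Z'))) = - Re (\tr (D *m (Z' - Z))).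
  by rewrite -(opprB Z' Z) mulmxN -cReN; congr Re; exact: raddfN.
have lim : 0 <= Re (\tr (A *m L X) + \tr (B *m L X')).
  apply: (generator_limit_ge0 L_gen) => h h0.
  have := beckner_estimate uV e0 p12 uW y0 _ c0 weighted_le
    (schur_multiplierE e uV p X) (qms_cp P_qms (ltW h0)) (qms_unital P_qms (ltW h0))
    (qms_gns P_qms L_gen uV e0 L_gns (ltW h0)).
  rewrite -(weight_udiag _ uV) => /(_ YE).
  rewrite cReD !(trN _ (P h _)) trA trB.
  move: (Re _) (Re _) => a b; lra.
move: lim; rewrite cReD trA trB mulrN; move: (Re _) (Re _) => a b; lra.
Qed.

Lemma density_beckner_eigen :
  p / 4 * c `^ (p - 2) * g * pdivergence p tau rho <=
  p ^- 2 * dirichlet p tau L X.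
Proof.
rewrite (pdivergenceE p12 uW y0 YE) (dirichletE uV e0 p12 uW YE).
have poin := gns_poincare P_qms L_gen uV e0 L_gns gap X'.
have diri := dirichlet_estimate.
have p0 : 0 < p by case/andP: p12 => /(lt_trans ltr01).
have pp : 0 < p - 1 by case/andP: p12; rewrite subr_gt0.
have s01 : 0 < p - 1 <= 1 by case/andP: p12 => _ p2; rewrite pp lerBlDr.
have tang := tr_pow_tangent s01 uV uW (fun i => powR_gt0 p^-1 (e0 i)) y0.
have betaE : udiag V (fun i => (e i `^ p^-1) `^ (p - 1)) = pw ((p - 1) / p).
  by apply: eq_udiag => i; rewrite -powRrM mulrC.
move: tang; rewrite betaE -YE -(schur_multiplier_gram uV e0 rho p12).
rewrite (reference_tr uV e0 p12 rho_tr) (_ : 1 + (p - 1) = p); last by ring.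
move: diri poin; rewrite condE_schur_gram.
move: (Re (\tr (tau *m X'^t* *m L X'))) (Re (\tr (tau *m X'^t* *m X'))) => l q.
move: (Re _) (\sum_i _) (powR_ge0 c (p - 2)) => D Q k0 diri poin tang.
(* The linear term of the tangent inequality has trace 1, so it contributes exactly 2 - p. *)
have h0 : Q - 1 <= q - (p - 1).
  by apply: le_trans (lerB tang (lexx 1)) _; rewrite le_eqVlt; apply/orP; left; apply/eqP; ring.
have h1 := le_trans (ler_wpM2l g0 h0) poin.
have h2 := le_trans (ler_wpM2l k0 h1) diri.
(* Both normalizations become 1/(4(p-1)), which fixes the factor p/4. *)
have -> : p / 4 * c `^ (p - 2) * g * ((p * (p - 1))^-1 * (Q - 1)) =
    (4 * (p - 1))^-1 * (c `^ (p - 2) * (g * (Q - 1))).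
  by field; rewrite (lt0r_neq0 p0) (lt0r_neq0 pp).
have -> : p ^- 2 * (- (p / (p - 1) * p / 4) * D) = (4 * (p - 1))^-1 * - D.
  by field; rewrite (lt0r_neq0 p0) (lt0r_neq0 pp).
apply: (ler_wpM2l _ h2); rewrite invr_ge0.
exact: (mulr_ge0 (ler0n _ 4) (ltW pp)).
Qed.

End Spectral.

Lemma density_beckner :
  p / 4 * c `^ (p - 2) * g * pdivergence p tau rho <=
  p ^- 2 * dirichlet p tau L X.
Proof.
have [W [y [uW y0 YE]]] := weight_eigen (p^-1 - 1).
by apply: (density_beckner_eigen uW y0); rewrite (weight_weight uV e0).
Qed.

End BecknerInequality.

(** * The optimal constant *)

Section BecknerConstant.
Variables (R : realType) (n : nat).
Local Notation C := R[i].
Variables (P : R -> {linear 'M[C]_n -> 'M[C]_n}) (L : {linear 'M[C]_n -> 'M[C]_n}).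
Hypotheses (P_qms : qms P) (L_gen : generator_of P L).
Variables (sigma : 'M[C]_n) (p : R).
Hypotheses (sigma_full : full_density sigma) (L_gns : gns_symmetric sigma L).
Hypothesis p12 : 1 < p <= 2.

Let sigma_udiag : exists (U : 'M[C]_n) (d : 'I_n -> R),
  [/\ U \is unitarymx, forall i, 0 < d i & sigma = udiag U d].
Proof. by case: sigma_full => -[sigma_psd _]; exact: posdef_udiag. Qed.

Lemma pdivergence_cond_exp_adj_ge0 rho : full_density rho ->
  0 <= pdivergence p (cond_exp_adj P rho) rho.
Proof.
have [U [d [uU d0 sE]]] := sigma_udiag; have sg := L_gns; rewrite sE in sg.
move=> [[rho_psd rho_tr] rho_unit].
have tau_tr := cond_exp_adj_tr P_qms L_gen uU d0 sg rho_tr.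
have [V [e [uV e0 tE]]] := cond_exp_adj_udiag P_qms L_gen uU d0 sg rho_psd rho_unit.
by rewrite tE; apply: pdivergence_ge0 => //; rewrite -tE.
Qed.

Lemma subalg_index_gt0 : 0 < subalg_index P.
Proof.
have [U [d [uU d0 sE]]] := sigma_udiag; have sg := L_gns; rewrite sE in sg.
apply: (lt_le_trans ltr01); apply: (subalg_index_ge1 P_qms L_gen uU d0 sg).
by rewrite -sE; case: sigma_full => -[].
Qed.

(** Stated for a real [g] below the nonzero spectrum of -L, because the spectral gap may be
    infinite. *)
Lemma beckner_eigen_gap (g : R) : 0 <= g ->
  (forall B m, L B = m%:C *: B -> m != 0 -> B != 0 -> g <= - m) ->
  beckner P L p (p / 4 * subalg_index P `^ (p - 2) * g).
Proof.
move=> g0 gap rho rho_full /=; set tau := cond_exp_adj P rho.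
have [U [d [uU d0 sE]]] := sigma_udiag; have sg := L_gns; rewrite sE in sg.
have [[rho_psd rho_tr] rho_unit] := rho_full.
have tau_tr : \tr tau = 1 := cond_exp_adj_tr P_qms L_gen uU d0 sg rho_tr.
have tau_gns : gns_symmetric tau L :=
  generator_gns_cond_exp_adj P_qms L_gen uU d0 sg rho_psd rho_unit.
have rho_le : lemx rho ((subalg_index P)%:C *: tau) :=
  subalg_index_le P_qms L_gen uU d0 sg (conj rho_psd rho_tr).
have tauE Z : hsdot (cond_exp P Z) rho = hsdot Z tau :=
  esym (cond_exp_adjE P_qms L_gen uU d0 sg Z rho).
have [V [e [uV e0 tE]]] : exists (V : 'M[C]_n) (e : 'I_n -> R),
    [/\ V \is unitarymx, forall i, 0 < e i & tau = udiag V e] :=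
  cond_exp_adj_udiag P_qms L_gen uU d0 sg rho_psd rho_unit.
move: tau_tr tau_gns rho_le tauE; rewrite tE => tau_tr tau_gns rho_le tauE.
exact: (density_beckner P_qms L_gen uV e0 tau_gns p12 rho_psd rho_tr rho_unit tau_tr
  tauE subalg_index_gt0 rho_le g0 gap).
Qed.

(** Taking g = 0 shows that the Dirichlet form is nonnegative at every full-rank density. *)
Lemma beckner0 : beckner P L p 0.
Proof.
have := @beckner_eigen_gap 0 (lexx 0); rewrite mulr0; apply => B m LB m0 B0.
by rewrite oppr_ge0 (generator_eigen_le0 P_qms L_gen LB B0).
Qed.

(** If [alpha] failed at some rho, the quotient of the Dirichlet term by the divergence would lie
    strictly below the supremum, hence below an admissible constant. Where the divergence is 0, the
    inequality is the nonnegativity of the Dirichlet form. *)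
Lemma beckner_constant_attained alpha :
  (alpha%:E <= beckner_constant P L p)%E -> beckner P L p alpha.
Proof.
move=> a_le rho rho_full /=; set tau := cond_exp_adj P rho; rewrite leNgt; apply/negP => lt_a.
have F0 := pdivergence_cond_exp_adj_ge0 rho_full; rewrite -/tau in F0.
have D0 : 0 <= p ^- 2 * dirichlet p tau L (weight tau (- 1) rho).
  by have := beckner0 rho_full; rewrite /= mul0r.
have Fn0 : 0 < pdivergence p tau rho.
  rewrite lt0r F0 andbT; apply/eqP => F00.
  by move: lt_a; rewrite F00 mulr0 ltNge D0.
move: lt_a; rewrite -ltr_pdivrMr // => lt_a.
have := lt_le_trans _ a_le; rewrite -lte_fin in lt_a; move=> /(_ _ lt_a).
case/ereal_sup_gt => _ [beta hb <-]; rewrite lte_fin ltr_pdivrMr // ltNge => /negP; apply.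
exact: hb.
Qed.

Lemma beckner_constant_ge (tau : 'M[C]_n) (f : R -> R) :
  ((p / 4 * subalg_index P `^ (p - 2))%:E * spectral_gap P L tau f <=
   beckner_constant P L p)%E.
Proof.
have [U [d [uU d0 sE]]] := sigma_udiag; have sg := L_gns; rewrite sE in sg.
have p0 : 0 < p by case/andP: p12 => /(lt_trans ltr01).
set k := p / 4 * _; have k0 : 0 < k.
  by rewrite mulr_gt0 ?divr_gt0 ?ltr0n // powR_gt0 // subalg_index_gt0.
have gap B m : L B = m%:C *: B -> m != 0 -> B != 0 -> (spectral_gap P L tau f <= (- m)%:E)%E.
  exact: (spectral_gap_le_eigen P_qms L_gen uU d0 sg tau f).
have reach g : 0 <= g ->
    (forall B m, L B = m%:C *: B -> m != 0 -> B != 0 -> g <= - m) ->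
    ((k * g)%:E <= beckner_constant P L p)%E.
  move=> g0 hg; apply: ereal_sup_ubound; exists (k * g) => //.
  exact: beckner_eigen_gap.
move: gap; case: (spectral_gap P L tau f) => [g| |] gap.
(* [reach] asks for a nonnegative number; raising [g] to at least 0 keeps it below every [- m]. *)
- apply: (@le_trans _ _ (k * Num.max g 0)%:E).
    by rewrite -EFinM lee_fin ler_pM2l // le_max lexx.
  apply: reach => [|B m LB m0 B0]; first by rewrite le_max lexx orbT.
  rewrite ge_max oppr_ge0 (generator_eigen_le0 P_qms L_gen LB B0) andbT.
  by rewrite -lee_fin; exact: gap LB m0 B0.
(* An infinite gap excludes nonzero eigenvalues, so [reach] applies to every nonnegative real and
   the constant is infinite too. *)
- rewrite gt0_muley ?lte_fin // leye_eq; apply/eqP/eqyP => A A0.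
  rewrite -(divfK (lt0r_neq0 k0) A) mulrC; apply: reach => [|B m LB m0 B0].
    by rewrite divr_ge0 // ltW.
  by have := gap B m LB m0 B0; rewrite leye_eq.
- by rewrite gt0_muleNy ?lte_fin // leNye.
Qed.

End BecknerConstant.

Theorem theoremC1 (R : realType) (n : nat)
    (P : R -> {linear 'M[R[i]]_n -> 'M[R[i]]_n})
    (L : {linear 'M[R[i]]_n -> 'M[R[i]]_n})
    (sigma tau : 'M[R[i]]_n) (f : R -> R) (p : R)
    (P_qms : qms P) (L_gen : generator_of P L)
    (sigma_full : full_density sigma) (L_gns : gns_symmetric sigma L)
    (tau_full : full_density tau) (tau_inv : invariant_state P tau)
    (f_gt0 : forall x : R, 0 < x -> 0 < f x)
    (p_itv : 1 < p <= 2) :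
  (forall alpha : R,
     (alpha%:E <= beckner_constant P L p)%E -> beckner P L p alpha) /\
  ((p / 4 * subalg_index P `^ (p - 2))%:E * spectral_gap P L tau f
     <= beckner_constant P L p)%E.
Proof.
split => [alpha|]; first exact: (beckner_constant_attained P_qms L_gen sigma_full L_gns p_itv).
exact: (beckner_constant_ge P_qms L_gen sigma_full L_gns p_itv).
Qed.
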